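(* Let $H\in(\frac12,\frac34)$, let $\theta\in(0,1)$, and let $\xi=(\xi_t)_{t\in\mathbb Z}$ be a centered stationary Gaussian sequence satisfying the Hypothesis stated in the context with this $H$. Let $X_0=0$, $X_t=\theta X_{t-1}+\xi_t$ for $t\ge1$, and let $\tilde\theta_n=f^{-1}\big(\frac1n\sum_{t=1}^nX_t^2\big)$ be the second moment estimator of $\theta$, with $f$ as in the context. Let $Z$ be a standard Gaussian random variable and set $$G_n=\frac{f'(\theta)\sqrt n\,(\tilde\theta_n-\theta)}{\sigma_H},\qquad \sigma_H=\Big(2\sum_{k\in\mathbb Z}R^2(k)\Big)^{1/2},$$ where $R(k)=\mathbb E(Y_0Y_k)$ is the covariance function of the stationary solution $Y_t=\sum_{j=0}^\infty\theta^j\xi_{t-j}$. Then $(G_n)$ satisfies an almost sure central limit theorem: almost surely, for all $z\in\mathbb R$, $$\frac1{\log n}\sum_{k=1}^n\frac1k\mathbf 1_{\{G_k\le z\}}\to P(Z\le z)\quad\text{as }n\to\infty;$$ or, equivalently, almost surely, for all continuous and bounded functions $\varphi:\mathbb R\to\mathbb R$, $$\frac1{\log n}\sum_{k=1}^n\frac1k\varphi(G_k)\to\mathbb E[\varphi(Z)]\quad\text{as }n\to\infty.$$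
   Context: **Slow variation.** A positive function $L$ defined for $x>x_0$ is slowly varying at infinity in Zygmund's sense if for every $\delta>0$, $x^{\delta}L(x)$ is increasing and $x^{-\delta}L(x)$ is decreasing for $x$ large enough. **Hypothesis (on $\xi$).** $\xi=(\xi_t)_{t\in\mathbb Z}$ is a centered stationary Gaussian sequence whose covariance function $\rho(k)=\mathbb E(\xi_0\xi_k)$ satisfies $\rho(0)=1$ and $\rho(k)=L(|k|)\,|k|^{2H-2}$ for $k\in\mathbb Z\setminus\{0\}$, where $H\in(\frac12,1)$, $L:(0,\infty)\to(0,\infty)$ is slowly varying at infinity in Zygmund's sense, and $\lambda\mapsto L(1/\lambda)$ is of bounded variation on $(a,\pi)$ for every $a>0$. **Function $f$.** For $\vartheta\in(0,1)$, $f(\vartheta)=\sum_{i,j=0}^\infty\vartheta^{i+j}\rho(i-j)$; it equals $\mathbb E(Y_t^2)$ for the stationary solution $Y_t=\sum_{j\ge0}\vartheta^j\xi_{t-j}$ of the autoregression with parameter $\vartheta$. It is positive and strictly increasing on $(0,1)$, $f'$ is its derivative, and $f^{-1}$ denotes its inverse function. Almost surely, $\frac1n\sum_{t=1}^nX_t^2$ belongs to the range of $f$ when $n$ is large enough, so that then $\tilde\theta_n\in(0,1)$. *)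

(* Defs.v *)
From HB Require Import structures.
From mathcomp Require Import all_boot all_order all_algebra.
From mathcomp Require Import all_classical all_reals all_analysis.
Import Order.TTheory GRing.Theory Num.Theory.
Import numFieldNormedType.Exports.

Set Implicit Arguments.
Unset Strict Implicit.
Unset Printing Implicit Defensive.

Local Open Scope classical_set_scope.
Local Open Scope ring_scope.

Section functions.
Context {R : realType}.
Implicit Types (L f : R -> R) (rho : int -> R).

Definition slowly_varying L : Prop :=
  forall delta : R, 0 < delta -> exists M : R,
    {in `]M, +oo[ &, nondecreasing_fun (fun x => x `^ delta * L x)} /\
    {in `]M, +oo[ &, nonincreasing_fun (fun x => x `^ (- delta) * L x)}.

(* [bounded_variation] of the library is for closed intervals; on the open
   interval (a, b) the variation is the supremum over the compact
   subintervals *)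
Definition bounded_variation_oo (a b : R) f : Prop :=
  exists M : R, forall c d : R, a < c -> c <= d -> d < b ->
    (total_variation c d f <= M%:E)%E.

Definition lrd_covariance (H : R) rho : Prop :=
  1 / 2 < H /\ H < 1 /\
  exists L : R -> R,
    [/\ forall x, 0 < x -> 0 < L x,
        slowly_varying L,
        forall a, 0 < a -> bounded_variation_oo a pi (fun x => L (x^-1)) &
        rho 0 = 1 /\
        forall k : int, k != 0 ->
          rho k = L (`|k|%N%:R) * (`|k|%N%:R) `^ (2 * H - 2)].

Definition second_moment rho (x : R) : R :=
  limn (series (fun i : nat =>
    limn (series (fun j : nat => x ^+ (i + j) * rho (i%:Z - j%:Z))))).

(* outside the range of [second_moment rho] on (0, 1), where the inverse is
   undefined, the value is set to 0 *)
Definition second_moment_inv rho : R -> R :=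
  'pinv_(fun=> 0) `]0, 1[%classic (second_moment rho).

Definition log_average (u : nat -> R) (n : nat) : R :=
  (ln n%:R)^-1 * \sum_(1 <= k < n.+1) k%:R^-1 * u k.

End functions.

Section processes.
Context {d : measure_display} {T : measurableType d} {R : realType}
  (P : probability T R).
Implicit Types (X : T -> R) (xi : int -> {RV P >-> R}) (theta : R).

(* the second alternative is the degenerate case of zero variance, which
   [normal_prob m 0] does not cover *)
Definition gaussian X : Prop :=
  (exists m s : R, 0 < s /\
     forall A, measurable A -> pushforward P X A = normal_prob m s A) \/
  (exists m : R, forall A, measurable A -> pushforward P X A = \d_m A).

Definition gaussian_process xi : Prop :=
  forall (s : seq int) (a : int -> R),
    gaussian (fun w => \sum_(t <- s) a t * xi t w).

Definition stationary xi : Prop :=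
  forall (n : nat) (t : 'I_n -> int) (h : int) (A : set (n.-tuple R)),
    measurable A ->
    pushforward P (fun w => [tuple xi (t i + h) w | i < n]) A =
    pushforward P (fun w => [tuple xi (t i) w | i < n]) A.

Definition centered xi : Prop := forall t, ('E_P[xi t] = 0)%E.

Definition autocov (Y : int -> T -> R) (k : int) : R :=
  fine ('E_P[(fun w => Y 0 w * Y k w)%R])%E.

Fixpoint ar1 xi theta (t : nat) (w : T) : R :=
  if t is t'.+1 then theta * ar1 xi theta t' w + xi t%:Z w else 0.

(* the series converges almost surely; [lim] is junk off that event *)
Definition stationary_ar1 xi theta (t : int) (w : T) : R :=
  limn (series (fun j : nat => theta ^+ j * xi (t - j%:Z) w)).

Definition sigma_ar1 xi theta : R :=
  Num.sqrt (2 * fine (\esum_(k in [set: int])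
                        (autocov (stationary_ar1 xi theta) k ^+ 2)%:E)).

Definition moment_estimator xi theta (n : nat) (w : T) : R :=
  second_moment_inv (autocov xi)
    (n%:R^-1 * \sum_(1 <= t < n.+1) ar1 xi theta t w ^+ 2).

Definition normalized_error xi theta (n : nat) (w : T) : R :=
  derive1 (second_moment (autocov xi)) theta * Num.sqrt n%:R
    * (moment_estimator xi theta n w - theta) / sigma_ar1 xi theta.

End processes.

(* Main.v *)
Require Import Defs.
From HB Require Import structures.
From mathcomp Require Import all_boot all_order all_algebra.
From mathcomp Require Import all_classical all_reals all_analysis.
From mathcomp Require Import measurable_realfun.
From mathcomp Require Import ring lra zify.
Import Order.TTheory GRing.Theory Num.Theory.
Import numFieldNormedType.Exports.

(** Everything happens in the Gaussian space spanned by [xi], without spectral densities.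
    Let [F_k] be the centered sum of the first [k] squares divided by its standard
    deviation. Gaussian integration by parts gives
    [E (F_k f(F_k) psi(F_l)) = E (A_k f'(F_k) psi(F_l)) + E (B_kl f(F_k) psi'(F_l))]
    with quadratic forms [A_k], of mean 1, and [B_kl]; Wick's formula and the decay of the
    covariances bound the variance of [A_k] and the second moment of [B_kl], so that, for
    [k <= l] and [psi = f' - x f],
    [|E (psi(F_k) psi(F_l))| <= C (k^-a + (k/l)^(1/4))].
    By Stein's equation every smooth [psi] with vanishing Gaussian mean has this form, and
    the bound is summable against [1/k]; hence the logarithmic averages of [psi(F_k)] tend
    to 0 almost surely. Countably many logistic functions determine the limit of all
    averages of indicators. Finally [G_k] is a deterministic function of [F_k] which tends
    to the identity uniformly on compact sets, because the second moment function has a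
    differentiable inverse and the variance of the sum of squares is equivalent to
    [sigma_H^2 k]. *)

Set Implicit Arguments.
Unset Strict Implicit.
Unset Printing Implicit Defensive.
Local Open Scope classical_set_scope.
Local Open Scope ring_scope.

(** * Random variables with all moments *)

(** The hypothesis on the noise provides Gaussianity of single linear combinations only, some
    possibly degenerate, so no joint density is available. Everything multivariate is extracted from
    the one-dimensional formula for [E cos (c + V)]: differentiating it in the direction of [U]
    gives integration by parts against trigonometric tests, and products and dominated limits carry
    it to polynomials, to Gaussian factors and to bounded functions with bounded derivative of a sum
    of squares. The condition [H < 3 / 4] enters through the exponent [b = 5 / 4 - H], for which the
    covariance at lag [k] is [O(k^-b)] and [1/2 < b < 1]. Squares of covariances are then summable,
    so the variance of the sum of squares is of order [k], while row sums of the covariance matrix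
    are [O(k^(1-b)) = o(sqrt k)], which makes [A_k] concentrate; hence [a = 3/4 - H]. Since the
    autoregression starts at 0, [X_t] is not stationary and its covariances are those of truncated
    series. They increase to the stationary ones, and the total bias of the second moments is
    bounded, hence negligible against [sqrt k]. *)

Section Expectation.
Context d (T : measurableType d) (R : realType) (P : probability T R).
Implicit Types (f g h : T -> R).

Definition Ex f : R := \int[P]_w f w.

(** Finiteness of all absolute moments, rather than plain integrability, makes the class stable
    under products; one predicate then settles the integrability side conditions below. *)
Definition mom h := measurable_fun [set: T] h /\
  forall p : nat, P.-integrable [set: T] (EFin \o (fun w => `|h w| ^+ p)).

Lemma mom_meas h : mom h -> measurable_fun [set: T] h.
Proof. by case. Qed.

Lemma mom_integrable h : mom h -> P.-integrable [set: T] (EFin \o h).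
Proof.
move=> [mh /(_ 1%N) ih]; apply: le_integrable ih => //.
  exact/measurable_EFinP.
by move=> w _ /=; rewrite lee_fin normr_id.
Qed.

Lemma mom_dom g h : mom g -> measurable_fun [set: T] h ->
  (forall w, `|h w| <= `|g w|) -> mom h.
Proof.
move=> [mg ig] mh hg; split=> // p; apply: le_integrable (ig p) => //.
  apply/measurable_EFinP; apply: measurable_funX; exact: measurableT_comp.
move=> w _ /=; rewrite lee_fin !normrX !normr_id.
by rewrite lerXn2r ?nnegrE.
Qed.

Lemma mom_cst c : mom (fun=> c).
Proof.
split=> [|p]; first exact: measurable_cst.
exact: finite_measure_integrable_cst.
Qed.

Lemma mom_bnd h (M : R) : measurable_fun [set: T] h ->
  (forall w, `|h w| <= M) -> mom h.
Proof.
move=> mh hM; apply: (mom_dom (mom_cst M)) => // w.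
by rewrite (le_trans (hM w)) ?ler_norm.
Qed.

(** By [a b <= a^2 + b^2], moments of order [2 p] of the factors control the moment of order [p] of
    the product. *)
Lemma mom_mul f g : mom f -> mom g -> mom (fun w => f w * g w).
Proof.
move=> [mf iF] [mg iG]; split=> [|p]; first exact: measurable_funM.
have := integrableD measurableT (iF (p * 2)%N) (iG (p * 2)%N).
apply: le_integrable => //.
  apply/measurable_EFinP; apply: measurable_funX; apply: measurableT_comp => //.
  exact: measurable_funM.
move=> w _ /=; rewrite lee_fin !normrX !normr_id.
rewrite [leRHS]ger0_norm ?addr_ge0 ?exprn_ge0 // normrM exprMn !exprM.
set a := `|f w| ^+ p; set b := `|g w| ^+ p.
have a0 : 0 <= a by rewrite exprn_ge0.
have b0 : 0 <= b by rewrite exprn_ge0.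
nra.
Qed.

Lemma mom_add f g : mom f -> mom g -> mom (fun w => f w + g w).
Proof.
move=> [mf iF] [mg iG]; split=> [|p]; first exact: measurable_funD.
have := integrableZl measurableT (2 ^+ p) (integrableD measurableT (iF p) (iG p)).
apply: le_integrable => //.
  apply/measurable_EFinP; apply: measurable_funX; apply: measurableT_comp => //.
  exact: measurable_funD.
move=> w _ /=; rewrite lee_fin !normrX !normr_id.
rewrite [leRHS]ger0_norm ?mulr_ge0 ?addr_ge0 ?exprn_ge0 //.
apply: (@le_trans _ _ ((2 * Num.max `|f w| `|g w|) ^+ p)).
  apply: lerXn2r; rewrite ?nnegrE ?mulr_ge0 ?le_max ?normr_ge0 //.
  rewrite (le_trans (ler_normD _ _)) // mulr2n mulrDl !mul1r lerD //;
    by rewrite le_max lexx ?orbT.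
rewrite exprMn ler_pM2l ?exprn_gt0 //.
by case: (leP `|f w| `|g w|) => _; rewrite ?lerDl ?lerDr exprn_ge0.
Qed.

Lemma mom_scal c f : mom f -> mom (fun w => c * f w).
Proof. by move=> mf; apply: mom_mul => //; exact: mom_cst. Qed.

Lemma mom_opp f : mom f -> mom (fun w => - f w).
Proof.
move=> mf; apply: (mom_dom mf) => [|w]; last by rewrite normrN.
by apply: measurableT_comp => //; case: mf.
Qed.

Lemma mom_sub f g : mom f -> mom g -> mom (fun w => f w - g w).
Proof. by move=> mf mg; apply: mom_add => //; exact: mom_opp. Qed.

Lemma mom_abs f : mom f -> mom (fun w => `|f w|).
Proof.
move=> mf; apply: (mom_dom mf) => [|w]; last by rewrite normr_id.
by apply: measurableT_comp => //; case: mf.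
Qed.

Lemma mom_exp f n : mom f -> mom (fun w => f w ^+ n).
Proof.
move=> mf; elim: n => [|n IHn]; first exact: mom_cst.
rewrite (_ : (fun w => _) = (fun w => f w * f w ^+ n)); first exact: mom_mul.
by apply/funext => w; rewrite exprS.
Qed.

Lemma mom_sum (I : Type) (r : seq I) (f : I -> T -> R) :
  (forall i, mom (f i)) -> mom (fun w => \sum_(i <- r) f i w).
Proof.
move=> mf; elim: r => [|i r IHr].
  by under eq_fun do rewrite big_nil; exact: mom_cst.
by under eq_fun do rewrite big_cons; exact: mom_add.
Qed.

Lemma ExD f g : mom f -> mom g -> Ex (fun w => f w + g w) = Ex f + Ex g.
Proof. by move=> mf mg; apply: RintegralD => //; exact: mom_integrable. Qed.

Lemma ExB f g : mom f -> mom g -> Ex (fun w => f w - g w) = Ex f - Ex g.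
Proof. by move=> mf mg; apply: RintegralB => //; exact: mom_integrable. Qed.

Lemma ExZ c f : mom f -> Ex (fun w => c * f w) = c * Ex f.
Proof. by move=> mf; apply: RintegralZl => //; exact: mom_integrable. Qed.

Lemma ExN f : mom f -> Ex (fun w => - f w) = - Ex f.
Proof.
move=> mf; rewrite -mulN1r -ExZ //; congr Ex; apply/funext => w.
by rewrite mulN1r.
Qed.

Lemma Ex_cst c : Ex (fun=> c) = c.
Proof.
rewrite /Ex Rintegral_cst //.
by rewrite -[RHS]mulr1; congr (c * _); exact: (congr1 fine (probability_setT P)).
Qed.

Lemma Ex_sum (I : Type) (r : seq I) (f : I -> T -> R) :
  (forall i, mom (f i)) -> Ex (fun w => \sum_(i <- r) f i w) = \sum_(i <- r) Ex (f i).
Proof.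
move=> mf; elim: r => [|i r IHr].
  by under eq_fun do rewrite big_nil; rewrite Ex_cst big_nil.
under eq_fun do rewrite big_cons.
by rewrite ExD ?IHr ?big_cons //; exact: mom_sum.
Qed.

Lemma Ex_le f g : mom f -> mom g -> (forall w, f w <= g w) -> Ex f <= Ex g.
Proof. by move=> mf mg fg; apply: le_Rintegral => //; exact: mom_integrable. Qed.

Lemma Ex_ge0 f : (forall w, 0 <= f w) -> 0 <= Ex f.
Proof. by move=> f0; apply: Rintegral_ge0. Qed.

Lemma Ex_abs f : mom f -> `|Ex f| <= Ex (fun w => `|f w|).
Proof. by move=> mf; apply: le_normr_Rintegral => //; exact: mom_integrable. Qed.

(** Nonnegativity of the variance of [|f|], expanded. *)
Lemma Ex_CS f : mom f -> (Ex (fun w => `|f w|)) ^+ 2 <= Ex (fun w => f w ^+ 2).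
Proof.
move=> mf; set a := Ex _.
have ma := mom_abs mf.
have : 0 <= Ex (fun w => (`|f w| - a) ^+ 2) by apply: Ex_ge0 => w; exact: sqr_ge0.
rewrite (_ : (fun w => _) = (fun w => (f w ^+ 2 - (2 * a) * `|f w|) + a ^+ 2)); last first.
  by apply/funext => w; rewrite -(real_normK (num_real (f w))); ring.
have m2 : mom (fun w => f w ^+ 2) by exact: mom_exp.
have m3 : mom (fun w => 2 * a * `|f w|) by exact: mom_scal.
have m4 : mom (fun w => f w ^+ 2 - 2 * a * `|f w|) by exact: mom_sub.
rewrite (ExD m4 (mom_cst _)) (ExB m2 m3) (ExZ _ ma) Ex_cst -/a.
by move: (Ex _) => b; nra.
Qed.

Lemma mom_lim (h_ : nat -> T -> R) h g : (forall n, measurable_fun [set: T] (h_ n)) ->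
  mom g -> (forall n w, `|h_ n w| <= g w) ->
  (forall w, h_ n w @[n --> \oo] --> h w) -> mom h.
Proof.
move=> mh mg hg hh.
apply: (mom_dom mg).
  by apply: (measurable_fun_cvg (h := h_)) => // w _; exact: hh.
move=> w; rewrite (le_trans _ (ler_norm _)) //.
have hn : `|h_ n w| @[n --> \oo] --> `|h w| by apply: cvg_norm; exact: hh.
rewrite -(cvg_lim _ hn) //.
apply: limr_le; first exact: cvgP hn.
exact: nearW.
Qed.

Lemma Ex_dct (h_ : nat -> T -> R) h g : (forall n, measurable_fun [set: T] (h_ n)) ->
  mom g -> (forall n w, `|h_ n w| <= g w) ->
  (forall w, h_ n w @[n --> \oo] --> h w) -> Ex (h_ n) @[n --> \oo] --> Ex h.
Proof.
move=> mh mg hg hh; have mhl := mom_lim mh mg hg hh.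
have [] := @dominated_convergence _ T R P setT measurableT
  (fun n => EFin \o h_ n) (EFin \o h) (EFin \o g).
- by move=> n; exact/measurable_EFinP.
- by apply/measurable_EFinP; case: mhl.
- by apply: aeW => w _ /=; apply: cvg_EFin; [exact: nearW|exact: hh].
- exact: mom_integrable.
- by apply: aeW => w n _ /=; rewrite lee_fin.
move=> ih _ cv; rewrite /Ex /Rintegral; apply: fine_cvg; rewrite fineK //.
exact: integrable_fin_num.
Qed.

End Expectation.

Lemma seq_cvg_unique {R : realType} (u v : nat -> R) (a b : R) :
  u @ \oo --> a -> v @ \oo --> b -> u =1 v -> a = b.
Proof.
move=> ua vb uv; have E : u = v by exact/funext.
by rewrite E in ua; exact: cvg_unique ua vb.
Qed.

Lemma cvg_seq_ext {R : realType} (u v : nat -> R) (a b : R) :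
  u @ \oo --> a -> a = b -> u =1 v -> v @ \oo --> b.
Proof.
move=> ua ab uv; have E : u = v by exact/funext.
by rewrite -E -ab.
Qed.

Lemma cvg0_le {R : realType} (u v : nat -> R) :
  (forall n, `|u n| <= `|v n|) -> v @ \oo --> (0 : R) -> u @ \oo --> (0 : R).
Proof.
move=> uv v0.
have v1 : `|v n| @[n --> \oo] --> (0 : R) by rewrite -(@normr0 _ R); apply: cvg_norm.
have c0 : (fun=> 0 : R) n @[n --> \oo] --> (0 : R) by exact: cvg_cst.
have : `|u n| @[n --> \oo] --> (0 : R).
  apply: squeeze_cvgr c0 v1.
  by apply: nearW => n; rewrite normr_ge0 uv.
exact: norm_cvg0.
Qed.

Lemma cvg_scalel {R : realType} (k : R) (u : nat -> R) (l : R) :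
  u @ \oo --> l -> (fun n => k * u n) @ \oo --> k * l.
Proof. by move=> ul; apply: cvgMr. Qed.
Arguments cvg_scalel {R} k {u l} _ [t] _.

(** * The normal law *)

Section NormalLaw.
Context {R : realType}.
Local Notation mu := (@lebesgue_measure R).
Implicit Types (m s : R).

(** The Radon-Nikodym derivative of [normal_prob m s] and [normal_pdf m s] have equal integrals over
    every measurable set, so they agree almost everywhere. *)
Lemma ge0_integral_normal_prob m s (g : R -> \bar R) :
  (forall x, 0 <= g x)%E -> measurable_fun [set: R] g ->
  (\int[normal_prob m s]_x g x = \int[mu]_x (g x * (normal_pdf m s x)%:E))%E.
Proof.
move=> g0 mg; have dom := @normal_prob_dominates R m s.
rewrite -(Radon_Nikodym_SigmaFinite.change_of_variables dom) //.
apply: ae_eq_integral => //.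
- apply: emeasurable_funM => //.
  exact: measurable_int (Radon_Nikodym_SigmaFinite.f_integrable dom).
- apply: emeasurable_funM => //; apply/measurable_EFinP.
  exact: measurable_normal_pdf.
- apply: ae_eqe_mul2l; apply: integral_ae_eq => //.
  + exact: Radon_Nikodym_SigmaFinite.f_integrable.
  + by apply/measurable_EFinP; exact: measurable_normal_pdf.
  + by move=> A _ mA; rewrite -Radon_Nikodym_SigmaFinite.f_integral.
Qed.

Lemma integral_normal_prob m s (g : R -> \bar R) :
  (normal_prob m s).-integrable [set: R] g ->
  (\int[normal_prob m s]_x g x = \int[mu]_x (g x * (normal_pdf m s x)%:E))%E.
Proof.
move=> ig; have mg := measurable_int _ ig; have dom := @normal_prob_dominates R m s.
have mpdf : measurable_fun [set: R] (fun x => (normal_pdf m s x)%:E).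
  by apply/measurable_EFinP; exact: measurable_normal_pdf.
rewrite -(Radon_Nikodym_change_of_variables dom) //.
apply: ae_eq_integral => //.
- by apply: emeasurable_funM => //.
- exact: emeasurable_funM.
- apply: ae_eqe_mul2l; apply: integral_ae_eq => //.
  + exact: Radon_Nikodym_integrable.
  + by move=> A _ mA; rewrite -Radon_Nikodym_integral.
Qed.


(** The fundamental theorem of calculus on [[-n, n]], combined with dominated convergence. *)
Lemma integral_derive_line (F f : R -> R) :
  (forall x : R, is_derive x 1 F (f x)) -> continuous f ->
  mu.-integrable [set: R] (EFin \o f) ->
  F n%:R @[n --> \oo] --> 0 -> F (- n%:R) @[n --> \oo] --> 0 ->
  \int[mu]_x f x = 0.
Proof.
move=> dF cf intf F1 F2.
have cF : continuous F.
  by move=> x; apply: differentiable_continuous; apply/derivable1_diffP; case: (dF x).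
pose g n := fun x => f x * \1_(`[- n%:R, n%:R]) x.
have Ig n : (0 < n)%N -> \int[mu]_x g n x = F n%:R - F (- n%:R).
  move=> n0; rewrite /g.
  transitivity (\int[mu]_(x in `[- n%:R, n%:R]) f x).
    rewrite [RHS]Rintegral_mkcond; congr Rintegral; apply/funext => x.
    by rewrite patchE indicE; case: ifPn => xI; rewrite ?mulr1 ?mulr0.
  rewrite /Rintegral (continuous_FTC2 (F := F)) //.
  - by rewrite (@lt_trans _ _ 0) ?oppr_lt0 ?ltr0n.
  - by apply: continuous_subspaceT.
  - split=> //.
    + by apply: cvg_at_right_filter; exact: cF.
    + by apply: cvg_at_left_filter; exact: cF.
  - by move=> x _; rewrite derive1E; case: (dF x).
have cv : \int[mu]_x g n x @[n --> \oo] --> \int[mu]_x f x.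
  have mf : measurable_fun [set: R] f by exact: continuous_measurable_fun.
  have [] := @dominated_convergence _ _ R mu setT measurableT
    (fun n => EFin \o g n) (EFin \o f) (EFin \o (fun x => `|f x|)).
  - move=> n; apply/measurable_EFinP; apply: measurable_funM => //.
  - exact/measurable_EFinP.
  - apply: aeW => x _ /=; apply: cvg_EFin; first exact: nearW.
    apply: cvg_near_cst; near=> n; rewrite /= /g indicE mem_set ?mulr1 //=.
    rewrite in_itv /= -ler_norml; near: n; exact: nbhs_infty_ger.
  - exact: integrable_norm.
  - apply: aeW => x n _ /=; rewrite lee_fin /g normrM indicE.
    by case: (_ \in _); rewrite ?normr1 ?normr0 ?mulr1 ?mulr0.
  move=> _ _ cv; rewrite /Rintegral; apply: fine_cvg; rewrite fineK //.
  exact: integrable_fin_num.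
have cv0 : \int[mu]_x g n x @[n --> \oo] --> (0 : R).
  rewrite -(subrr (0 : R)); apply: cvg_trans (cvgB F1 F2).
  apply: near_eq_cvg; near=> n; rewrite Ig //; near: n; exact: nbhs_infty_gt.
exact: cvg_unique cv cv0.
Unshelve. all: by end_near. Qed.

End NormalLaw.

Section NormalMoments.
Context {R : realType} (m s : R) (s0 : 0 < s).
Local Notation mu := (@lebesgue_measure R).
Local Notation N := (normal_prob m s).

Let sn0 : s != 0. Proof. by rewrite gt_eqF. Qed.

(** Completing the square: an exponential weight shifts the mean by [c s^2]. It provides both the
    finiteness of the moments and the decay of the density. *)
Lemma normal_pdf_tilt (c x : R) : expR (c * x) * normal_pdf m s x =
  expR (c * m + c ^+ 2 * s ^+ 2 / 2) * normal_pdf (m + c * s ^+ 2) s x.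
Proof.
rewrite !normal_pdfE //= /normal_fun mulrCA [RHS]mulrCA -!expRD.
congr (_ * expR _); have s2 : s ^+ 2 *+ 2 != 0 by rewrite mulrn_eq0 expf_eq0 (negbTE sn0).
field.
by rewrite sn0.
Qed.

Lemma mom_normal : mom N id.
Proof.
split=> [|p]; first exact: measurable_id.
apply/integrableP; split.
  apply/measurable_EFinP; apply: measurable_funX; exact: normr_measurable.
have -> : (\int[N]_x `|(EFin \o (fun w : R => `|w| ^+ p)%R) x|)%E =
    (\int[mu]_x ((`|x| ^+ p)%R%:E * (normal_pdf m s x)%:E))%E.
  rewrite ge0_integral_normal_prob //.
    by apply: eq_integral => x _ /=; rewrite ger0_norm ?exprn_ge0.
  apply: measurableT_comp => //; apply/measurable_EFinP; apply: measurable_funX.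
  exact: normr_measurable.
(* [|x|^p <= (p+1)! (exp x + exp (-x))], and tilting turns the right side times the density into the
   combination [D] of two shifted normal densities. *)
pose K c := p.+1`!%:R * expR (c * m + c ^+ 2 * s ^+ 2 / 2).
pose D x := K 1 * normal_pdf (m + 1 * s ^+ 2) s x + K (-1) * normal_pdf (m + (-1) * s ^+ 2) s x.
have iD : mu.-integrable [set: R] (EFin \o D).
  have -> : EFin \o D = ((fun x => (K 1)%:E * (normal_pdf (m + 1 * s ^+ 2) s x)%R%:E) \+
     (fun x => (K (-1))%:E * (normal_pdf (m + (-1) * s ^+ 2) s x)%:E))%E by [].
  by apply: integrableD => //; apply: integrableZl => //; exact: integrable_normal_pdf.
have K0 c : 0 <= K c by rewrite mulr_ge0 // expR_ge0.
have D0 x : 0 <= D x by rewrite addr_ge0 // mulr_ge0 // normal_pdf_ge0.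
have : (\int[mu]_x (D x)%:E < +oo)%E.
  move/integrableP : iD => [_]; apply: le_lt_trans.
  rewrite le_eqVlt; apply/orP; left; apply/eqP; apply: eq_integral => x _ /=.
  by rewrite ger0_norm.
apply: le_lt_trans; apply: ge0_le_integral => //.
- by move=> x _; rewrite -EFinM lee_fin mulr_ge0 // ?exprn_ge0 // normal_pdf_ge0.
- apply/measurable_EFinP; apply: measurable_funM; last exact: measurable_normal_pdf.
  apply: measurable_funX; exact: normr_measurable.
- exact: measurable_int iD.
have DE x : D x = p.+1`!%:R * (expR x + expR (- x)) * normal_pdf m s x.
  have t1 := normal_pdf_tilt 1 x; have t2 := normal_pdf_tilt (-1) x.
  rewrite mul1r in t1; rewrite mulN1r in t2; rewrite /D /K.
  set a1 := expR (1 * m + _) in t1 *; set a2 := expR (-1 * m + _) in t2 *.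
  set p1 := normal_pdf (m + 1 * _) s x in t1 *.
  set p2 := normal_pdf (m + -1 * _) s x in t2 *.
  clearbody a1 a2 p1 p2; clear K D iD K0 D0.
  by rewrite -(mulrA _ a1) -(mulrA _ a2) -t1 -t2; ring.
move=> x _; rewrite -EFinM lee_fin DE ler_wpM2r ?normal_pdf_ge0 //.
have h : `|x| ^+ p <= p.+1`!%:R * expR `|x|.
  have [->|p0] := eqVneq p 0%N.
    by rewrite expr0 mul1r -expR0 ler_expR.
  have := expR_ge1Dxn p.-1 (normr_ge0 x); rewrite prednK ?lt0n //.
  move=> h; have {h} : `|x| ^+ p / p`!%:R <= expR `|x|.
    by apply: le_trans h; rewrite lerDr.
  rewrite ler_pdivrMr ?ltr0n ?fact_gt0 // => /le_trans; apply.
  rewrite mulrC ler_wpM2r ?expR_ge0 // ler_nat factS leq_pmull //.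
apply: (le_trans h); rewrite ler_wpM2l //.
by case: (ler0P x) => _; rewrite ?lerDl ?lerDr expR_ge0.
Qed.

(** Tilting by [c = 1] and [c = -1] bounds [exp n] times the density at [n] and at [-n] by a
    constant, and [exp n >= n + 1] leaves a decay of order [1 / (n + 1)]. *)
Lemma normal_pdf_cvg0 (F : R -> R) : (forall x, `|F x| <= `|normal_pdf m s x|) ->
  F n%:R @[n --> \oo] --> 0 /\ F (- n%:R) @[n --> \oo] --> 0.
Proof.
move=> hF.
have key c n : `|c| = 1 -> normal_pdf m s (c * n%:R) <=
    (expR (c * m + c ^+ 2 * s ^+ 2 / 2) * normal_peak s) * harmonic n.
  move=> c1; have := normal_pdf_tilt c (c * n%:R).
  rewrite mulrA -expr2 -(real_normK (num_real c)) c1 expr1n !mul1r => h.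
  rewrite /harmonic /= ler_pdivlMr ?ltr0n // mulrC.
  apply: (@le_trans _ _ (expR n%:R * normal_pdf m s (c * n%:R))).
    rewrite ler_wpM2r ?normal_pdf_ge0 // (le_trans _ (expR_ge1Dx _)) //.
    by rewrite -natr1 addrC.
  by rewrite h ler_wpM2l ?expR_ge0 // normal_pdf_ub.
have sq (G : nat -> R) (K : R) : (forall n, `|G n| <= K * harmonic n) ->
    G n @[n --> \oo] --> 0.
  move=> hG; have K0 : K * harmonic n @[n --> \oo] --> (0 : R).
    by rewrite -(mulr0 K); apply: cvgMr; exact: cvg_harmonic.
  apply/norm_cvg0P; apply: squeeze_cvgr K0; last exact: cvg_cst.
  by apply: nearW => n; rewrite normr_ge0 hG.
split; [apply: (sq _ (expR (1 * m + 1 ^+ 2 * s ^+ 2 / 2) * normal_peak s)) => n |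
        apply: (sq _ (expR ((-1) * m + (-1) ^+ 2 * s ^+ 2 / 2) * normal_peak s)) => n].
- rewrite (le_trans (hF _)) // ger0_norm ?normal_pdf_ge0 // -[n%:R in leLHS]mul1r.
  by rewrite key // normr1.
- rewrite (le_trans (hF _)) // ger0_norm ?normal_pdf_ge0 // -[- n%:R in leLHS]mulN1r.
  by rewrite key // normrN1.
Qed.

Lemma integrable_normal_prob_pdf (g : R -> R) : mom N g ->
  mu.-integrable [set: R] (EFin \o (fun x => g x * normal_pdf m s x)).
Proof.
move=> mg; have /integrableP[_] := mom_integrable mg => hg.
have meg : measurable_fun [set: R] g by case: mg.
apply/integrableP; split.
  by apply/measurable_EFinP; apply: measurable_funM => //; exact: measurable_normal_pdf.
move: hg; rewrite ge0_integral_normal_prob //.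
  apply: le_lt_trans; rewrite le_eqVlt; apply/orP; left; apply/eqP.
  apply: eq_integral => x _ /=.
  by rewrite normrM (ger0_norm (normal_pdf_ge0 _ _ _)) EFinM.
by apply: measurableT_comp => //; exact/measurable_EFinP.
Qed.

Lemma Ex_normalE (g : R -> R) : mom N g ->
  Ex N g = \int[mu]_x (g x * normal_pdf m s x).
Proof.
by move=> mg; rewrite /Ex /Rintegral integral_normal_prob //; exact: mom_integrable.
Qed.

Lemma is_derive_normal_pdf (x : R) :
  is_derive x 1 (normal_pdf m s) (- ((x - m) / s ^+ 2) * normal_pdf m s x).
Proof.
rewrite normal_pdfE //= /normal_fun.
have -> : (fun x0 : R => normal_peak s * expR (- (x0 - m) ^+ 2 / (s ^+ 2 *+ 2))) =
  (fun y => normal_peak s *: (expR \o (fun x0 : R => (- (s ^+ 2 *+ 2)^-1) *: ((x0 - m) ^+ 2))) y).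
  by apply/funext => y /=; congr (_ * expR _); rewrite mulrC mulrN -mulNr.
apply: is_derive_eq.
rewrite -![_ *: _]/(_ * _) (mulrC (- _) ((x - m) ^+ 2)) mulrN -mulNr.
move: (expR _) (normal_peak s) => e p; field.
by rewrite sn0.
Qed.

(** The derivative of [g] times the density is [g' - s^-2 g (x - m)] times the density; its integral
    vanishes because [g] is bounded and the density decays. *)
Lemma normal_ibp (g g' : R -> R) (M : R) : (forall x : R, is_derive x 1 g (g' x)) ->
  continuous g' -> (forall x, `|g x| <= 1) -> (forall x, `|g' x| <= M) ->
  Ex N (fun x => g x * (x - m)) = s ^+ 2 * Ex N g'.
Proof.
move=> dg cg' bg bg'.
have cg : continuous g.
  by move=> x; apply: differentiable_continuous; apply/derivable1_diffP; case: (dg x).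
have mg : mom N g by apply: (@mom_bnd _ _ R N g 1) => //; exact: continuous_measurable_fun.
have mg' : mom N g' by apply: (@mom_bnd _ _ R N g' M) => //; exact: continuous_measurable_fun.
have mgx : mom N (fun x => g x * (x - m)).
  by apply: mom_mul => //; apply: mom_sub; [exact: mom_normal|exact: mom_cst].
have mh : mom N (fun x => g' x - s ^- 2 * (g x * (x - m))).
  by apply: mom_sub => //; exact: mom_scal.
have bF x : `|g x * normal_pdf m s x| <= `|normal_pdf m s x|.
  by rewrite normrM ler_piMl.
have ch : continuous (fun x : R => (g' x - s ^- 2 * (g x * (x - m))) * normal_pdf m s x).
  move=> x; apply: cvgM; last exact: continuous_normal_pdf.
  apply: cvgB; first exact: cg'.
  apply: cvgM; first exact: cvg_cst.
  apply: cvgM; first exact: cg.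
  by apply: cvgB; [exact: cvg_id|exact: cvg_cst].
have h : Ex N (fun x => g' x - s ^- 2 * (g x * (x - m))) = 0.
  rewrite Ex_normalE //; apply: (@integral_derive_line _ (fun x => g x * normal_pdf m s x)).
  - move=> x; have := is_deriveM (dg x) (is_derive_normal_pdf x).
    move=> H; apply: (is_derive_eq H); rewrite /GRing.scale /=.
    by move: (normal_pdf _ _ _) => p; field.
  - exact: ch.
  - exact: integrable_normal_prob_pdf.
  - exact: (normal_pdf_cvg0 bF).1.
  - exact: (normal_pdf_cvg0 bF).2.
move: h; rewrite ExB //; last exact: mom_scal.
rewrite ExZ // => /eqP; rewrite subr_eq0 => /eqP ->.
by rewrite mulrA divff ?mul1r // expf_eq0.
Qed.

End NormalMoments.

Lemma cvg_diffquot {R : realType} (f : R -> R) (x l : R) (u : nat -> R) :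
  is_derive x 1 f l -> (forall n, u n != 0) -> u n @[n --> \oo] --> (0 : R) ->
  (u n)^-1 * (f (x + u n) - f x) @[n --> \oo] --> l.
Proof.
move=> df un0 u0.
have df1 : derivable f x 1 by case: df.
have df2 : 'D_1 f x = l by case: df.
have h0 : h^-1 *: ((f \o shift x) (h *: 1) - f x) @[h --> (0 : R)^'] --> l.
  by rewrite -df2; exact: df1.
move/cvgr_dnbhsP : h0 => /(_ u (conj un0 u0)).
apply: cvg_trans; apply: near_eq_cvg; near=> n.
rewrite /= (_ : (u n)%:A = u n); last exact: mulr1.
by rewrite -[_ *: _]/(_ * _) [u n + x]addrC.
Unshelve. all: by end_near. Qed.

(** Lets a linear factor be reached by bounded trigonometric functions; since
    [|n sin (a / n)| <= |a|], dominated convergence will apply. *)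
Lemma cvg_sinM {R : realType} (a : R) : n.+1%:R * sin (n.+1%:R^-1 * a) @[n --> \oo] --> a.
Proof.
have := @cvg_diffquot R (sin \o (fun x => a * x)) 0 a (fun n => n.+1%:R^-1).
have d : is_derive (0 : R) 1 (sin \o (fun x => a * x)) a.
  have -> : (fun x => a * x) = (fun x : R => a *: x) by [].
  apply: is_derive_eq.
  by rewrite -![_ *: _]/(_ * _) mulr0 cos0 !mulr1 ?mul1r.
move=> /(_ d); rewrite /= mulr0 sin0 => h.
apply: cvg_trans (h _ _) => [||].
- apply: near_eq_cvg; near=> n.
  by rewrite invrK add0r subr0 [a * _]mulrC.
- by move=> n; rewrite invr_neq0.
- exact: cvg_harmonic.
Unshelve. all: by end_near. Qed.

Section GaussianLaw.
Context d (T : measurableType d) (R : realType) (P : probability T R).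
Implicit Types (V : T -> R).

Lemma law_transfer V (N : probability (measurableTypeR R) R) :
  measurable_fun [set: T] V ->
  (forall A, measurable A -> pushforward P V A = N A) ->
  forall g : R -> R, measurable_fun [set: R] g ->
  mom N g -> mom P (g \o V) /\ Ex P (g \o V) = Ex N g.
Proof.
move=> mV law g mg momg.
have int_eq (f : R -> \bar R) : (\int[pushforward P (V : T -> measurableTypeR R)]_x f x = \int[N]_x f x)%E.
  pose X : {RV P >-> measurableTypeR R} := HB.pack (V : T -> measurableTypeR R) (isMeasurableFun.Build _ _ T (measurableTypeR R) V mV).
  transitivity (\int[distribution P X]_x f x)%E; first by [].
  by apply: eq_measure_integral => A mA _; exact: law.
have mgV : measurable_fun [set: T] (g \o V) by exact: measurableT_comp.
have mgV' : mom P (g \o V).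
  split=> // p; apply/integrableP; split.
    by apply/measurable_EFinP; apply: measurable_funX; apply: measurableT_comp.
  have /integrableP[_] := momg.2 p; rewrite -int_eq.
  rewrite ge0_integral_pushforward //=.
  by do 2 apply: measurableT_comp => //; apply: measurable_funX; apply: measurableT_comp.
split=> //.
rewrite /Ex /Rintegral -int_eq integral_pushforward //.
- exact/measurable_EFinP.
- exact: mom_integrable.
Qed.

End GaussianLaw.

Lemma derive_lipschitz {R : realType} (f f' : R -> R) (M : R) :
  (forall x : R, is_derive x 1 f (f' x)) -> (forall x, `|f' x| <= M) ->
  forall x y, `|f y - f x| <= M * `|y - x|.
Proof.
move=> df bf.
have cf : continuous f.
  by move=> x; apply: differentiable_continuous; apply/derivable1_diffP; case: (df x).
have key a b : a <= b -> `|f b - f a| <= M * `|b - a|.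
  move=> ab; have [|c _ ->] := MVT_segment ab (fun x _ => df x).
    exact: continuous_subspaceT.
  by rewrite normrM ler_wpM2r.
move=> x y; case: (leP x y) => [|/ltW] h; first exact: key.
by rewrite distrC (distrC y); exact: key.
Qed.

Lemma sin_abs_le {R : realType} (x : R) : `|sin x| <= `|x|.
Proof.
have := @derive_lipschitz R sin cos 1 (@is_derive_sin R) (@cos_max R) 0 x.
by rewrite sin0 !subr0 mul1r.
Qed.

(** * Trigonometric moments of a Gaussian variable *)

Section GaussianTrig.
Context d (T : measurableType d) (R : realType) (P : probability T R).
Implicit Types (V : T -> R).

Let meas_sinM (t : R) : measurable_fun [set: R] (fun x => sin (t * x)).
Proof.
apply: measurableT_comp; first by apply: continuous_measurable_fun; exact: continuous_sin.
exact: measurable_funM.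
Qed.

Let meas_cosM (t : R) : measurable_fun [set: R] (fun x => cos (t * x)).
Proof.
apply: measurableT_comp; first by apply: continuous_measurable_fun; exact: continuous_cos.
exact: measurable_funM.
Qed.

Lemma dirac_mom (m : R) (g : R -> R) : measurable_fun [set: R] g ->
  mom (\d_(m : measurableTypeR R) : probability (measurableTypeR R) R) g /\ Ex (\d_(m : measurableTypeR R) : probability (measurableTypeR R) R) g = g m.
Proof.
move=> mg; split.
  split=> // p; apply/integrableP; split.
    by apply/measurable_EFinP; apply: measurable_funX; apply: measurableT_comp.
  rewrite integral_dirac //=; last first.
    by do 2 apply: measurableT_comp => //; apply: measurable_funX; apply: measurableT_comp.
  by rewrite diracT mul1e ltry.
rewrite /Ex /Rintegral integral_dirac //; last exact/measurable_EFinP.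
by rewrite diracT mul1e.
Qed.

(** [s2] is the variance parameter of the law, 0 in the degenerate case. It stays existential here
    because its identification with the second moment of [V] is drawn from the formulas
    themselves. *)
Lemma gaussian_ibp_scale V : measurable_fun [set: T] V -> gaussian P V ->
  Ex P V = 0 -> mom P V /\ exists s2 : R, forall t,
    Ex P (fun w => V w * sin (t * V w)) = t * s2 * Ex P (fun w => cos (t * V w)) /\
    Ex P (fun w => V w * cos (t * V w)) = - (t * s2 * Ex P (fun w => sin (t * V w))).
Proof.
move=> mV gV EV.
have mid : measurable_fun [set: R] (@id R) by exact: measurable_id.
have mXs t : measurable_fun [set: R] (fun x : R => x * sin (t * x)) by exact: measurable_funM.
have mXc t : measurable_fun [set: R] (fun x : R => x * cos (t * x)) by exact: measurable_funM.
case: gV => [[m [s [s0 law]]]|[m law]]; last first.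
  pose N : probability (measurableTypeR R) R := \d_(m : measurableTypeR R).
  have tr g : measurable_fun [set: R] g -> mom P (g \o V) /\ Ex P (g \o V) = g m.
    move=> mg; have [h1 h2] := dirac_mom m mg.
    by have [h3 ->] := law_transfer (N := N) mV law mg h1; split.
  have [mmV m0] := tr _ mid; rewrite /= EV in m0.
  split=> //; exists 0 => t.
  have [_ ->] := tr _ (mXs t); have [_ ->] := tr _ (mXc t).
  by rewrite -m0 !mulr0 !mul0r oppr0.
pose N : probability (measurableTypeR R) R := normal_prob m s.
have mmid : mom N id by exact: mom_normal.
have [mmV EVm] := law_transfer (N := N) mV law mid mmid.
have m0 : m = 0.
  (* Integration by parts with [g = 1] identifies the parameter [m] with the mean. *)
  have := @normal_ibp R m s s0 (fun=> 1) (fun=> 0) 0 _ _ _ _.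
  have H1 : forall x : R, is_derive x 1 (fun _ : R => 1 : R) (0 : R) by move=> x; exact: is_derive_cst.
  have H2 : continuous (fun _ : R => 0 : R) by move=> x; exact: cvg_cst.
  move=> /(_ H1 H2); rewrite normr1 normr0 => /(_ (fun=> lexx _) (fun=> lexx _)).
  rewrite Ex_cst mulr0.
  have -> : (fun x : R => 1 * (x - m)) = (fun x : R => x - m).
    by apply/funext => x; rewrite mul1r.
  rewrite ExB //; last exact: mom_cst.
  rewrite Ex_cst => /eqP; rewrite subr_eq0 => /eqP h.
  by rewrite -h; rewrite -EVm.
have bs t x : `|sin (t * x)| <= 1 :> R by exact: sin_max.
have bc t x : `|cos (t * x)| <= 1 :> R by exact: cos_max.
have ms t : mom N (fun x => sin (t * x)) by apply: (@mom_bnd _ _ R N _ 1); [exact: meas_sinM|exact: bs].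
have mc t : mom N (fun x => cos (t * x)) by apply: (@mom_bnd _ _ R N _ 1); [exact: meas_cosM|exact: bc].
split=> //; exists (s ^+ 2) => t.
have -> : (fun w => V w * sin (t * V w)) = (fun x => x * sin (t * x)) \o V by [].
have -> : (fun w => V w * cos (t * V w)) = (fun x => x * cos (t * x)) \o V by [].
have -> : (fun w => sin (t * V w)) = (fun x => sin (t * x)) \o V by [].
have -> : (fun w => cos (t * V w)) = (fun x => cos (t * x)) \o V by [].
have [_ ->] := law_transfer (N := N) mV law (mXs t) (mom_mul mmid (ms t)).
have [_ ->] := law_transfer (N := N) mV law (mXc t) (mom_mul mmid (mc t)).
have [_ ->] := law_transfer (N := N) mV law (meas_sinM t) (ms t).
have [_ ->] := law_transfer (N := N) mV law (meas_cosM t) (mc t).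
have comm (g : R -> R) : (fun x => x * g x) = (fun x => g x * (x - m)).
  by apply/funext => x; rewrite m0 subr0 mulrC.
have ct : continuous (fun x : R => t * x).
  by move=> x; apply: cvgM; [exact: cvg_cst|exact: cvg_id].
have cs : continuous (fun x : R => sin (t * x)).
  by move=> x; apply: continuous_comp; [exact: ct|exact: continuous_sin].
have cc : continuous (fun x : R => cos (t * x)).
  by move=> x; apply: continuous_comp; [exact: ct|exact: continuous_cos].
have ds (x : R) : is_derive x 1 (fun x => sin (t * x)) (t * cos (t * x)).
  have -> : (fun x => sin (t * x)) = sin \o (fun x : R => t *: x) by [].
  by apply: is_derive_eq; rewrite -![_ *: _]/(_ * _) mulr1 mulrC.
have dc (x : R) : is_derive x 1 (fun x => cos (t * x)) (- t * sin (t * x)).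
  have -> : (fun x => cos (t * x)) = cos \o (fun x : R => t *: x) by [].
  by apply: is_derive_eq; rewrite -![_ *: _]/(_ * _) mulr1; ring.
have c1 : continuous (fun x : R => t * cos (t * x)).
  by move=> x; apply: cvgM; [exact: cvg_cst|exact: cc].
have c2 : continuous (fun x : R => - t * sin (t * x)).
  by move=> x; apply: cvgM; [exact: cvg_cst|exact: cs].
have b1 x : `|t * cos (t * x)| <= `|t| by rewrite normrM ler_piMr.
have b2 x : `|- t * sin (t * x)| <= `|t| by rewrite normrM normrN ler_piMr.
split; rewrite comm.
- by rewrite (normal_ibp m s0 ds c1 (bs t) b1) (ExZ t (mc t)) mulrCA mulrA.
- by rewrite (normal_ibp m s0 dc c2 (bc t) b2) (ExZ (- t) (ms t)) mulrCA mulrA !mulNr.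
Qed.

(** At [t = 1 / (n + 1)] the sine formula multiplied by [n + 1] reads [E (V (n + 1) sin (V / (n +
    1))) = s2 E cos (V / (n + 1))]; its limit is [E V^2 = s2]. *)
Lemma gaussian_ibp_trig V : measurable_fun [set: T] V -> gaussian P V ->
  Ex P V = 0 -> mom P V /\ forall t, let s2 := Ex P (fun w => V w ^+ 2) in
    Ex P (fun w => V w * sin (t * V w)) = t * s2 * Ex P (fun w => cos (t * V w)) /\
    Ex P (fun w => V w * cos (t * V w)) = - (t * s2 * Ex P (fun w => sin (t * V w))).
Proof.
move=> mV gV EV; have [mmV [s2 hs]] := gaussian_ibp_scale mV gV EV.
suff h : Ex P (fun w => V w ^+ 2) = s2 by split=> // t /=; rewrite h.
have mcos t : measurable_fun [set: T] (fun w => cos (t * V w)).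
  exact: (measurableT_comp (meas_cosM t) mV).
have msin t : measurable_fun [set: T] (fun w => sin (t * V w)).
  exact: (measurableT_comp (meas_sinM t) mV).
have l1 : Ex P (fun w => V w * (n.+1%:R * sin (n.+1%:R^-1 * V w))) @[n --> \oo]
    --> Ex P (fun w => V w ^+ 2).
  apply: (Ex_dct (g := fun w => V w ^+ 2)).
  - by move=> n; apply: measurable_funM => //; apply: measurable_funM.
  - exact: mom_exp.
  - move=> n w; rewrite normrM -(real_normK (num_real (V w))) expr2 ler_wpM2l //.
    rewrite normrM normr_nat.
    rewrite -ler_pdivlMl ?ltr0n // -[leLHS]/(`|_|) (le_trans (sin_abs_le _)) //.
    by rewrite normrM ger0_norm.
  - move=> w; rewrite expr2; apply: cvgMr.
    exact: cvg_sinM.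
have l2 : s2 * Ex P (fun w => cos (n.+1%:R^-1 * V w)) @[n --> \oo] --> s2.
  rewrite -[X in _ --> X]mulr1; apply: cvgMr.
  rewrite -[X in _ --> X](Ex_cst P 1).
  apply: (Ex_dct (g := fun=> 1)) => //.
  - exact: mom_cst.
  - by move=> n w; exact: cos_max.
  - move=> w; rewrite -[X in _ --> X]cos0; apply: continuous_cvg; first exact: continuous_cos.
    by rewrite -[X in _ --> X](mul0r (V w)); apply: cvgMl; exact: cvg_harmonic.
apply: (seq_cvg_unique l1 l2) => n.
have := (hs n.+1%:R^-1).1.
have -> : (fun w => V w * (n.+1%:R * sin (n.+1%:R^-1 * V w))) =
  (fun w => n.+1%:R * (V w * sin (n.+1%:R^-1 * V w))).
  by apply/funext => w; ring.
rewrite ExZ; last first.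
  by apply: mom_mul => //; apply: (@mom_bnd _ _ R P _ 1) => // w; exact: sin_max.
by move=> ->; rewrite !mulrA divff ?mul1r.
Qed.

End GaussianTrig.

Section CosDerive.
Context d (T : measurableType d) (R : realType) (P : probability T R).

Lemma measurable_cos_comp (f : T -> R) : measurable_fun [set: T] f ->
  measurable_fun [set: T] (fun w => cos (f w)).
Proof.
move=> mf; apply: (measurableT_comp _ mf).
by apply: continuous_measurable_fun; exact: continuous_cos.
Qed.

Lemma measurable_sin_comp (f : T -> R) : measurable_fun [set: T] f ->
  measurable_fun [set: T] (fun w => sin (f w)).
Proof.
move=> mf; apply: (measurableT_comp _ mf).
by apply: continuous_measurable_fun; exact: continuous_sin.
Qed.

Lemma mom_cos (f : T -> R) : measurable_fun [set: T] f -> mom P (fun w => cos (f w)).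
Proof.
move=> mf; apply: (@mom_bnd _ _ R P _ 1); first exact: measurable_cos_comp.
by move=> w; exact: cos_max.
Qed.

Lemma mom_sin (f : T -> R) : measurable_fun [set: T] f -> mom P (fun w => sin (f w)).
Proof.
move=> mf; apply: (@mom_bnd _ _ R P _ 1); first exact: measurable_sin_comp.
by move=> w; exact: sin_max.
Qed.

(** Differentiation under the integral, with [|U|] as dominating function for all parameters. *)
Lemma is_derive_Ex_cos (W U : T -> R) (s : R) : measurable_fun [set: T] W ->
  mom P U ->
  is_derive s 1 (fun s => Ex P (fun w => cos (W w + s * U w)))
    (- Ex P (fun w => U w * sin (W w + s * U w))).
Proof.
move=> mW mU.
have mWU t : measurable_fun [set: T] (fun w => W w + t * U w).
  by apply: measurable_funD => //; apply: measurable_funM => //; exact: mom_meas mU.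
pose f (t : R) (w : T) := cos (W w + t * U w).
have df (t : R) (w : T) : is_derive t 1 (fun t : R => f t w) (- (U w * sin (W w + t * U w))).
  have -> : (fun t => f t w) = cos \o (fun t : R => cst (W w) t + t *: U w) by [].
  apply: is_derive_eq; rewrite -![_ *: _]/(_ * _) /cst; ring.
have inI : `]s - 1, s + 1[%classic s by rewrite /= in_itv /= ltrBlDr ltrDl ltr01.
have intf t : `]s - 1, s + 1[%classic t -> P.-integrable [set: T] (EFin \o f t).
  by move=> _; apply: mom_integrable; exact: mom_cos.
have der t y : `]s - 1, s + 1[%classic t -> [set: T] y -> derivable (fun t => f t y) t 1.
  by move=> _ _; case: (df t y).
have G0 y : 0 <= `|U y| by [].
have iG : P.-integrable [set: T] (EFin \o (fun y => `|U y|)).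
  by apply: mom_integrable; exact: mom_abs.
have part t y : partial1of2 f t y = - (U y * sin (W y + t * U y)).
  by rewrite partial1of2E; case: (df t y).
have Gub t y : `]s - 1, s + 1[%classic t -> [set: T] y -> `|partial1of2 f t y| <= `|U y|.
  by move=> _ _; rewrite part normrN normrM ler_piMr // sin_max.
have D1 := derivable_under_integral measurableT inI intf der G0 iG Gub.
have D2 := differentiation_under_integral measurableT inI intf der G0 iG Gub.
apply: DeriveDef; first exact: D1.
move: D2; rewrite derive1E => ->.
rewrite -ExN; last first.
  by apply: mom_mul => //; exact: mom_sin.
by rewrite /Ex; congr Rintegral; apply/funext => y; rewrite part.
Qed.

(** As a function of [t], [f t = E cos (c + t V)] solves [f' = - t v f] by the trigonometric
    formulas, so [f t] times [expR (t^2 v / 2)] is constant. *)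
Lemma Ex_cos_gaussian (V : T -> R) (c : R) : measurable_fun [set: T] V ->
  gaussian P V -> Ex P V = 0 ->
  Ex P (fun w => cos (c + V w)) = cos c * expR (- (Ex P (fun w => V w ^+ 2) / 2)).
Proof.
move=> mV gV EV; have [mmV h] := gaussian_ibp_trig mV gV EV.
set v := Ex P (fun w => V w ^+ 2) in h *.
pose f t := Ex P (fun w => cos (cst c w + t * V w)).
have mtV t : measurable_fun [set: T] (fun w => t * V w) by apply: measurable_funM.
have df (t : R) : is_derive t 1 f (- (t * v * f t)).
  have -> : - (t * v * f t) = - Ex P (fun w => V w * sin (cst c w + t * V w)); last first.
    by apply: is_derive_Ex_cos.
  congr (- _); rewrite /f /cst.
  have -> : (fun w => cos (c + t * V w)) =
    (fun w => cos c * cos (t * V w) - sin c * sin (t * V w)).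
    by apply/funext => w; rewrite cosD.
  have -> : (fun w => V w * sin (c + t * V w)) =
    (fun w => cos c * (V w * sin (t * V w)) + sin c * (V w * cos (t * V w))).
    by apply/funext => w; rewrite sinD; ring.
  have mc := mom_cos (mtV t); have ms := mom_sin (mtV t).
  have mvc := mom_mul mmV mc; have mvs := mom_mul mmV ms.
  rewrite (ExB (mom_scal _ mc) (mom_scal _ ms)) (ExD (mom_scal _ mvs) (mom_scal _ mvc)).
  rewrite (ExZ _ mc) (ExZ _ ms) (ExZ _ mvc) (ExZ _ mvs).
  by rewrite (h t).1 (h t).2 -/v; ring.
pose g t := f t * expR (t ^+ 2 * (v / 2)).
have dg (t : R) : is_derive t 1 g 0.
  have de : is_derive t 1 (fun t : R => expR (t ^+ 2 * (v / 2))) (t * v * expR (t ^+ 2 * (v / 2))).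
    have -> : (fun t : R => expR (t ^+ 2 * (v / 2))) = expR \o (fun t : R => t ^+ 2 *: (v / 2)) by [].
    apply: is_derive_eq; rewrite -![_ *: _]/(_ * _).
    by move: (expR _) => e; field.
  have H := is_deriveM (df t) de; apply: (is_derive_eq H).
  rewrite -![_ *: _]/(_ * _); ring.
have := @is_derive_0_is_cst R g 1 0 dg.
rewrite /g expr0n /= mul0r expR0 mulr1 expr1n mul1r /f /cst.
have -> : (fun w => cos (c + 1 * V w)) = (fun w => cos (c + V w)).
  by apply/funext => w; rewrite mul1r.
have -> : (fun w => cos (c + 0 * V w)) = (fun=> cos c).
  by apply/funext => w; rewrite mul0r addr0.
by rewrite Ex_cst => <-; rewrite -mulrA -expRD addrN expR0 mulr1.
Qed.

End CosDerive.

(** * Integration by parts in a Gaussian space *)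

Section GaussianSpace.
Context d (T : measurableType d) (R : realType) (P : probability T R).
Variable G : (T -> R) -> Prop.

(** Only the laws of single elements are constrained; closure under [U + a V] is what encodes joint
    Gaussianity. *)
Definition gaussian_space :=
  [/\ forall U V a, G U -> G V -> G (fun w => U w + a * V w),
      forall V, G V -> measurable_fun [set: T] V,
      forall V, G V -> gaussian P V &
      forall V, G V -> Ex P V = 0].

Hypothesis GS : gaussian_space.

Lemma GS_lin U V a : G U -> G V -> G (fun w => U w + a * V w).
Proof. by case: GS => + _ _ _; exact. Qed.

Lemma GS_meas V : G V -> measurable_fun [set: T] V.
Proof. by case: GS => _ + _ _; exact. Qed.

Lemma GS_mom V : G V -> mom P V.
Proof.
move=> GV; case: GS => _ h1 h2 h3.
by case: (gaussian_ibp_trig (h1 _ GV) (h2 _ GV) (h3 _ GV)).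
Qed.

Lemma GS_scale a V : G V -> G (fun w => a * V w).
Proof.
move=> GV; have := GS_lin (a - 1) GV GV; congr G; apply/funext => w; ring.
Qed.

Lemma GS_zero V : G V -> G (fun=> 0).
Proof. by move=> /(GS_scale 0); congr G; apply/funext => w; rewrite mul0r. Qed.

Lemma Ex_mul_lin U V W (a : R) : G U -> G V -> G W ->
  Ex P (fun w => U w * (V w + a * W w)) =
  Ex P (fun w => U w * V w) + a * Ex P (fun w => U w * W w).
Proof.
move=> /GS_mom mU /GS_mom mV /GS_mom mW.
have -> : (fun w => U w * (V w + a * W w)) = (fun w => U w * V w + a * (U w * W w)).
  by apply/funext => w; ring.
by rewrite ExD ?ExZ //; [exact: mom_mul|exact: mom_mul|apply: mom_scal; exact: mom_mul].
Qed.

Lemma Ex_cos_space V c : G V ->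
  Ex P (fun w => cos (c + V w)) = cos c * expR (- (Ex P (fun w => V w ^+ 2) / 2)).
Proof.
by move=> GV; case: GS => _ h1 h2 h3; exact: Ex_cos_gaussian (h1 _ GV) (h2 _ GV) (h3 _ GV).
Qed.

(** [E cos (c + V + s U)] is differentiated at [s = 0] in two ways: under the integral, and in its
    closed form, whose exponent is [- q s / 2] with [q] quadratic and of slope [2 E (U V)] at 0. *)
Lemma Ex_mul_sin_space U V c : G U -> G V ->
  Ex P (fun w => U w * sin (c + V w)) =
  Ex P (fun w => U w * V w) * Ex P (fun w => cos (c + V w)).
Proof.
move=> GU GV; have mU := GS_mom GU; have mV := GS_mom GV.
have mcV : measurable_fun [set: T] (fun w => c + V w).
  by apply: measurable_funD => //; exact: GS_meas.
have := is_derive_Ex_cos 0 mcV mU.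
have -> : (fun w => U w * sin (c + V w + 0 * U w)) = (fun w => U w * sin (c + V w)).
  by apply/funext => w; rewrite mul0r addr0.
set e := Ex P (fun w => U w * sin _) => D1.
pose q (s : R) := Ex P (fun w => V w ^+ 2) + 2 * s * Ex P (fun w => U w * V w) +
  s ^+ 2 * Ex P (fun w => U w ^+ 2).
have E s : Ex P (fun w => cos (c + V w + s * U w)) = cos c * expR (- (q s / 2)).
  have -> : (fun w => cos (c + V w + s * U w)) = (fun w => cos (c + (V w + s * U w))).
    by apply/funext => w; rewrite addrA.
  rewrite Ex_cos_space; last exact: GS_lin.
  congr (_ * expR (- (_ / 2))); rewrite /q.
  have -> : (fun w => (V w + s * U w) ^+ 2) =
      (fun w => V w ^+ 2 + (2 * s * (U w * V w) + s ^+ 2 * U w ^+ 2)).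
    by apply/funext => w; ring.
  have m1 := mom_exp 2 mV; have m2 := mom_exp 2 mU; have m3 := mom_mul mU mV.
  have m4 := mom_scal (2 * s) m3; have m5 := mom_scal (s ^+ 2) m2.
  by rewrite (ExD m1 (mom_add m4 m5)) (ExD m4 m5) (ExZ _ m3) (ExZ _ m2) addrA.
have D2 : is_derive (0 : R) 1 (fun s => Ex P (fun w => cos (c + V w + s * U w)))
    (- (Ex P (fun w => U w * V w) * (cos c * expR (- (q 0 / 2))))).
  have -> : (fun s => Ex P (fun w => cos (c + V w + s * U w))) =
    (fun s => cos c *: (expR \o (fun s : R => cst (- Ex P (fun w => V w ^+ 2) / 2) s +
      s *: (- Ex P (fun w => U w * V w)) +
      s ^+ 2 *: (- Ex P (fun w => U w ^+ 2) / 2))) s).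
    apply/funext => s; rewrite E /q /=; congr (_ * expR _).
    by rewrite -![_ *: _]/(_ * _); field.
  apply: is_derive_eq; rewrite -![_ *: _]/(_ * _) /q /cst /=.
  have -> : (- Ex P (fun w => V w ^+ 2) / 2 + 0 * - Ex P (fun w => U w * V w) +
     0 ^+ 2 * (- Ex P (fun w => U w ^+ 2) / 2)) = - ((Ex P (fun w => V w ^+ 2) +
     2 * 0 * Ex P (fun w => U w * V w) + 0 ^+ 2 * Ex P (fun w => U w ^+ 2)) / 2).
    by field.
  move: (expR _) => e0; ring.
have h : - e = - (Ex P (fun w => U w * V w) * (cos c * expR (- (q 0 / 2)))).
  by rewrite -(@derive_val _ _ _ _ _ _ _ D1) -(@derive_val _ _ _ _ _ _ _ D2).
move/oppr_inj : h => ->; congr (_ * _); rewrite Ex_cos_space // /q.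
by rewrite mulr0 mul0r expr0n /= mul0r !addr0.
Qed.

Lemma Ex_mul_cos_space U V c : G U -> G V ->
  Ex P (fun w => U w * cos (c + V w)) =
  - (Ex P (fun w => U w * V w) * Ex P (fun w => sin (c + V w))).
Proof.
move=> GU GV; have := Ex_mul_sin_space (pi / 2 + c) GU GV.
have -> : (fun w => U w * sin (pi / 2 + c + V w)) = (fun w => U w * cos (c + V w)).
  by apply/funext => w; rewrite -addrA sinD sin_pihalf cos_pihalf mul1r mul0r addr0.
have -> : (fun w => cos (pi / 2 + c + V w)) = (fun w => - sin (c + V w)).
  by apply/funext => w; rewrite -addrA cosD sin_pihalf cos_pihalf mul1r mul0r add0r.
rewrite ExN ?mulrN //; apply: mom_sin.
by apply: measurable_funD => //; exact: GS_meas.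
Qed.

End GaussianSpace.

(** Produces the Gaussian factor as a bounded limit of trigonometric functions. The exponent is [n]
    under a root of [n + 1] because this is the power left after differentiating [cos ^+ n.+1]. *)
Lemma cvg_cos_exp {R : realType} (b : R) :
  cos (b / Num.sqrt n.+1%:R) ^+ n @[n --> \oo] --> expR (- (b ^+ 2 / 2)).
Proof.
pose r (n : nat) : R := (Num.sqrt n.+1%:R)^-1.
have r_ge0 n : 0 < r n by rewrite invr_gt0 sqrtr_gt0 ltr0n.
have r2 n : r n ^+ 2 = n.+1%:R^-1 by rewrite exprVn sqr_sqrtr ?ler0n.
have r0 : r n @[n --> \oo] --> (0 : R).
  have : Num.sqrt (harmonic n) @[n --> \oo] --> Num.sqrt (0 : R).
    by apply: continuous_cvg; [exact: sqrt_continuous|exact: cvg_harmonic].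
  rewrite sqrtr0; apply: cvg_trans; apply: near_eq_cvg; near=> n.
  by rewrite /harmonic /r /= sqrtrV ?ler0n.
(* The bases of both [n.+1]-st powers agree to second order in [r n]. *)
have l1 : n.+1%:R * (1 - cos (b * r n)) @[n --> \oo] --> b ^+ 2 / 2.
  have s1 : (r n)^-1 * sin (b / 2 * r n) @[n --> \oo] --> b / 2.
    have df : is_derive (0 : R) 1 (sin \o (fun x : R => (b / 2) *: x)) (b / 2).
      apply: is_derive_eq; rewrite -![_ *: _]/(_ * _) mulr0 cos0; ring.
    have rn0 n : r n != 0 by rewrite gt_eqF.
    have := cvg_diffquot df rn0 r0; apply: cvg_trans; apply: near_eq_cvg; near=> n.
    by rewrite /= -![_ *: _]/(_ * _) mulr0 sin0 subr0 add0r.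
  have s2 : 2 * ((r n)^-1 * sin (b / 2 * r n)) ^+ 2 @[n --> \oo] --> 2 * (b / 2) ^+ 2.
    by apply: cvgMr; rewrite [_ ^+ 2]expr2; under eq_fun do rewrite expr2; exact: cvgM.
  have -> : b ^+ 2 / 2 = 2 * (b / 2) ^+ 2 by field.
  apply: cvg_trans s2; apply: near_eq_cvg; near=> n.
  rewrite exprMn exprVn r2 invrK.
  have -> : b * r n = (b / 2 * r n) *+ 2 by rewrite -mulr_natr; field.
  rewrite cos_mulr2n; have := cos2Dsin2 (b / 2 * r n).
  move: (cos _) (sin _) (n.+1%:R : R) => x y z h.
  have -> : x ^+ 2 = 1 - y ^+ 2 by rewrite -h addrK.
  by ring.
have l2 : n.+1%:R * (1 - expR (- (b ^+ 2 / 2) * r n ^+ 2)) @[n --> \oo] --> b ^+ 2 / 2.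
  have df : is_derive (0 : R) 1 (expR \o (fun x : R => (- (b ^+ 2 / 2)) *: x)) (- (b ^+ 2 / 2)).
    apply: is_derive_eq; rewrite -![_ *: _]/(_ * _) mulr0 expR0; ring.
  have hn0 n : harmonic n != 0 :> R by rewrite invr_neq0.
  have := cvg_diffquot df hn0 cvg_harmonic => /cvgN; rewrite opprK.
  apply: cvg_trans; apply: near_eq_cvg; near=> n.
  rewrite r2 fctE /= !add0r -![_ *: _]/(_ * _) mulr0 expR0 /harmonic /= invrK.
  by rewrite -mulrN opprB.
have l3 : n.+1%:R * (cos (b * r n) - expR (- (b ^+ 2 / 2) * r n ^+ 2)) @[n --> \oo] --> (0 : R).
  apply: (cvg_seq_ext (cvgB l2 l1)) => [|n]; first by rewrite subrr.
  by rewrite -[LHS]/(_ * _ - _ * _) -mulrBr; congr (_ * _); ring.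
have powB (x y : R) n : `|x| <= 1 -> `|y| <= 1 -> `|x ^+ n - y ^+ n| <= n%:R * `|x - y|.
  move=> x1 y1; elim: n => [|n IHn]; first by rewrite !expr0 subrr normr0 mul0r.
  have -> : x ^+ n.+1 - y ^+ n.+1 = x * (x ^+ n - y ^+ n) + (x - y) * y ^+ n.
    by rewrite !exprS; ring.
  rewrite (le_trans (ler_normD _ _)) // !normrM -natr1 mulrDl mul1r lerD //.
    by rewrite (le_trans _ IHn) // ler_piMl.
  by rewrite ler_piMr // normrX exprn_ile1.
have e1 (x : R) : 0 <= x -> `|expR (- x)| <= 1.
  by move=> x0; rewrite ger0_norm ?expR_ge0 // -expR0 ler_expR oppr_le0.
have l4 : cos (b * r n) ^+ n - expR (- (b ^+ 2 / 2 * r n ^+ 2)) ^+ n @[n --> \oo] --> (0 : R).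
  apply: (cvg0_le _ l3) => n; rewrite mulNr [leRHS]normrM normr_nat.
  apply: (le_trans (powB _ _ _ _ _)); first exact: cos_max.
    by apply: e1; apply: mulr_ge0; [apply: divr_ge0; [exact: sqr_ge0|]|exact: sqr_ge0].
  by rewrite ler_wpM2r // ler_nat.
have l5 : expR (- (b ^+ 2 / 2 * r n ^+ 2)) ^+ n @[n --> \oo] --> expR (- (b ^+ 2 / 2)).
  have : expR (- (b ^+ 2 / 2) * (1 - harmonic n)) @[n --> \oo] --> expR (- (b ^+ 2 / 2) * (1 - 0)).
    apply: continuous_cvg; first exact: continuous_expR.
    by apply: cvgMr; apply: cvgB; [exact: cvg_cst|exact: cvg_harmonic].
  rewrite subr0 mulr1; apply: cvg_trans; apply: near_eq_cvg; near=> n.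
  rewrite -expRM_natl r2 /harmonic /=; congr expR.
  by rewrite -[X in _ * (1 - X)]mul1r; field.
by apply: (cvg_seq_ext (cvgD l4 l5)) => [|n]; rewrite ?add0r // fctE /= subrK.
Unshelve. all: by end_near. Qed.

Section Ibp.
Context d (T : measurableType d) (R : realType) (P : probability T R).
Variable G : (T -> R) -> Prop.
Hypothesis GS : gaussian_space P G.
Variable U : T -> R.
Hypothesis GU : G U.
Local Notation c_ V := (Ex P (fun w => U w * V w)).

(* [h'] stands for the derivative of [h] in the direction of [U]; testing against
   [cos (c + V)] rather than against [1] makes the relation stable under products. *)
Definition ibp (h h' : T -> R) := [/\ mom P h, mom P h' &
  forall V c, G V -> Ex P (fun w => U w * h w * cos (c + V w)) =
    Ex P (fun w => h' w * cos (c + V w)) - c_ V * Ex P (fun w => h w * sin (c + V w))].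

Lemma ibp_ext h1 h1' h2 h2' : ibp h1 h1' -> h1 =1 h2 -> h1' =1 h2' -> ibp h2 h2'.
Proof. by move=> H /funext <- /funext <-. Qed.

Lemma GS_measD V c : G V -> measurable_fun [set: T] (fun w => c + V w).
Proof. by move=> GV; apply: measurable_funD => //; exact: (GS_meas GS). Qed.

(** The zero variable belongs to [G], and with [c = 0] the test is the constant 1. *)
Lemma ibpE h h' : ibp h h' -> Ex P (fun w => U w * h w) = Ex P h'.
Proof.
move=> [mh mh' /(_ (fun=> 0) 0 (GS_zero GS GU))].
have e w (g : T -> R) : g w * cos (0 + 0) = g w by rewrite addr0 cos0 mulr1.
under eq_fun do rewrite addr0 cos0 mulr1.
under [X in _ = Ex P X - _]eq_fun do rewrite addr0 cos0 mulr1.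
have -> : c_ (fun=> 0) = 0 by under eq_fun do rewrite mulr0; rewrite Ex_cst.
by rewrite mul0r subr0.
Qed.

Lemma ibp_one : ibp (fun=> 1) (fun=> 0).
Proof.
split; [exact: mom_cst|exact: mom_cst|move=> V c GV].
under [X in Ex P X = _]eq_fun do rewrite mulr1.
under [X in _ = Ex P X - _]eq_fun do rewrite mul0r.
under [X in _ = _ - _ * Ex P X]eq_fun do rewrite mul1r.
by rewrite Ex_cst sub0r (Ex_mul_cos_space GS).
Qed.

Lemma ibp_lin a h1 h1' h2 h2' : ibp h1 h1' -> ibp h2 h2' ->
  ibp (fun w => h1 w + a * h2 w) (fun w => h1' w + a * h2' w).
Proof.
move=> [m1 m1' H1] [m2 m2' H2]; split; [by apply: mom_add => //; exact: mom_scal|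
  by apply: mom_add => //; exact: mom_scal|move=> V c GV].
have mc := mom_cos P (GS_measD c GV); have ms := mom_sin P (GS_measD c GV).
have mU := GS_mom GS GU.
have lin f g k : mom P f -> mom P g -> mom P k ->
    Ex P (fun w => (f w + a * g w) * k w) =
    Ex P (fun w => f w * k w) + a * Ex P (fun w => g w * k w).
  move=> mf mg mk; rewrite -ExZ; last exact: mom_mul.
  rewrite -ExD; [|exact: mom_mul|by apply: mom_scal; exact: mom_mul].
  by congr Ex; apply/funext => w; ring.
rewrite !lin // (_ : (fun w => U w * (h1 w + a * h2 w) * cos (c + V w)) =
  (fun w => (U w * h1 w + a * (U w * h2 w)) * cos (c + V w))); last first.
  by apply/funext => w; ring.
rewrite lin //; [|exact: mom_mul|exact: mom_mul].
by rewrite H1 // H2 //; ring.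
Qed.

Lemma ibp_scal a h h' : ibp h h' -> ibp (fun w => a * h w) (fun w => a * h' w).
Proof.
move=> H; apply: (ibp_ext (ibp_lin (a - 1) H H)) => w; ring.
Qed.

Lemma ibp_lim (h_ h'_ : nat -> T -> R) h h' g g' :
  (forall n, ibp (h_ n) (h'_ n)) -> mom P g -> mom P g' ->
  (forall n w, `|h_ n w| <= g w) -> (forall n w, `|h'_ n w| <= g' w) ->
  (forall w, h_ n w @[n --> \oo] --> h w) ->
  (forall w, h'_ n w @[n --> \oo] --> h' w) -> ibp h h'.
Proof.
move=> H mg mg' hg hg' cv cv'.
have mh_ n : mom P (h_ n) by case: (H n).
have mh'_ n : mom P (h'_ n) by case: (H n).
split.
- exact: (mom_lim (fun n => mom_meas (mh_ n)) mg hg cv).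
- exact: (mom_lim (fun n => mom_meas (mh'_ n)) mg' hg' cv').
move=> V c GV.
have mU := GS_mom GS GU.
have mc := mom_cos P (GS_measD c GV); have ms := mom_sin P (GS_measD c GV).
have l1 : Ex P (fun w => U w * h_ n w * cos (c + V w)) @[n --> \oo] -->
    Ex P (fun w => U w * h w * cos (c + V w)).
  apply: (Ex_dct (g := fun w => `|U w| * g w)).
  - by move=> n; apply: (@mom_meas _ _ _ P); apply: mom_mul => //; exact: mom_mul.
  - by apply: mom_mul => //; exact: mom_abs.
  - move=> n w; rewrite normrM -[leRHS]mulr1; apply: ler_pM => //.
      by rewrite normrM ler_wpM2l.
    exact: cos_max.
  - by move=> w; apply: cvgMl; apply: cvgMr; exact: cv.
have l2 : Ex P (fun w => h'_ n w * cos (c + V w)) @[n --> \oo] -->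
    Ex P (fun w => h' w * cos (c + V w)).
  apply: (Ex_dct (g := g')) => //.
  - by move=> n; apply: (@mom_meas _ _ _ P); apply: mom_mul.
  - move=> n w; rewrite normrM -[leRHS]mulr1; apply: ler_pM => //; exact: cos_max.
  - by move=> w; apply: cvgMl; exact: cv'.
have l3 : Ex P (fun w => h_ n w * sin (c + V w)) @[n --> \oo] -->
    Ex P (fun w => h w * sin (c + V w)).
  apply: (Ex_dct (g := g)) => //.
  - by move=> n; apply: (@mom_meas _ _ _ P); apply: mom_mul.
  - move=> n w; rewrite normrM -[leRHS]mulr1; apply: ler_pM => //; exact: sin_max.
  - by move=> w; apply: cvgMl; exact: cv.
have l4 : c_ V * Ex P (fun w => h_ n w * sin (c + V w)) @[n --> \oo] -->
    c_ V * Ex P (fun w => h w * sin (c + V w)) by apply: cvgMr; exact: l3.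
apply: (seq_cvg_unique l1 (cvgB l2 l4)) => n.
by case: (H n) => _ _ /(_ V c GV).
Qed.

(** Product-to-sum formulas turn the new factor times the test into tests along [W + V] and [W - V],
    both in [G], to which the hypothesis on [h] applies. Their covariances with [U] are
    [c_ W + c_ V] and [c_ W - c_ V], and the Leibniz rule results. *)
Lemma ibp_cos h h' W b : G W -> ibp h h' ->
  ibp (fun w => h w * cos (b + W w))
      (fun w => h' w * cos (b + W w) - c_ W * (h w * sin (b + W w))).
Proof.
move=> GW [mh mh' H].
have mU := GS_mom GS GU.
have mcW := mom_cos P (GS_measD b GW); have msW := mom_sin P (GS_measD b GW).
split; [exact: mom_mul|apply: mom_sub; first exact: mom_mul|].
  by apply: mom_scal; exact: mom_mul.
move=> V c GV.
have GWV : G (fun w => W w + 1 * V w) by exact: (GS_lin GS).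
have GWV' : G (fun w => W w + (-1) * V w) by exact: (GS_lin GS).
have E1 := H _ (b + c) GWV; have E2 := H _ (b - c) GWV'.
have cc w : cos (b + W w) * cos (c + V w) =
    2^-1 * cos (b + c + (W w + 1 * V w)) + 2^-1 * cos (b - c + (W w + (-1) * V w)).
  rewrite (_ : b + c + (W w + 1 * V w) = (b + W w) + (c + V w)); last by ring.
  rewrite (_ : b - c + (W w + (-1) * V w) = (b + W w) - (c + V w)); last by ring.
  by rewrite (cosD (b + W w)) (cosB (b + W w)); field.
have sc w : sin (b + W w) * cos (c + V w) =
    2^-1 * sin (b + c + (W w + 1 * V w)) + 2^-1 * sin (b - c + (W w + (-1) * V w)).
  rewrite (_ : b + c + (W w + 1 * V w) = (b + W w) + (c + V w)); last by ring.
  rewrite (_ : b - c + (W w + (-1) * V w) = (b + W w) - (c + V w)); last by ring.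
  by rewrite (sinD (b + W w)) (sinB (b + W w)); field.
have cs w : cos (b + W w) * sin (c + V w) =
    2^-1 * sin (b + c + (W w + 1 * V w)) - 2^-1 * sin (b - c + (W w + (-1) * V w)).
  rewrite (_ : b + c + (W w + 1 * V w) = (b + W w) + (c + V w)); last by ring.
  rewrite (_ : b - c + (W w + (-1) * V w) = (b + W w) - (c + V w)); last by ring.
  by rewrite (sinD (b + W w)) (sinB (b + W w)); field.
have cWV : c_ (fun w => W w + 1 * V w) = c_ W + c_ V.
  by rewrite (Ex_mul_lin GS) // mul1r.
have cWV' : c_ (fun w => W w + (-1) * V w) = c_ W - c_ V.
  by rewrite (Ex_mul_lin GS) // mulN1r.
have mcp := mom_cos P (GS_measD (b + c) GWV); have mcm := mom_cos P (GS_measD (b - c) GWV').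
have msp := mom_sin P (GS_measD (b + c) GWV); have msm := mom_sin P (GS_measD (b - c) GWV').
have lin a1 a2 f k1 k2 : mom P f -> mom P k1 -> mom P k2 ->
    Ex P (fun w => f w * (a1 * k1 w + a2 * k2 w)) =
    a1 * Ex P (fun w => f w * k1 w) + a2 * Ex P (fun w => f w * k2 w).
  move=> mf mk1 mk2; have mm1 := mom_mul mf mk1; have mm2 := mom_mul mf mk2.
  rewrite -!ExZ // -ExD; [|exact: mom_scal|exact: mom_scal].
  by congr Ex; apply/funext => w; ring.
have L1 : Ex P (fun w => U w * (h w * cos (b + W w)) * cos (c + V w)) =
    2^-1 * Ex P (fun w => U w * h w * cos (b + c + (W w + 1 * V w))) +
    2^-1 * Ex P (fun w => U w * h w * cos (b - c + (W w + (-1) * V w))).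
  rewrite -lin //; last exact: mom_mul.
  by congr Ex; apply/funext => w; rewrite -cc; ring.
have L2 : Ex P (fun w => (h' w * cos (b + W w) - c_ W * (h w * sin (b + W w))) * cos (c + V w)) =
    (2^-1 * Ex P (fun w => h' w * cos (b + c + (W w + 1 * V w))) +
    2^-1 * Ex P (fun w => h' w * cos (b - c + (W w + (-1) * V w)))) - c_ W *
    (2^-1 * Ex P (fun w => h w * sin (b + c + (W w + 1 * V w))) +
    2^-1 * Ex P (fun w => h w * sin (b - c + (W w + (-1) * V w)))).
  rewrite -!lin // -ExZ -?ExB.
  - by congr Ex; apply/funext => w; rewrite -cc -sc; ring.
  - by apply: mom_mul => //; apply: mom_add; exact: mom_scal.
  - by apply: mom_scal; apply: mom_mul => //; apply: mom_add; exact: mom_scal.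
  - by apply: mom_mul => //; apply: mom_add; exact: mom_scal.
have L3 : Ex P (fun w => h w * cos (b + W w) * sin (c + V w)) =
    2^-1 * Ex P (fun w => h w * sin (b + c + (W w + 1 * V w))) +
    (- 2^-1) * Ex P (fun w => h w * sin (b - c + (W w + (-1) * V w))).
  rewrite -lin //.
  by congr Ex; apply/funext => w; rewrite -mulrA cs; ring.
rewrite L1 L2 L3 E1 E2 cWV cWV'; ring.
Qed.

End Ibp.

Section IbpClosure.
Context d (T : measurableType d) (R : realType) (P : probability T R).
Variable G : (T -> R) -> Prop.
Hypothesis GS : gaussian_space P G.
Variable U : T -> R.
Hypothesis GU : G U.
Local Notation c_ V := (Ex P (fun w => U w * V w)).
Local Notation ibp := (ibp P G U).

Lemma covZ a V : G V -> c_ (fun w => a * V w) = a * c_ V.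
Proof.
move=> GV; rewrite -ExZ; last by apply: mom_mul; [exact: (GS_mom GS)|exact: (GS_mom GS)].
by congr Ex; apply/funext => w; ring.
Qed.

(** [W] is the limit of [(n + 1) sin (W / (n + 1))], and a sine is a cosine with phase
    [- pi / 2]. *)
Lemma ibp_mul h h' W : G W -> ibp h h' ->
  ibp (fun w => h w * W w) (fun w => h' w * W w + c_ W * h w).
Proof.
move=> GW H; have [mh mh' _] := H; have mW := GS_mom GS GW.
pose a (n : nat) : R := n.+1%:R^-1.
have GaW n : G (fun w => a n * W w) by exact: (GS_scale GS).
have sE (x : R) : cos (- (pi / 2) + x) = sin x by rewrite addrC cosBpihalf.
have cE (x : R) : sin (- (pi / 2) + x) = - cos x by rewrite addrC sinBpihalf.
have an (n : nat) : n.+1%:R * a n = 1 by rewrite divff.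
have H1 n : ibp (fun w => h w * (n.+1%:R * sin (a n * W w)))
    (fun w => h' w * (n.+1%:R * sin (a n * W w)) + c_ W * (h w * cos (a n * W w))).
  apply: (ibp_ext (ibp_scal GS GU n.+1%:R (ibp_cos GS GU (- (pi / 2)) (GaW n) H))) => w.
    by rewrite sE; ring.
  rewrite sE cE covZ //.
  have -> : c_ W * (h w * cos (a n * W w)) = n.+1%:R * a n * c_ W * (h w * cos (a n * W w)).
    by rewrite an mul1r.
  by ring.
have bs n w : `|n.+1%:R * sin (a n * W w)| <= `|W w|.
  rewrite normrM (ger0_norm (ler0n _ _)) (le_trans (ler_wpM2l _ (sin_abs_le _))) //.
  by rewrite normrM (ger0_norm (_ : 0 <= a n)) ?invr_ge0 // mulrA an mul1r.
apply: (ibp_lim GS GU (g := fun w => `|h w| * `|W w|)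
   (g' := fun w => `|h' w| * `|W w| + `|c_ W| * `|h w|) H1).
- by apply: mom_mul; exact: mom_abs.
- by apply: mom_add; [apply: mom_mul; exact: mom_abs|apply: mom_scal; exact: mom_abs].
- by move=> n w; rewrite normrM ler_wpM2l.
- move=> n w; rewrite (le_trans (ler_normD _ _)) // lerD // normrM ?ler_wpM2l //.
  by rewrite normrM ler_piMr // cos_max.
- by move=> w; apply: cvgMr; exact: cvg_sinM.
- move=> w; apply: cvgD; first by apply: cvgMr; exact: cvg_sinM.
  apply: cvgMr; rewrite -[X in _ --> X]mulr1; apply: cvgMr.
  rewrite -[X in _ --> X]cos0; apply: continuous_cvg; first exact: continuous_cos.
  by rewrite -[X in _ --> X](mul0r (W w)); apply: cvgMl; exact: cvg_harmonic.
Qed.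

Lemma ibp_cosX h h' W n : G W -> ibp h h' ->
  ibp (fun w => h w * cos (W w) ^+ n)
      (fun w => h' w * cos (W w) ^+ n - n%:R * c_ W * (h w * sin (W w) * cos (W w) ^+ n.-1)).
Proof.
move=> GW H; elim: n => [|n IHn].
  by apply: (ibp_ext H) => w; rewrite expr0; ring.
apply: (ibp_ext (ibp_cos GS GU 0 GW IHn)) => w; rewrite add0r.
  by rewrite exprSr mulrA.
case: n {IHn} => [|n] /=; first by rewrite !expr0 expr1; ring.
have -> : n.+2%:R = n.+1%:R + 1 :> R by rewrite natr1.
by rewrite !(exprS _ n.+1) !(exprS _ n); move: (n.+1%:R : R) (c_ W) => x y; ring.
Qed.

(** The factor is the limit of [cos (V n) ^+ n.+1] with [V n = a W / sqrt (n + 1)], for which the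
    Leibniz rule has been iterated. *)
Lemma ibp_gauss h h' W (a : R) : G W -> ibp h h' ->
  ibp (fun w => h w * expR (- (a * W w) ^+ 2 / 2))
      (fun w => h' w * expR (- (a * W w) ^+ 2 / 2) -
         a ^+ 2 * c_ W * W w * (h w * expR (- (a * W w) ^+ 2 / 2))).
Proof.
move=> GW H; have [mh mh' _] := H; have mW := GS_mom GS GW.
pose s (n : nat) : R := Num.sqrt n.+1%:R.
have s0 n : 0 < s n by rewrite sqrtr_gt0.
have s2 n : s n ^+ 2 = n.+1%:R by rewrite sqr_sqrtr.
have rcv : (s n)^-1 @[n --> \oo] --> (0 : R).
  have : Num.sqrt (harmonic n) @[n --> \oo] --> Num.sqrt (0 : R).
    by apply: continuous_cvg; [exact: sqrt_continuous|exact: cvg_harmonic].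
  rewrite sqrtr0; apply: cvg_trans; apply: near_eq_cvg; near=> n.
  by rewrite /harmonic /s /= sqrtrV ?ler0n.
pose V n w := a / s n * W w.
have GV n : G (V n) by exact: (GS_scale GS).
have VE n w : V n w = (a * W w) / s n by rewrite /V mulrAC.
have scv w : s n * sin (V n w) @[n --> \oo] --> a * W w.
  have df : is_derive (0 : R) 1 (sin \o (fun x : R => (a * W w) *: x)) (a * W w).
    by apply: is_derive_eq; rewrite -![_ *: _]/(_ * _) mulr0 cos0; ring.
  have rn0 n : (s n)^-1 != 0 by rewrite invr_neq0 // gt_eqF.
  apply: (cvg_seq_ext (cvg_diffquot df rn0 rcv)) => // n.
  by rewrite invrK /= -![_ *: _]/(_ * _) mulr0 sin0 subr0 add0r VE.
have ccv w : cos (V n w) ^+ n @[n --> \oo] --> expR (- (a * W w) ^+ 2 / 2).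
  apply: (cvg_seq_ext (@cvg_cos_exp R (a * W w))); first by rewrite mulNr.
  by move=> n; rewrite VE.
have ccv1 w : cos (V n w) @[n --> \oo] --> (1 : R).
  rewrite -[X in _ --> X]cos0; apply: continuous_cvg; first exact: continuous_cos.
  rewrite -[X in _ --> X](mulr0 (a * W w)).
  by apply: (cvg_seq_ext (cvg_scalel (a * W w) rcv)) => // n; rewrite VE.
have H1 n := ibp_cosX n.+1 (GV n) H.
have cX n w k : `|cos (V n w) ^+ k| <= 1 by rewrite normrX exprn_ile1 // cos_max.
(* One factor [sqrt (n + 1)] cancels the scaling of the covariance; the other keeps the sine of
   order 1, below [|a W|]. *)
have dE n w : n.+1%:R * c_ (V n) * (h w * sin (V n w) * cos (V n w) ^+ n) =
  (a * c_ W) * (h w * (s n * sin (V n w)) * cos (V n w) ^+ n).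
  rewrite covZ // -s2; have := lt0r_neq0 (s0 n).
  by move: (s n) (c_ W) (sin _) (cos _ ^+ _) => x y z t x0; field.
apply: (ibp_lim GS GU (g := fun w => `|h w|)
   (g' := fun w => `|h' w| + `|a * c_ W| * (`|h w| * `|a * W w|)) H1).
- exact: mom_abs.
- apply: mom_add; first exact: mom_abs.
  apply: mom_scal; apply: mom_mul; first exact: mom_abs.
  by apply: mom_abs; exact: mom_scal.
- by move=> n w; rewrite normrM ler_piMr.
- move=> n w; rewrite /= (le_trans (ler_normB _ _)) // lerD //.
    by rewrite normrM ler_piMr.
  rewrite dE normrM ler_wpM2l // normrM -[leRHS]mulr1; apply: ler_pM => //.
  rewrite normrM ler_wpM2l // normrM gtr0_norm // -ler_pdivlMl //.
  by rewrite (le_trans (sin_abs_le _)) // VE normrM normfV (gtr0_norm (s0 n)) mulrC.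
- move=> w; apply: cvgMr; rewrite -[X in _ --> X]mulr1.
  apply: (cvg_seq_ext (cvgM (ccv w) (ccv1 w))) => // n.
  by rewrite exprSr.
- move=> w /=; apply: cvgB.
    apply: cvgMr; rewrite -[X in _ --> X]mulr1.
    apply: (cvg_seq_ext (cvgM (ccv w) (ccv1 w))) => // n.
    by rewrite exprSr.
  have L : (a * c_ W) * (h w * (s n * sin (V n w)) * cos (V n w) ^+ n) @[n --> \oo] -->
     (a * c_ W) * (h w * (a * W w) * expR (- (a * W w) ^+ 2 / 2)).
    by apply: cvgMr; apply: cvgM; [apply: cvgMr; exact: scv|exact: ccv].
  apply: (cvg_seq_ext L) => [|n]; last by rewrite -dE.
  by ring.
Unshelve. all: by end_near. Qed.

End IbpClosure.

(** * Polynomial approximation of continuous functions *)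

Section Bernstein.
Context {R : realType}.
Implicit Types (phi : nat -> R) (x : R).

(** The mean of [phi] at a binomial variable with [n] trials and success probability ['X]. The
    recursion conditions on one trial, which turns bounds into inductions on [n]. *)
Fixpoint bernstein n phi : {poly R} :=
  if n is n'.+1 then (1 - 'X) * bernstein n' phi + 'X * bernstein n' (phi \o succn)
  else (phi 0%N)%:P.

Lemma bernsteinS n phi x : (bernstein n.+1 phi).[x] =
  (1 - x) * (bernstein n phi).[x] + x * (bernstein n (phi \o succn)).[x].
Proof. by rewrite /= !hornerE. Qed.

Lemma bernstein_le n phi psi x : 0 <= x <= 1 ->
  (forall k, (k <= n)%N -> phi k <= psi k) ->
  (bernstein n phi).[x] <= (bernstein n psi).[x].
Proof.
move=> /andP[x0 x1]; elim: n phi psi => [|n IHn] phi psi le; first by rewrite !hornerE le.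
rewrite !bernsteinS lerD // ler_wpM2l ?subr_ge0 //; apply: IHn => k kn.
  by apply: le; rewrite leqW.
exact: le.
Qed.

(** The second moment about [- a] of a binomial variable, of mean [n x] and variance
    [n x (1 - x)]. *)
Lemma bernstein_quad n x (e K a : R) :
  (bernstein n (fun k => e + K * (k%:R + a) ^+ 2)).[x] =
  e + K * ((n%:R * x + a) ^+ 2 + n%:R * x * (1 - x)).
Proof.
elim: n a => [|n IHn] a; first by rewrite !hornerE; ring.
rewrite bernsteinS IHn.
have -> : (fun k : nat => e + K * (k%:R + a) ^+ 2) \o succn =
    (fun k : nat => e + K * (k%:R + (1 + a)) ^+ 2).
  by apply/funext => k /=; rewrite -natr1 addrA.
by rewrite IHn -natr1; ring.
Qed.

(** Compactness of the segment; only [x] is confined to [[a, b]], the comparison point [y] ranges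
    over the line because [f] is continuous there. *)
Lemma unif_continuous_segment (f : R -> R) (a b e : R) : continuous f -> 0 < e ->
  exists2 del : R, 0 < del & forall x y, a <= x <= b -> `|y - x| < del -> `|f y - f x| <= e.
Proof.
move=> cf e0; have /compact_near_coveringP := @segment_compact R a b.
move=> /(_ R (0 : R)^'+ (fun del x => forall y, `|y - x| < del -> `|f y - f x| <= e)).
move=> /(_ _); case.
  move=> x _ /=.
  have := cf x; move=> /cvgrPdist_lt /(_ (e / 2)); rewrite divr_gt0 // => /(_ isT).
  move=> /nbhs_ballP[r /= r0 hr].
  exists (ball x (r / 2), [set t | t < r / 2]) => /=.
    split; first by apply: nbhsx_ballx; rewrite divr_gt0.
    by apply: nbhs_right_lt; rewrite divr_gt0.
  move=> [x' t] /= [xx' tr] y yx'.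
  have h1 : `|f x - f x'| < e / 2.
    by apply: hr; apply: lt_le_trans xx' _; lra.
  have h2 : `|f x - f y| < e / 2.
    apply: hr; rewrite /ball /=; rewrite /ball /= in xx'.
    rewrite (_ : x - y = (x - x') - (y - x')); last by ring.
    rewrite (le_lt_trans (ler_normB _ _)) // (splitr r) ltrD //.
    exact: lt_trans yx' tr.
  rewrite (_ : f y - f x' = (f x - f x') - (f x - f y)); last by ring.
  by rewrite (le_trans (ler_normB _ _)) // (splitr e) lerD // ltW.
move=> del /= d0 hd.
exists (del / 2); first by rewrite divr_gt0.
move=> x y xab; apply: hd => //=; rewrite ?divr_gt0 //.
by rewrite /ball /= sub0r normrN gtr0_norm ?divr_gt0 //; lra.
Qed.

Lemma weierstrass_approx (f : R -> R) (e : R) : continuous f ->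
  0 < e -> exists p : {poly R}, forall x, 0 <= x <= 1 -> `|f x - p.[x]| <= e.
Proof.
move=> cf e0; have e20 : 0 < e / 2 by rewrite divr_gt0.
have [del d0 hd] := @unif_continuous_segment f 0 1 (e / 2) cf e20.
have [M hM] : exists M : R, forall x, 0 <= x <= 1 -> `|f x| <= M.
  have cnf : {within `[0, 1], continuous (fun x => `|f x|)}.
    by apply: continuous_subspaceT => x; apply: cvg_norm; exact: cf.
  by have [c _ hc] := EVT_max ler01 cnf; exists `|f c| => x x01; apply: hc; rewrite in_itv.
have M0 : 0 <= M by rewrite (le_trans _ (hM 0 _)) // lexx ler01.
have [n n0 hn] : exists2 n : nat, (0 < n)%N & 2 * M / del ^+ 2 / n%:R <= e / 2.
  exists (Num.bound (2 * (2 * M / del ^+ 2) / e)).+1 => //.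
  rewrite ler_pdivrMr ?ltr0n // -ler_pdivrMl // invf_div mulrC.
  rewrite [leLHS](_ : _ = 2 * (2 * M / del ^+ 2) / e); last by field; rewrite !gt_eqF.
  rewrite (le_trans (ltW (archi_boundP _))) ?ler_nat //.
  by rewrite !mulr_ge0 // invr_ge0 ?sqr_ge0 // ltW.
(* [K (y - x)^2 >= 2 M] as soon as [|y - x| >= del], so the parabola [e / 2 + K (y - x)^2] dominates
   [|f y - f x|] in all cases; its binomial mean exceeds [e / 2] by at most [K / n]. *)
pose K : R := 2 * M / del ^+ 2.
pose phi (k : nat) := f (k%:R / n%:R).
exists (bernstein n phi) => x x01; have /andP[x0 x1] := x01.
have nR0 : 0 < n%:R :> R by rewrite ltr0n.
have bnd k : (k <= n)%N -> `|phi k - f x| <= e / 2 + (K / n%:R ^+ 2) * (k%:R + (- (n%:R * x))) ^+ 2.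
  move=> kn; rewrite /phi; set y : R := k%:R / n%:R.
  have y01 : 0 <= y <= 1 by rewrite divr_ge0 //= ler_pdivrMr // mul1r ler_nat.
  have -> : K / n%:R ^+ 2 * (k%:R + - (n%:R * x)) ^+ 2 = K * (y - x) ^+ 2.
    by rewrite /y; field; rewrite gt_eqF.
  have K0 : 0 <= K by rewrite !mulr_ge0 // invr_ge0 sqr_ge0.
  case: (ltP `|y - x| del) => h.
    by rewrite (le_trans (hd _ _ x01 h)) // lerDl mulr_ge0 // sqr_ge0.
  apply: (@le_trans _ _ (2 * M)).
    by rewrite (le_trans (ler_normB _ _)) // mulr2n mulrDl mul1r lerD // hM.
  apply: (@le_trans _ _ (K * (y - x) ^+ 2)); last by rewrite lerDr ltW.
  rewrite /K mulrAC ler_pdivlMr ?exprn_gt0 // ler_wpM2l ?mulr_ge0 //.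
  by rewrite -[leRHS]real_normK ?num_real // lerXn2r ?nnegrE // ltW.
have H1 : (bernstein n phi).[x] <= f x + e / 2 + (K / n%:R ^+ 2) * (n%:R * x * (1 - x)).
  have := @bernstein_quad n x (f x + e / 2) (K / n%:R ^+ 2) (- (n%:R * x)).
  rewrite addrN expr0n /= add0r => <-; apply: bernstein_le => // k kn.
  by have := bnd k kn; rewrite ler_norml => /andP[_]; rewrite lerBlDl addrA.
have H2 : f x - e / 2 - (K / n%:R ^+ 2) * (n%:R * x * (1 - x)) <= (bernstein n phi).[x].
  have := @bernstein_quad n x (f x - e / 2) (- (K / n%:R ^+ 2)) (- (n%:R * x)).
  rewrite addrN expr0n /= add0r mulNr => <-; apply: bernstein_le => // k kn.
  have := bnd k kn; rewrite ler_norml => /andP[+ _]; rewrite mulNr; lra.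
have H3 : (K / n%:R ^+ 2) * (n%:R * x * (1 - x)) <= e / 2.
  apply: le_trans hn; rewrite -/K.
  have -> : K / n%:R ^+ 2 * (n%:R * x * (1 - x)) = K / n%:R * (x * (1 - x)).
    by field; rewrite gt_eqF.
  rewrite ler_piMr //; first by rewrite !mulr_ge0 // ?invr_ge0 ?sqr_ge0 // ltW.
  nra.
rewrite ler_norml; apply/andP; split; lra.
Qed.

End Bernstein.

(** Polynomials will be fitted to a derivative and integrated, which approximates a function and its
    derivative together. *)
Lemma poly_primitive {R : realType} (q : {poly R}) (c : R) :
  exists p : {poly R}, p^`() = q /\ p.[0] = c.
Proof.
exists (\poly_(i < (size q).+1) (if i == 0 then c else q`_i.-1 / i%:R)); split.
  apply/polyP => i; rewrite coef_deriv coef_poly ltnS /=.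
  case: ltnP => h; last by rewrite mul0rn nth_default.
  by rewrite -[LHS]mulr_natr divfK // pnatr_eq0.
by rewrite horner_coef0 coef_poly.
Qed.

(** * Chain rule for functions of a nonnegative variable *)

Section Chain.
Context d (T : measurableType d) (R : realType) (P : probability T R).
Variable G : (T -> R) -> Prop.
Hypothesis GS : gaussian_space P G.
Variable U : T -> R.
Hypothesis GU : G U.
Local Notation c_ V := (Ex P (fun w => U w * V w)).
Local Notation ibp := (ibp P G U).

(** [Q'] plays the derivative of [Q] in the direction of [U]. Quantifying over [h] and [h'] lets two
    rules be applied in succession, which is the rule for a product. *)
Definition chain (Q Q' : T -> R) (g g' : R -> R) := forall h h', ibp h h' ->
  ibp (fun w => h w * g (Q w)) (fun w => h' w * g (Q w) + h w * (Q' w * g' (Q w))).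

Section General.
Variables Q Q' : T -> R.
Hypothesis mQ' : mom P Q'.
Hypothesis Q0 : forall w, 0 <= Q w.

Lemma chain_ext g1 g1' g2 g2' : chain Q Q' g1 g1' -> g1 =1 g2 -> g1' =1 g2' ->
  chain Q Q' g2 g2'.
Proof. by move=> H /funext <- /funext <-. Qed.

Lemma chain_cst c : chain Q Q' (fun=> c) (fun=> 0).
Proof. by move=> h h' H; apply: (ibp_ext (ibp_scal GS GU c H)) => w; ring. Qed.

Lemma chain_lin a g1 g1' g2 g2' : chain Q Q' g1 g1' -> chain Q Q' g2 g2' ->
  chain Q Q' (fun x => g1 x + a * g2 x) (fun x => g1' x + a * g2' x).
Proof.
move=> H1 H2 h h' H; apply: (ibp_ext (ibp_lin GS GU a (H1 _ _ H) (H2 _ _ H))) => w; ring.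
Qed.

Lemma chain_mul g1 g1' g2 g2' : chain Q Q' g1 g1' -> chain Q Q' g2 g2' ->
  chain Q Q' (fun x => g1 x * g2 x) (fun x => g1' x * g2 x + g1 x * g2' x).
Proof.
move=> H1 H2 h h' H; apply: (ibp_ext (H2 _ _ (H1 _ _ H))) => w; ring.
Qed.

(** Limits and bounds are asked on the half-line only, where [Q] takes its values. *)
Lemma chain_lim (g_ g'_ : nat -> R -> R) (g g' : R -> R) (M : R) :
  (forall n, chain Q Q' (g_ n) (g'_ n)) ->
  (forall n x, 0 <= x -> `|g_ n x| <= M) -> (forall n x, 0 <= x -> `|g'_ n x| <= M) ->
  (forall x, 0 <= x -> g_ n x @[n --> \oo] --> g x) ->
  (forall x, 0 <= x -> g'_ n x @[n --> \oo] --> g' x) -> chain Q Q' g g'.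
Proof.
move=> H bg bg' cg cg' h h' hh'; have [mh mh' _] := hh'.
apply: (ibp_lim GS GU (g := fun w => M * `|h w|)
   (g' := fun w => M * `|h' w| + M * (`|h w| * `|Q' w|)) (fun n => H n _ _ hh')).
- by apply: mom_scal; exact: mom_abs.
- by apply: mom_add; apply: mom_scal; [exact: mom_abs|apply: mom_mul; exact: mom_abs].
- by move=> n w; rewrite normrM mulrC ler_wpM2r // bg.
- move=> n w; rewrite (le_trans (ler_normD _ _)) // lerD //.
    by rewrite normrM mulrC ler_wpM2r // bg.
  by rewrite !normrM mulrA mulrC ler_wpM2r ?mulr_ge0 // bg'.
- by move=> w; apply: cvgMr; exact: cg.
- move=> w; apply: cvgD; first by apply: cvgMr; exact: cg.
  by do 2 apply: cvgMr; exact: cg'.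
Qed.

Hypothesis chain_exp : chain Q Q' (fun x => expR (- x)) (fun x => - expR (- x)).

Lemma chain_poly (p : {poly R}) :
  chain Q Q' (fun x => p.[expR (- x)]) (fun x => - (expR (- x) * p^`().[expR (- x)])).
Proof.
elim/poly_ind: p => [|p c IHp].
  by apply: (chain_ext (chain_cst 0)) => x; rewrite ?deriv0 !horner0 ?mulr0 ?oppr0.
apply: (chain_ext (chain_lin 1 (chain_mul IHp chain_exp) (chain_cst c))) => x.
  by rewrite !hornerE.
by rewrite derivD derivM derivX derivC !hornerE; ring.
Qed.

(** On [[0, 1]], which contains [expR (- x)] for [x >= 0], primitives of polynomials close to [F']
    are uniformly close to [F], so the rule for polynomials passes to the limit. *)
Lemma chain_exp_C1 (F F' : R -> R) : (forall x : R, is_derive x 1 F (F' x)) -> continuous F' ->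
  chain Q Q' (fun x => F (expR (- x))) (fun x => - (expR (- x) * F' (expR (- x)))).
Proof.
move=> dF cF'.
have ha (n : nat) : exists p : {poly R}, p.[0] = F 0 /\ forall y : R, 0 <= y <= 1 ->
    `|F' y - p^`().[y]| <= harmonic n.
  have [q hq] := weierstrass_approx cF' (harmonic_gt0 n : 0 < harmonic n :> R).
  by have [p [dp p0]] := poly_primitive q (F 0); exists p; rewrite dp.
have [p_ hp] := choice ha.
have hp' n y : 0 <= y <= 1 -> `|F y - (p_ n).[y]| <= harmonic n.
  move=> /andP[y0 y1]; have [p0 hd] := hp n.
  have dd (x : R) : is_derive x 1 (fun x => F x - (p_ n).[x]) (F' x - (p_ n)^`().[x]).
    by have H1 := dF x; have H2 := is_derive_poly (p_ n) x; apply: is_derive_eq.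
  have cc : continuous (fun x => F x - (p_ n).[x]).
    by move=> x; apply: differentiable_continuous; apply/derivable1_diffP; case: (dd x).
  have [|c cy /=] := MVT_segment y0 (fun x _ => dd x).
    exact: continuous_subspaceT.
  rewrite p0 subrr !subr0 => ->; rewrite normrM.
  have /andP[c0 c1] : 0 <= c <= y by move: cy; rewrite in_itv.
  rewrite -[leRHS]mulr1; apply: ler_pM => //; last by rewrite ger0_norm.
  by apply: hd; rewrite c0 (le_trans c1).
have e01 (x : R) : 0 <= x -> 0 <= expR (- x) <= 1.
  by move=> x0; rewrite expR_ge0 -[leRHS]expR0 ler_expR oppr_le0.
have harm1 n : harmonic n <= 1 :> R by rewrite /harmonic /= invf_le1 ?ltr0n // ler1n.
have bnd (f : R -> R) : continuous f -> exists M : R, forall x, 0 <= x <= 1 -> `|f x| <= M.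
  move=> cf; have cnf : {within `[0, 1], continuous (fun x => `|f x|)}.
    by apply: continuous_subspaceT => x; apply: cvg_norm; exact: cf.
  by have [c _ hc] := EVT_max ler01 cnf; exists `|f c| => x x01; apply: hc; rewrite in_itv.
have cF : continuous F.
  by move=> x; apply: differentiable_continuous; apply/derivable1_diffP; case: (dF x).
have [M1 hM1] := bnd _ cF; have [M2 hM2] := bnd _ cF'.
have M1p : 0 <= M1 by rewrite (le_trans _ (hM1 0 _)) // lexx ler01.
have M2p : 0 <= M2 by rewrite (le_trans _ (hM2 0 _)) // lexx ler01.
have tri (a b c : R) n : `|a - b| <= harmonic n -> `|a| <= c -> `|b| <= 1 + c.
  move=> ab ac; rewrite (_ : b = - (a - b) + a); last by ring.
  rewrite (le_trans (ler_normD _ _)) // normrN lerD //.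
  exact: le_trans ab (harm1 n).
have cvh (f : nat -> R) l : (forall n : nat, `|l - f n| <= harmonic n) -> f n @[n --> \oo] --> l.
  move=> H; have h0 : (fun n => l - f n) n @[n --> \oo] --> (0 : R).
    by apply: (cvg0_le _ cvg_harmonic) => n; rewrite (le_trans (H n)) // ler_norm.
  have h1 : (fun=> l) n @[n --> \oo] --> l by exact: cvg_cst.
  apply: (cvg_seq_ext (cvgB h1 h0)); first by rewrite subr0.
  by move=> n; rewrite -[LHS]/(l - (l - f n)); ring.
apply: (chain_lim (M := 1 + (M1 + M2)) (fun n => chain_poly (p_ n))).
- move=> n x x0; apply: (tri (F (expR (- x))) _ _ n); first by apply: hp'; exact: e01.
  by rewrite (le_trans (hM1 _ (e01 _ x0))) // lerDl.
- move=> n x x0; rewrite normrN normrM ger0_norm ?expR_ge0 //.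
  have /andP[e0 e1] := e01 x x0; rewrite -[leRHS]mul1r; apply: ler_pM => //.
  apply: (tri (F' (expR (- x))) _ _ n); first by apply: (hp n).2; exact: e01.
  by rewrite (le_trans (hM2 _ (e01 _ x0))) // lerDr.
- by move=> x x0; apply: cvh => n; apply: hp'; exact: e01.
- move=> x x0; apply: cvgN; apply: cvgMr; apply: cvh => n.
  by apply: (hp n).2; exact: e01.
Qed.

(* [f] is composed with a smooth truncation of the identity at height about [n],
   which is a smooth function of [expR (- x)]. *)
Lemma chain_C1 (f f' : R -> R) (M : R) : (forall x : R, is_derive x 1 f (f' x)) ->
  continuous f' -> (forall x, `|f x| <= M) -> (forall x, `|f' x| <= M) ->
  chain Q Q' f f'.
Proof.
move=> df cf' bf bf'.
have cf : continuous f.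
  by move=> x; apply: differentiable_continuous; apply/derivable1_diffP; case: (df x).
pose a (n : nat) : R := (harmonic n : R) ^+ 2.
have a0 n : 0 < a n by rewrite exprn_gt0 // harmonic_gt0.
have ya n (y : R) : 0 < y ^+ 2 + a n by rewrite ltr_wpDl ?sqr_ge0.
(* At [y = expR (- x)] this increases to [x] with [n] and stays at most [ln (n + 1)]. The square
   makes [l n] smooth on the whole line, and the derivative in [x] of the composite lies in
   [[0, 1]], so the bound on [f'] is kept. *)
pose l n (y : R) := - 2^-1 * ln (y ^+ 2 + a n).
have dl n (y : R) : is_derive y 1 (l n) (- (y / (y ^+ 2 + a n))).
  have d1 : is_derive y 1 (fun y : R => y ^+ 2 + a n) (2 * y).
    have -> : (fun y : R => y ^+ 2 + a n) = (fun y => y ^+ 2 + cst (a n) y) by [].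
    by apply: is_derive_eq; rewrite -![_ *: _]/(_ * _); ring.
  have d2 := is_derive1_ln (ya n y).
  have -> : l n = (fun z => (- 2^-1) *: ((@ln R \o (fun y : R => y ^+ 2 + a n)) z)) by [].
  apply: is_derive_eq; rewrite -![_ *: _]/(_ * _).
  by field; rewrite gt_eqF.
have df_ n (y : R) : is_derive y 1 (f \o l n) (- (y / (y ^+ 2 + a n)) * f' (l n y)).
  have H1 := dl n y; have H2 := df (l n y).
  by rewrite mulrC; exact: is_derive1_comp.
have cl n : continuous (l n).
  by move=> x; apply: differentiable_continuous; apply/derivable1_diffP; case: (dl n x).
have cd n : continuous (fun y : R => - (y / (y ^+ 2 + a n)) * f' (l n y)).
  move=> y; apply: cvgM.
    apply: cvgN; apply: cvgM; first exact: cvg_id.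
    apply: cvgV; first by rewrite gt_eqF.
    by apply: cvgD; [exact: exprn_continuous|exact: cvg_cst].
  by apply: continuous_comp; [exact: cl|exact: cf'].
have acv : a n @[n --> \oo] --> (0 : R).
  rewrite -[X in _ --> X](mulr0 (0 : R)) /a; under eq_fun do rewrite expr2.
  by apply: cvgM; exact: cvg_harmonic.
have e2 (x : R) : 0 < expR (- x) ^+ 2 by rewrite exprn_gt0 // expR_gt0.
have dcv (x : R) : expR (- x) ^+ 2 + a n @[n --> \oo] --> expR (- x) ^+ 2.
  by rewrite -[X in _ --> X]addr0; apply: cvgD; [exact: cvg_cst|exact: acv].
have lcv (x : R) : l n (expR (- x)) @[n --> \oo] --> x.
  have xE : x = - 2^-1 * ln (expR (- x) ^+ 2).
    by rewrite lnXn ?expR_gt0 // expRK -mulr_natr; field.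
  rewrite [X in _ --> X]xE.
  by apply: cvgMr; apply: continuous_cvg; [exact: continuous_ln|exact: dcv].
apply: (chain_lim (M := M) (fun n => chain_exp_C1 (df_ n) (cd n))).
- by move=> n x _; exact: bf.
- move=> n x _; rewrite mulNr mulrN opprK.
  have -> : expR (- x) * (expR (- x) / (expR (- x) ^+ 2 + a n) * f' (l n (expR (- x)))) =
     expR (- x) ^+ 2 / (expR (- x) ^+ 2 + a n) * f' (l n (expR (- x))) by ring.
  rewrite normrM (le_trans _ (bf' (l n (expR (- x))))) // ler_piMl //.
  rewrite ger0_norm; last by apply: divr_ge0; [exact: sqr_ge0|exact: ltW (ya n _)].
  by rewrite ler_pdivrMr ?ya // mul1r lerDl; exact: ltW (a0 n).
- by move=> x _; apply: continuous_cvg; [exact: cf|exact: lcv].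
- move=> x _.
  have L : expR (- x) ^+ 2 * (expR (- x) ^+ 2 + a n)^-1 * f' (l n (expR (- x))) @[n --> \oo] -->
     expR (- x) ^+ 2 * (expR (- x) ^+ 2)^-1 * f' x.
    apply: cvgM; last by apply: continuous_cvg; [exact: cf'|exact: lcv].
    by apply: cvgMr; apply: cvgV; [rewrite gt_eqF|exact: dcv].
  apply: (cvg_seq_ext L) => [|n]; first by rewrite divff ?mul1r // gt_eqF.
  by ring.
Qed.

End General.
End Chain.

(** * Stein's method for sums of squares *)

Section QuadraticForms.
Context d (T : measurableType d) (R : realType) (P : probability T R).
Variable G : (T -> R) -> Prop.
Hypothesis GS : gaussian_space P G.
Variable X : nat -> T -> R.
Hypothesis GX : forall t, G (X t).

Definition gram (s t : nat) : R := Ex P (fun w => X s w * X t w).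

Definition sumsq (k : nat) (w : T) : R := \sum_(t < k) X t w ^+ 2.

(** Up to normalization, the forms [A_k] and [B_kl]. The derivative of [sumsq l] in the direction
    [X u] is [2 * \sum_t gram u t * X t]; multiplied by [X u] and summed over [u] it gives twice
    this form. *)
Definition gramform (k l : nat) (w : T) : R :=
  \sum_(u < k) \sum_(t < l) gram u t * (X u w * X t w).

Lemma gramC s t : gram s t = gram t s.
Proof. by congr Ex; apply/funext => w; rewrite mulrC. Qed.

Lemma mom_X t : mom P (X t). Proof. exact: (GS_mom GS). Qed.

Lemma mom_sumsq k : mom P (sumsq k).
Proof. by apply: mom_sum => t; apply: mom_exp; exact: mom_X. Qed.

Lemma mom_gramform k l : mom P (gramform k l).
Proof.
apply: mom_sum => u; apply: mom_sum => t; apply: mom_scal.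
by apply: mom_mul; exact: mom_X.
Qed.

Lemma sumsq_ge0 k w : 0 <= sumsq k w.
Proof. by apply: sumr_ge0 => t _; exact: sqr_ge0. Qed.

Let dsumsq (v : nat) (k : nat) (w : T) : R := \sum_(t < k) 2 * gram v t * X t w.

Let mom_dsumsq v k : mom P (dsumsq v k).
Proof. by apply: mom_sum => t; apply: mom_scal; exact: mom_X. Qed.

Local Ltac solve_mom :=
  by repeat (first [assumption|exact: mom_X|exact: mom_dsumsq|exact: mom_cst|apply: mom_add|apply: mom_mul]).

(** Induction on the number of squares: [expR (- X_k^2)] is a Gaussian factor with [a = sqrt 2], and
    its rule is applied after the previous one. *)
Let chain_exp_sumsq v k :
  chain P G (X v) (sumsq k) (dsumsq v k) (fun x => expR (- x)) (fun x => - expR (- x)).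
Proof.
elim: k => [|k IHk] h h' H.
  by apply: (ibp_ext H) => w; rewrite /sumsq /dsumsq !big_ord0 oppr0 expR0; ring.
apply: (ibp_ext (ibp_gauss GS (GX v) (Num.sqrt 2) (GX k) (IHk _ _ H))) => w.
  rewrite exprMn sqr_sqrtr // /sumsq big_ord_recr /= -mulrA -expRD.
  by congr (_ * expR _); field.
rewrite exprMn sqr_sqrtr // /sumsq /dsumsq !big_ord_recr /=.
have -> : expR (- (\sum_(i < k) X i w ^+ 2 + X k w ^+ 2)) =
  expR (- (\sum_(i < k) X i w ^+ 2)) * expR (- (2 * X k w ^+ 2) / 2).
  by rewrite -expRD; congr expR; field.
rewrite /gram; move: (expR _) (expR (- (2 * _) / 2)) (Ex P _) => e1 e2 c; ring.
Qed.

Lemma chain_sumsq v k (m s M : R) (f f' : R -> R) : (forall x : R, is_derive x 1 f (f' x)) ->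
  continuous f' -> (forall x, `|f x| <= M) -> (forall x, `|f' x| <= M) ->
  chain P G (X v) (sumsq k) (dsumsq v k) (fun x => f ((x - m) / s)) (fun x => f' ((x - m) / s) / s).
Proof.
move=> df cf' bf bf'.
have M0 : 0 <= M by rewrite (le_trans _ (bf 0)).
apply: (@chain_C1 _ T R P G GS (X v) (GX v) _ _ (mom_dsumsq v k) (sumsq_ge0 k)
  (@chain_exp_sumsq v k) _ _ (M * (1 + `|s^-1|))).
- move=> x; have d1 : is_derive x 1 (fun x : R => (x - m) / s) s^-1.
    have -> : (fun x : R => (x - m) / s) = (fun x : R => s^-1 *: (x - cst m x)).
      by apply/funext => y; rewrite mulrC.
    by apply: is_derive_eq; rewrite -![_ *: _]/(_ * _); ring.
  exact: (is_derive1_comp (df _) d1).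
- move=> x; apply: cvgM; last exact: cvg_cst.
  apply: continuous_comp; last exact: cf'.
  by apply: cvgM; [apply: cvgB; [exact: cvg_id|exact: cvg_cst]|exact: cvg_cst].
- by move=> x; rewrite (le_trans (bf _)) // ler_peMr // lerDl.
- move=> x; rewrite normrM; apply: ler_pM => //; by rewrite lerDr.
Qed.

(** Integration by parts in the direction [X a], the other three factors being differentiated one at
    a time. *)
Lemma wick4 a b c e : Ex P (fun w => X a w * (X b w * X c w * X e w)) =
  gram a b * gram c e + gram a c * gram b e + gram a e * gram b c.
Proof.
have H := ibp_mul GS (GX a) (GX e) (ibp_mul GS (GX a) (GX c) (ibp_mul GS (GX a) (GX b) (ibp_one GS (GX a)))).
have := ibpE GS (GX a) H.
have -> : (fun w => X a w * (1 * X b w * X c w * X e w)) =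
  (fun w => X a w * (X b w * X c w * X e w)) by apply/funext => w; rewrite mul1r.
move=> ->; rewrite -![Ex P (fun w => X a w * X _ w)]/(gram a _).
have mm s t : mom P (fun w => X s w * X t w) by apply: mom_mul; exact: mom_X.
have -> : (fun w => ((0 * X b w + gram a b * 1) * X c w + gram a c * (1 * X b w)) * X e w +
     gram a e * (1 * X b w * X c w)) =
  (fun w => gram a b * (X c w * X e w) + gram a c * (X b w * X e w) + gram a e * (X b w * X c w)).
  by apply/funext => w; ring.
have mz s t z : mom P (fun w => z * (X s w * X t w)) by exact: mom_scal.
rewrite ExD //; last by apply: mom_add.
by rewrite ExD // !ExZ.
Qed.

Lemma Ex_gramform k l : Ex P (gramform k l) = \sum_(u < k) \sum_(t < l) gram u t ^+ 2.
Proof.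
rewrite /gramform Ex_sum => [|u]; last first.
  by apply: mom_sum => t; apply: mom_scal; apply: mom_mul; exact: mom_X.
apply: eq_bigr => u _; rewrite Ex_sum => [|t]; last first.
  by apply: mom_scal; apply: mom_mul; exact: mom_X.
apply: eq_bigr => t _; rewrite ExZ ?expr2 //.
by apply: mom_mul; exact: mom_X.
Qed.

Lemma Ex_gramform_sq k l : Ex P (fun w => gramform k l w ^+ 2) =
  \sum_(u < k) \sum_(t < l) \sum_(u' < k) \sum_(t' < l)
    gram u t * gram u' t' * (gram u t * gram u' t' + gram u u' * gram t t' + gram u t' * gram t u').
Proof.
have mm s t : mom P (fun w => X s w * X t w) by apply: mom_mul; exact: mom_X.
have m4 (a b c e : nat) z : mom P (fun w => z * (X a w * (X b w * X c w * X e w))).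
  apply: mom_scal; solve_mom.
have -> : (fun w => gramform k l w ^+ 2) = (fun w => \sum_(u < k) \sum_(t < l)
   \sum_(u' < k) \sum_(t' < l) (gram u t * gram u' t') * (X u w * (X t w * X u' w * X t' w))).
  apply/funext => w; rewrite expr2 {1}/gramform mulr_suml; apply: eq_bigr => u _.
  rewrite mulr_suml; apply: eq_bigr => t _; rewrite mulr_sumr; apply: eq_bigr => u' _.
  by rewrite mulr_sumr; apply: eq_bigr => t' _; ring.
rewrite Ex_sum => [|u]; last by do 3 (apply: mom_sum => ?).
apply: eq_bigr => u _; rewrite Ex_sum => [|t]; last by do 2 (apply: mom_sum => ?).
apply: eq_bigr => t _; rewrite Ex_sum => [|u']; last by apply: mom_sum => ?.
apply: eq_bigr => u' _; rewrite Ex_sum => [|t'] //.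
apply: eq_bigr => t' _; rewrite ExZ ?wick4 //.
solve_mom.
Qed.

(** Each square [X_u^2] is split as [X_u] times the rest and integrated by parts in the direction
    [X_u]: the derivative of the remaining [X_u] gives [gram u u], those of [f] and [psi] give the
    two quadratic forms after summing over [u]. *)
Lemma stein_identity k l (sk sl mk ml M : R) (f f' psi psi' : R -> R) :
  (forall x : R, is_derive x 1 f (f' x)) -> continuous f' ->
  (forall x, `|f x| <= M) -> (forall x, `|f' x| <= M) ->
  (forall x : R, is_derive x 1 psi (psi' x)) -> continuous psi' ->
  (forall x, `|psi x| <= M) -> (forall x, `|psi' x| <= M) ->
  let F w := (sumsq k w - mk) / sk in let H w := (sumsq l w - ml) / sl in
  Ex P (fun w => (sumsq k w - \sum_(t < k) gram t t) * (f (F w) * psi (H w))) =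
  2 / sk * Ex P (fun w => gramform k k w * (f' (F w) * psi (H w))) +
  2 / sl * Ex P (fun w => gramform k l w * (f (F w) * psi' (H w))).
Proof.
move=> df cf' bf bf' dp cp' bp bp' F H.
have mbnd (g g' : R -> R) j (m s : R) : (forall x : R, is_derive x 1 g (g' x)) ->
    (forall x, `|g x| <= M) -> mom P (fun w => g ((sumsq j w - m) / s)).
  move=> dg bg; apply: (@mom_bnd _ _ _ P _ M) => //.
  apply: (@measurableT_comp _ _ _ _ _ _ g).
    apply: continuous_measurable_fun => x; apply: differentiable_continuous.
    by apply/derivable1_diffP; case: (dg x).
  apply: measurable_funM => //; apply: measurable_funB => //.
  exact: mom_meas (mom_sumsq j).
have mbnd' (g : R -> R) j (m s : R) : continuous g ->
    (forall x, `|g x| <= M) -> mom P (fun w => g ((sumsq j w - m) / s)).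
  move=> cg bg; apply: (@mom_bnd _ _ _ P _ M) => //.
  apply: (@measurableT_comp _ _ _ _ _ _ g); first exact: continuous_measurable_fun.
  apply: measurable_funM => //; apply: measurable_funB => //.
  exact: mom_meas (mom_sumsq j).
have mf : mom P (fun w => f (F w)) by exact: (mbnd f f').
have mp : mom P (fun w => psi (H w)) by exact: (mbnd psi psi').
have mf' : mom P (fun w => f' (F w)) by exact: mbnd'.
have mp' : mom P (fun w => psi' (H w)) by exact: mbnd'.
have key u : Ex P (fun w => X u w ^+ 2 * (f (F w) * psi (H w))) =
    gram u u * Ex P (fun w => f (F w) * psi (H w)) +
    (sk^-1 * Ex P (fun w => dsumsq u k w * X u w * (f' (F w) * psi (H w))) +
     sl^-1 * Ex P (fun w => dsumsq u l w * X u w * (f (F w) * psi' (H w)))).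
  have I1 := @chain_sumsq u k mk sk M f f' df cf' bf bf' _ _ (ibp_one GS (GX u)).
  have I2 := @chain_sumsq u l ml sl M psi psi' dp cp' bp bp' _ _ I1.
  have := ibpE GS (GX u) (ibp_mul GS (GX u) (GX u) I2).
  rewrite -/(gram u u).
  have -> : (fun w => X u w * (1 * f ((sumsq k w - mk) / sk) * psi ((sumsq l w - ml) / sl) * X u w)) =
    (fun w => X u w ^+ 2 * (f (F w) * psi (H w))) by apply/funext => w; rewrite /F /H; ring.
  move=> ->.
  rewrite -!ExZ.
  rewrite -!ExD.
  by congr Ex; apply/funext => w; rewrite /F /H; ring.
  1-7: solve_mom.
have E1 : Ex P (fun w => sumsq k w * (f (F w) * psi (H w))) =
    \sum_(u < k) Ex P (fun w => X u w ^+ 2 * (f (F w) * psi (H w))).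
  rewrite -Ex_sum => [|u]; last first.
    by apply: mom_mul; [apply: mom_exp; exact: mom_X|exact: mom_mul].
  by congr Ex; apply/funext => w; rewrite /sumsq mulr_suml.
have E2 (j : nat) (g : T -> R) : mom P g -> \sum_(u < k) Ex P (fun w => dsumsq u j w * X u w * g w) =
    2 * Ex P (fun w => gramform k j w * g w).
  move=> mg; rewrite -Ex_sum => [|u]; last solve_mom.
  rewrite -ExZ; last by apply: mom_mul => //; exact: mom_gramform.
  congr Ex; apply/funext => w; rewrite /gramform mulr_suml mulr_sumr.
  apply: eq_bigr => u _; rewrite /dsumsq !mulr_suml mulr_sumr; apply: eq_bigr => t _; ring.
have mfp := mom_mul mf mp.
have -> : (fun w => (sumsq k w - \sum_(t < k) gram t t) * (f (F w) * psi (H w))) =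
  (fun w => sumsq k w * (f (F w) * psi (H w)) - (\sum_(t < k) gram t t) * (f (F w) * psi (H w))).
  by apply/funext => w; rewrite mulrBl.
rewrite ExB; [|by apply: mom_mul => //; exact: mom_sumsq|exact: mom_scal].
rewrite ExZ // E1 (eq_bigr _ (fun (u : 'I_k) _ => key u)) big_split /= -mulr_suml big_split /=.
rewrite -!mulr_sumr !E2; [ring|exact: mom_mul|exact: mom_mul].
Qed.

End QuadraticForms.

(** * Second moments of the quadratic forms *)

Section QuadrupleSums.
Context {R : realType}.
Variables k l : nat.
Implicit Types F H : nat -> nat -> nat -> nat -> R.

Definition sum4 F : R :=
  \sum_(u < k) \sum_(t < l) \sum_(u' < k) \sum_(t' < l) F u t u' t'.

Lemma sum4_le F H : (forall u t u' t', (u < k)%N -> (t < l)%N -> (u' < k)%N -> (t' < l)%N ->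
  F u t u' t' <= H u t u' t') -> sum4 F <= sum4 H.
Proof. by move=> FH; do 4 (apply: ler_sum => ? _); apply: FH. Qed.

Lemma sum4D F H : sum4 (fun u t u' t' => F u t u' t' + H u t u' t') = sum4 F + sum4 H.
Proof.
rewrite /sum4 -big_split; apply: eq_bigr => u _; rewrite -big_split; apply: eq_bigr => t _.
by rewrite -big_split; apply: eq_bigr => u' _; rewrite -big_split.
Qed.

Lemma sum4Z c F : sum4 (fun u t u' t' => c * F u t u' t') = c * sum4 F.
Proof.
rewrite /sum4 mulr_sumr; apply: eq_bigr => u _; rewrite mulr_sumr; apply: eq_bigr => t _.
by rewrite mulr_sumr; apply: eq_bigr => u' _; rewrite mulr_sumr.
Qed.

Lemma sum4_ut (f g : nat -> nat -> R) : sum4 (fun u t u' t' => f u t * g u' t') =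
  (\sum_(u < k) \sum_(t < l) f u t) * (\sum_(u < k) \sum_(t < l) g u t).
Proof.
rewrite /sum4 mulr_suml; apply: eq_bigr => u _; rewrite mulr_suml; apply: eq_bigr => t _.
by rewrite mulr_sumr; apply: eq_bigr => u' _; rewrite mulr_sumr.
Qed.

Lemma sum4_uu (f g : nat -> nat -> R) : sum4 (fun u t u' t' => f u u' * g t t') =
  (\sum_(u < k) \sum_(u' < k) f u u') * (\sum_(t < l) \sum_(t' < l) g t t').
Proof.
rewrite /sum4 mulr_suml; apply: eq_bigr => u _; rewrite exchange_big /= mulr_suml.
apply: eq_bigr => u' _; rewrite mulr_sumr; apply: eq_bigr => t _; by rewrite mulr_sumr.
Qed.

Lemma sum4_utx (f g : nat -> nat -> R) : sum4 (fun u t u' t' => f u t' * g u' t) =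
  (\sum_(u < k) \sum_(t < l) f u t) * (\sum_(u < k) \sum_(t < l) g u t).
Proof.
rewrite -sum4_ut /sum4; apply: eq_bigr => u _; rewrite exchange_big /=.
rewrite [RHS]exchange_big /=; apply: eq_bigr => u' _; rewrite exchange_big /=.
by [].
Qed.

Lemma sum4_swap F : sum4 F = sum4 (fun u t u' t' => F u' t' u t).
Proof.
transitivity (\sum_(u < k) \sum_(u' < k) \sum_(t < l) \sum_(t' < l) F u t u' t').
  by apply: eq_bigr => u _; rewrite exchange_big.
rewrite exchange_big /=; apply: eq_bigr => u' _.
rewrite exchange_big /= (eq_bigr (fun t : 'I_l => \sum_(t' < l) \sum_(u < k) F u t u' t')).
  by rewrite exchange_big /=; apply: eq_bigr => t' _; rewrite exchange_big.
by move=> t _; rewrite exchange_big.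
Qed.

End QuadrupleSums.

Section Estimates.
Context d (T : measurableType d) (R : realType) (P : probability T R).
Variable G : (T -> R) -> Prop.
Hypothesis GS : gaussian_space P G.
Variable X : nat -> T -> R.
Hypothesis GX : forall t, G (X t).
Local Notation gram := (gram P X).
Hypothesis gram0 : forall s t, 0 <= gram s t.
Hypothesis gram1 : forall t, 1 <= gram t t.
Variable row : nat -> R.
Hypothesis rowP : forall k s, (s < k)%N -> \sum_(t < k) gram s t <= row k.
Variable C : R.
Hypothesis C1 : 1 <= C.
Hypothesis gram2 : forall s l, \sum_(t < l) gram s t ^+ 2 <= C.

(** Squared Hilbert-Schmidt norm of a corner of the covariance matrix; by Wick's formula, twice its
    value at [l = k] is the variance of [sumsq X k]. *)
Definition gram_norm2 (k l : nat) : R := \sum_(u < k) \sum_(t < l) gram u t ^+ 2.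

Definition sumsq_sd (k : nat) : R := Num.sqrt (2 * gram_norm2 k k).

Definition std_sumsq (k : nat) (w : T) : R :=
  (sumsq X k w - \sum_(t < k) gram t t) / sumsq_sd k.

Lemma gram_norm2_ge0 k l : 0 <= gram_norm2 k l.
Proof. by do 2 (apply: sumr_ge0 => ? _); exact: sqr_ge0. Qed.

Lemma gram_norm2_ub k l : gram_norm2 k l <= C * k%:R.
Proof.
rewrite mulr_natr -[X in _ *+ X](card_ord k) -sumr_const.
apply: ler_sum => u _; exact: gram2.
Qed.

Lemma gram_norm2_lb k : k%:R <= gram_norm2 k k.
Proof.
rewrite -[X in X%:R]card_ord -sumr_const; apply: ler_sum => u _.
rewrite (bigD1 u) //= -[leLHS]addr0 lerD //.
  by rewrite -[leLHS](expr1n _ 2) lerXn2r ?nnegrE // ?(le_trans _ (gram1 u)).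
by apply: sumr_ge0 => t _; exact: sqr_ge0.
Qed.

Lemma sumsq_sd2 k : sumsq_sd k ^+ 2 = 2 * gram_norm2 k k.
Proof. by rewrite sqr_sqrtr // mulr_ge0 // gram_norm2_ge0. Qed.

Lemma sumsq_sd_gt0 k : (0 < k)%N -> 0 < sumsq_sd k.
Proof.
move=> k0; rewrite sqrtr_gt0 mulr_gt0 // (lt_le_trans _ (gram_norm2_lb k)) //.
by rewrite ltr0n.
Qed.

Lemma row_ge0 k : (0 < k)%N -> 0 <= row k.
Proof. by move=> k0; rewrite (le_trans _ (rowP k0)) //; apply: sumr_ge0. Qed.

(** Of the three Wick pairings, the one within each factor gives the squared mean. The two mixed
    ones are sums of products of four entries along a cycle: [x y <= (x^2 + y^2) / 2] leaves one
    entry, squared, and for its indices fixed the remaining two sum to a product of two row sums. *)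
Lemma Ex_gramform_diag_ub k : (0 < k)%N ->
  Ex P (fun w => gramform P X k k w ^+ 2) <=
  gram_norm2 k k ^+ 2 + 2 * (row k ^+ 2 * gram_norm2 k k).
Proof.
move=> k0; rewrite (Ex_gramform_sq GS GX).
have r0 := row_ge0 k0.
pose N := gram_norm2 k k.
have rows (g : nat -> nat -> nat -> nat -> R) :
    (forall u t, (u < k)%N -> (t < k)%N ->
       \sum_(u' < k) \sum_(t' < k) g u t u' t' <= row k ^+ 2) ->
    sum4 k k (fun u t u' t' => gram u t ^+ 2 * g u t u' t') <= row k ^+ 2 * N.
  move=> hg; rewrite mulr_sumr; apply: ler_sum => u _; rewrite mulr_sumr; apply: ler_sum => t _.
  rewrite [leRHS]mulrC; apply: le_trans (ler_wpM2l (sqr_ge0 _) (hg _ _ (ltn_ord u) (ltn_ord t))).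
  rewrite mulr_sumr; apply: ler_sum => u' _; by rewrite mulr_sumr.
have prod (f g : nat -> R) : 0 <= \sum_(i < k) f i -> 0 <= \sum_(i < k) g i ->
    \sum_(i < k) f i <= row k -> \sum_(i < k) g i <= row k ->
    \sum_(i < k) \sum_(j < k) f i * g j <= row k ^+ 2.
  move=> f0 g0 fr gr; rewrite expr2; apply: le_trans (ler_pM f0 g0 fr gr).
  rewrite mulr_suml; apply: ler_sum => i _; by rewrite mulr_sumr.
have S1 : sum4 k k (fun u t u' t' => gram u t ^+ 2 * (gram u u' * gram t t')) <= row k ^+ 2 * N.
  by apply: rows => u t uk tk; apply: prod; rewrite ?rowP ?sumr_ge0.
have S2 : sum4 k k (fun u t u' t' => gram u t ^+ 2 * (gram u t' * gram t u')) <= row k ^+ 2 * N.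
  apply: rows => u t uk tk; rewrite exchange_big /=.
  by apply: (prod (fun i => gram u i) (fun i => gram t i)); rewrite ?rowP ?sumr_ge0.
have amgm (x y z : R) : 0 <= z -> x * y * z <= 2^-1 * (x ^+ 2 * z) + 2^-1 * (y ^+ 2 * z).
  by move=> z0; have := sqr_ge0 (x - y); nra.
have S1' : sum4 k k (fun u t u' t' => gram u' t' ^+ 2 * (gram u u' * gram t t')) <= row k ^+ 2 * N.
  rewrite sum4_swap; apply: le_trans S1; apply: sum4_le => u t u' t' _ _ _ _.
  by rewrite (gramC _ _ u') (gramC _ _ t').
have S2' : sum4 k k (fun u t u' t' => gram u' t' ^+ 2 * (gram u t' * gram t u')) <= row k ^+ 2 * N.
  rewrite sum4_swap; apply: le_trans S2; apply: sum4_le => u t u' t' _ _ _ _.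
  by rewrite (gramC _ _ u') (gramC _ _ t') mulrC [X in _ <= _ * X]mulrC mulrC.
have -> : \sum_(u < k) \sum_(t < k) \sum_(u' < k) \sum_(t' < k) gram u t * gram u' t' *
    (gram u t * gram u' t' + gram u u' * gram t t' + gram u t' * gram t u') =
  sum4 k k (fun u t u' t' => gram u t ^+ 2 * gram u' t' ^+ 2 +
    (gram u t * gram u' t' * (gram u u' * gram t t') + gram u t * gram u' t' * (gram u t' * gram t u'))).
  by do 4 (apply: eq_bigr => ? _); ring.
rewrite sum4D (sum4_ut k k (fun u t => gram u t ^+ 2) (fun u t => gram u t ^+ 2)) -expr2 lerD2l.
rewrite sum4D mulr2n mulrDl !mul1r; apply: lerD.
- apply: (@le_trans _ _ (sum4 k k (fun u t u' t' => 2^-1 * (gram u t ^+ 2 * (gram u u' * gram t t')) +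
     2^-1 * (gram u' t' ^+ 2 * (gram u u' * gram t t'))))).
    by apply: sum4_le => *; apply: amgm; rewrite mulr_ge0.
  by rewrite sum4D !sum4Z; move: S1 S1'; rewrite /N; lra.
- apply: (@le_trans _ _ (sum4 k k (fun u t u' t' => 2^-1 * (gram u t ^+ 2 * (gram u t' * gram t u')) +
     2^-1 * (gram u' t' ^+ 2 * (gram u t' * gram t u'))))).
    by apply: sum4_le => *; apply: amgm; rewrite mulr_ge0.
  by rewrite sum4D !sum4Z; move: S2 S2'; rewrite /N; lra.
Qed.

(** The pairing [gram u u' * gram t t'] is separated from [gram u t * gram u' t'] by a weighted
    inequality of means. The weight [tau] is left free to balance [gram_norm2 k l ^+ 2], at most of
    order [k^2], against [gram_norm2 k k * gram_norm2 l l], of order [k l]. *)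
Lemma Ex_gramform_cross_ub k l (tau : R) : 0 < tau ->
  Ex P (fun w => gramform P X k l w ^+ 2) <=
  2 * gram_norm2 k l ^+ 2 +
  2^-1 * (tau * gram_norm2 k l ^+ 2 + tau^-1 * (gram_norm2 k k * gram_norm2 l l)).
Proof.
move=> tau0; rewrite (Ex_gramform_sq GS GX).
have amgm (x y : R) : x * y <= 2^-1 * (tau * x ^+ 2 + tau^-1 * y ^+ 2).
  have : 0 <= tau^-1 * (tau * x - y) ^+ 2 by rewrite mulr_ge0 ?sqr_ge0 // invr_ge0 ltW.
  rewrite (_ : tau^-1 * _ = tau * x ^+ 2 + tau^-1 * y ^+ 2 - 2 * (x * y)); last first.
    by field; rewrite gt_eqF.
  lra.
have amgm1 (x y : R) : x * y <= 2^-1 * (x ^+ 2 + y ^+ 2).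
  by have := sqr_ge0 (x - y); nra.
pose N := gram_norm2 k l.
have SA : sum4 k l (fun u t u' t' => gram u t ^+ 2 * gram u' t' ^+ 2) = N ^+ 2.
  by rewrite (sum4_ut k l (fun u t => gram u t ^+ 2) (fun u t => gram u t ^+ 2)) -expr2.
have SB : sum4 k l (fun u t u' t' => gram u u' ^+ 2 * gram t t' ^+ 2) =
    gram_norm2 k k * gram_norm2 l l.
  by rewrite (sum4_uu k l (fun u t => gram u t ^+ 2) (fun u t => gram u t ^+ 2)).
have SC : sum4 k l (fun u t u' t' => gram u t' ^+ 2 * gram u' t ^+ 2) = N ^+ 2.
  by rewrite (sum4_utx k l (fun u t => gram u t ^+ 2) (fun u t => gram u t ^+ 2)) -expr2.
apply: (@le_trans _ _ (sum4 k l (fun u t u' t' => gram u t ^+ 2 * gram u' t' ^+ 2 +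
   (2^-1 * (tau * (gram u t ^+ 2 * gram u' t' ^+ 2) + tau^-1 * (gram u u' ^+ 2 * gram t t' ^+ 2)) +
    2^-1 * (gram u t ^+ 2 * gram u' t' ^+ 2 + gram u t' ^+ 2 * gram u' t ^+ 2))))).
  apply: ler_sum => u _; apply: ler_sum => t _; apply: ler_sum => u' _; apply: ler_sum => t' _.
  rewrite [leLHS]mulrDr [X in X + _ <= _]mulrDr -addrA -!exprMn; apply: lerD.
    by rewrite -expr2.
  apply: lerD; first exact: amgm.
  by rewrite (gramC _ _ t u'); exact: amgm1.
rewrite sum4D sum4D !sum4Z !sum4D !sum4Z SA SB SC -/N; lra.
Qed.

Variables (f f' psi psi' : R -> R) (M : R).
Hypothesis df : forall x : R, is_derive x 1 f (f' x).
Hypothesis cf' : continuous f'.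
Hypothesis bf : forall x, `|f x| <= M.
Hypothesis bf' : forall x, `|f' x| <= M.
Hypothesis dp : forall x : R, is_derive x 1 psi (psi' x).
Hypothesis cp' : continuous psi'.
Hypothesis bp : forall x, `|psi x| <= M.
Hypothesis bp' : forall x, `|psi' x| <= M.

(** After normalization the quantity is [E ((1 - A) f' psi) - E (B f psi')] with [A] of mean 1.
    Cauchy-Schwarz reduces the bound to the standard deviation of [A], at most [2 row k / sqrt k],
    and to the second moment of [B], at most [3 C^2 sqrt (k / l)]. *)
Lemma stein_bound k l : (0 < k)%N -> (k <= l)%N ->
  `|Ex P (fun w => (f' (std_sumsq k w) - std_sumsq k w * f (std_sumsq k w)) * psi (std_sumsq l w))|
  <= M ^+ 2 * (2 * row k / Num.sqrt k%:R + 2 * C * Num.sqrt (Num.sqrt (k%:R / l%:R))).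
Proof.
move=> k0 kl; have l0 : (0 < l)%N by exact: leq_trans kl.
have M0 : 0 <= M by rewrite (le_trans _ (bf 0)).
have sk0 := sumsq_sd_gt0 k0; have sl0 := sumsq_sd_gt0 l0.
have sk2 := sumsq_sd2 k; have sl2 := sumsq_sd2 l.
have Nk := gram_norm2_lb k; have Nl := gram_norm2_lb l.
have kR : 0 < k%:R :> R by rewrite ltr0n.
have lR : 0 < l%:R :> R by rewrite ltr0n.
have klR : k%:R <= l%:R :> R by rewrite ler_nat.
set F := std_sumsq k; set H := std_sumsq l.
have mF j : mom P (std_sumsq j).
  have -> : std_sumsq j = (fun w => (sumsq_sd j)^-1 * (sumsq X j w - \sum_(t < j) gram t t)).
    by apply/funext => w; rewrite /std_sumsq mulrC.
  by apply: mom_scal; apply: mom_sub; [exact: (mom_sumsq GS GX)|exact: mom_cst].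
have mcomp (g : R -> R) j : continuous g -> (forall x, `|g x| <= M) -> mom P (fun w => g (std_sumsq j w)).
  move=> cg bg; apply: (@mom_bnd _ _ _ P _ M) => //.
  by apply: (measurableT_comp (continuous_measurable_fun cg)); exact: mom_meas (mF j).
have cf : continuous f.
  by move=> x; apply: differentiable_continuous; apply/derivable1_diffP; case: (df x).
have cp : continuous psi.
  by move=> x; apply: differentiable_continuous; apply/derivable1_diffP; case: (dp x).
have mf := mcomp f k cf bf; have mf' := mcomp f' k cf' bf'.
have mp := mcomp psi l cp bp; have mp' := mcomp psi' l cp' bp'.
have mB i j := mom_gramform GS GX i j.
pose A w := 2 / sumsq_sd k ^+ 2 * gramform P X k k w.
pose B w := 2 / (sumsq_sd k * sumsq_sd l) * gramform P X k l w.
have mA : mom P A by exact: mom_scal.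
have mBB : mom P B by exact: mom_scal.
have E : Ex P (fun w => (f' (F w) - F w * f (F w)) * psi (H w)) =
    Ex P (fun w => (1 - A w) * (f' (F w) * psi (H w))) - Ex P (fun w => B w * (f (F w) * psi' (H w))).
  have := stein_identity GS GX k l (sumsq_sd k) (sumsq_sd l) (\sum_(t < k) gram t t)
     (\sum_(t < l) gram t t) df cf' bf bf' dp cp' bp bp'.
  rewrite /= -/F -/H => SI.
  have m1 := mom_mul mf mp; have m2 := mom_mul mf' mp; have m3 := mom_mul mf mp'.
  have e1 : Ex P (fun w => F w * (f (F w) * psi (H w))) = (sumsq_sd k)^-1 *
     Ex P (fun w => (sumsq X k w - \sum_(t < k) gram t t) * (f (F w) * psi (H w))).
    rewrite -ExZ; first by congr Ex; apply/funext => w; rewrite /F /std_sumsq; ring.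
    by apply: mom_mul => //; apply: mom_sub; [exact: (mom_sumsq GS GX)|exact: mom_cst].
  have -> : (fun w => (f' (F w) - F w * f (F w)) * psi (H w)) =
    (fun w => f' (F w) * psi (H w) - F w * (f (F w) * psi (H w))).
    by apply/funext => w; ring.
  rewrite ExB //; last by apply: mom_mul => //; exact: mF.
  rewrite e1 SI.
  have -> : (fun w => (1 - A w) * (f' (F w) * psi (H w))) =
    (fun w => f' (F w) * psi (H w) - 2 / sumsq_sd k ^+ 2 * (gramform P X k k w * (f' (F w) * psi (H w)))).
    by apply/funext => w; rewrite /A; ring.
  have -> : (fun w => B w * (f (F w) * psi' (H w))) =
    (fun w => 2 / (sumsq_sd k * sumsq_sd l) * (gramform P X k l w * (f (F w) * psi' (H w)))).
    by apply/funext => w; rewrite /B; ring.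
  rewrite ExB //; last by apply: mom_scal; exact: mom_mul.
  rewrite !ExZ; [|exact: mom_mul|exact: mom_mul].
  by field; rewrite !gt_eqF.
have EA : Ex P A = 1.
  rewrite ExZ // (Ex_gramform GS GX) -/(gram_norm2 k k) sk2; field.
  by rewrite gt_eqF // (lt_le_trans _ Nk).
have CSb (g : T -> R) (c : R) : mom P g -> 0 <= c -> Ex P (fun w => g w ^+ 2) <= c ^+ 2 -> Ex P (fun w => `|g w|) <= c.
  move=> mg c0 h; have := le_trans (Ex_CS mg) h.
  by rewrite ler_sqr ?nnegrE //; apply: Ex_ge0.
have bound (g h1 h2 : T -> R) : mom P g -> mom P h1 -> mom P h2 ->
    (forall w, `|h1 w| <= M) -> (forall w, `|h2 w| <= M) ->
    `|Ex P (fun w => g w * (h1 w * h2 w))| <= M ^+ 2 * Ex P (fun w => `|g w|).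
  move=> mg m1 m2 b1 b2; have mg1 : mom P (fun w => g w * (h1 w * h2 w)) by do 2 apply: mom_mul => //.
  rewrite (le_trans (Ex_abs mg1)) // -ExZ; last exact: mom_abs.
  apply: Ex_le; [exact: mom_abs|by apply: mom_scal; exact: mom_abs|move=> w].
  by rewrite normrM mulrC ler_wpM2r // normrM expr2; apply: ler_pM.
rewrite E mulrDr (le_trans (ler_normB _ _)) // lerD //.
- apply: (le_trans (bound _ _ _ _ mf' mp _ _)) => //; first by apply: mom_sub => //; exact: mom_cst.
  rewrite ler_wpM2l ?sqr_ge0 //; apply: CSb.
  + by apply: mom_sub => //; exact: mom_cst.
  + by rewrite !mulr_ge0 ?invr_ge0 ?sqrtr_ge0 // row_ge0.
  have -> : (fun w => (1 - A w) ^+ 2) = (fun w => 1 - 2 * A w + A w ^+ 2).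
    by apply/funext => w; ring.
  have mA2 := mom_exp 2 mA.
  rewrite ExD //; last by apply: mom_sub; [exact: mom_cst|exact: mom_scal].
  rewrite ExB; [|exact: mom_cst|exact: mom_scal]; rewrite Ex_cst ExZ // EA.
  have -> : (fun w => A w ^+ 2) = (fun w => (2 / sumsq_sd k ^+ 2) ^+ 2 * gramform P X k k w ^+ 2).
    by apply/funext => w; rewrite /A exprMn.
  rewrite ExZ; last exact: mom_exp.
  have hE := Ex_gramform_diag_ub k0.
  have -> : (2 * row k / Num.sqrt k%:R) ^+ 2 = 4 * (row k ^+ 2 / k%:R).
    rewrite -[in RHS](sqr_sqrtr (ltW kR)); field.
    by rewrite gt_eqF // sqrtr_gt0.
  rewrite sk2.
  set N := gram_norm2 k k in hE Nk *.
  have N0 : 0 < N by rewrite (lt_le_trans _ Nk).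
  have -> : (2 / (2 * N)) ^+ 2 = N ^- 2 by field; rewrite gt_eqF.
  have h2 : N ^- 2 * Ex P (fun w => gramform P X k k w ^+ 2) <= 1 + 2 * (row k ^+ 2 / N).
    apply: (le_trans (ler_wpM2l _ hE)); first by rewrite invr_ge0 sqr_ge0.
    by rewrite le_eqVlt; apply/orP; left; apply/eqP; field; rewrite gt_eqF.
  have h3 : row k ^+ 2 / N <= row k ^+ 2 / k%:R.
    by rewrite ler_wpM2l ?sqr_ge0 // lef_pV2 ?posrE.
  have h4 : 0 <= row k ^+ 2 / k%:R by rewrite mulr_ge0 ?sqr_ge0 // invr_ge0 ltW.
  by lra.
- apply: (le_trans (bound _ _ _ mBB mf mp' _ _)) => //.
  rewrite ler_wpM2l ?sqr_ge0 //; apply: CSb => //.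
    by rewrite !mulr_ge0 ?sqrtr_ge0 // (le_trans _ C1).
  have -> : (fun w => B w ^+ 2) = (fun w => (2 / (sumsq_sd k * sumsq_sd l)) ^+ 2 * gramform P X k l w ^+ 2).
    by apply/funext => w; rewrite /B exprMn.
  rewrite ExZ; last exact: mom_exp.
  pose r : R := Num.sqrt (k%:R / l%:R).
  have r0 : 0 < r by rewrite sqrtr_gt0 divr_gt0.
  have r2 : r ^+ 2 = k%:R / l%:R by rewrite sqr_sqrtr // divr_ge0 // ltW.
  (* The weight [tau = 1 / r = sqrt (l / k)] balances [tau k^2] against [k l / tau]: both equal
     [r^3 l^2]. *)
  have hE := @Ex_gramform_cross_ub k l r^-1; rewrite invr_gt0 r0 invrK in hE.
  have {}hE := hE isT.
  rewrite [leRHS]exprMn sqr_sqrtr ?sqrtr_ge0 // -/r.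
  have N1 := gram_norm2_ub k l; have N2 := gram_norm2_ub k k; have N3 := gram_norm2_ub l l.
  have N10 := gram_norm2_ge0 k l; have N20 := gram_norm2_ge0 k k; have N30 := gram_norm2_ge0 l l.
  have C0 : 0 <= C by rewrite (le_trans _ C1).
  have r1 : r <= 1 by rewrite -(sqrtr1 R) ler_sqrt // ler_pdivrMr // mul1r.
  have kE : k%:R = r ^+ 2 * l%:R by rewrite r2 divfK // gt_eqF.
  have step1 : Ex P (fun w => gramform P X k l w ^+ 2) <= 3 * C ^+ 2 * r ^+ 3 * l%:R ^+ 2.
    apply: (le_trans hE).
    have h1 : gram_norm2 k l ^+ 2 <= C ^+ 2 * r ^+ 4 * l%:R ^+ 2.
      have -> : C ^+ 2 * r ^+ 4 * l%:R ^+ 2 = (C * k%:R) ^+ 2 by rewrite kE; ring.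
      by rewrite lerXn2r ?nnegrE // mulr_ge0 // ltW.
    have h2 : gram_norm2 k k * gram_norm2 l l <= C ^+ 2 * r ^+ 2 * l%:R ^+ 2.
      have -> : C ^+ 2 * r ^+ 2 * l%:R ^+ 2 = (C * k%:R) * (C * l%:R) by rewrite kE; ring.
      exact: ler_pM.
    have h3 : r^-1 * gram_norm2 k l ^+ 2 <= C ^+ 2 * r ^+ 3 * l%:R ^+ 2.
      rewrite ler_pdivrMl // (le_trans h1) // le_eqVlt; apply/orP; left; apply/eqP; ring.
    have h4 : r * (gram_norm2 k k * gram_norm2 l l) <= C ^+ 2 * r ^+ 3 * l%:R ^+ 2.
      rewrite (le_trans (ler_wpM2l (ltW r0) h2)) // le_eqVlt; apply/orP; left; apply/eqP; ring.
    have h5 : C ^+ 2 * r ^+ 4 * l%:R ^+ 2 <= C ^+ 2 * r ^+ 3 * l%:R ^+ 2.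
      rewrite ler_wpM2r ?sqr_ge0 // ler_wpM2l ?sqr_ge0 // exprSr ler_piMr // exprn_ge0 // ltW //.
    by lra.
  have step2 : (2 / (sumsq_sd k * sumsq_sd l)) ^+ 2 <= r ^- 2 * l%:R ^- 2.
    have -> : (2 / (sumsq_sd k * sumsq_sd l)) ^+ 2 = (gram_norm2 k k * gram_norm2 l l)^-1.
      rewrite exprMn exprVn exprMn sk2 sl2; field.
      by rewrite !gt_eqF // (lt_le_trans _ Nk, lt_le_trans _ Nl).
    rewrite -invfM lef_pV2 ?posrE ?mulr_gt0 ?exprn_gt0 //.
    + have -> : r ^+ 2 * l%:R ^+ 2 = k%:R * l%:R by rewrite kE; ring.
      by apply: ler_pM; rewrite // ltW.
    + exact: lt_le_trans Nk.
    + exact: lt_le_trans Nl.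
  apply: (@le_trans _ _ ((r ^- 2 * l%:R ^- 2) * (3 * C ^+ 2 * r ^+ 3 * l%:R ^+ 2))).
    apply: ler_pM => //; first exact: sqr_ge0.
    by apply: Ex_ge0 => w; exact: sqr_ge0.
  have -> : (r ^- 2 * l%:R ^- 2) * (3 * C ^+ 2 * r ^+ 3 * l%:R ^+ 2) = 3 * C ^+ 2 * r.
    by field; rewrite !gt_eqF.
  have : 0 <= C ^+ 2 * r by rewrite mulr_ge0 ?sqr_ge0 // ltW.
  by rewrite exprMn; lra.
Qed.

End Estimates.

(** * Logarithmic averages *)

Section HarmonicSums.
Context {R : realType}.

Definition harm (n : nat) : R := \sum_(1 <= k < n.+1) k%:R^-1.

(** From [1 - x <= expR (- x)] at [x = 1 / (k + 1)], where [1 - x = k / (k + 1)]. *)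
Lemma inv_le_lnB (k : nat) : (0 < k)%N -> k.+1%:R^-1 <= ln k.+1%:R - ln k%:R :> R.
Proof.
move=> k0; have kR : 0 < k%:R :> R by rewrite ltr0n.
have k1R : 0 < k.+1%:R :> R by rewrite ltr0n.
have h : k%:R = (1 + - k.+1%:R^-1) * k.+1%:R :> R.
  by rewrite mulrDl mul1r mulNr mulVf ?gt_eqF // -natr1 addrK.
have : ln k%:R <= ln (expR (- k.+1%:R^-1) * k.+1%:R) :> R.
  rewrite ler_ln ?posrE ?mulr_gt0 ?expR_gt0 // [leLHS]h ler_pM2r //.
  exact: expR_ge1Dx.
rewrite lnM ?posrE ?expR_gt0 // expRK.
move: (ln k%:R) (ln k.+1%:R) (k.+1%:R^-1) => x y z; lra.
Qed.

Lemma harm_le n : (0 < n)%N -> harm n <= 1 + ln n%:R.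
Proof.
case: n => // n _; elim: n => [|n IHn].
  by rewrite /harm big_nat1 invr1 ln1 addr0.
rewrite /harm big_nat_recr //= -/(harm n.+1).
have := inv_le_lnB (ltn0Sn n).
move: (ln n.+1%:R) (ln n.+2%:R) (n.+2%:R^-1) IHn => x y z; lra.
Qed.

Lemma harmB_le (m n : nat) : (0 < m)%N -> (m <= n)%N ->
  \sum_(m.+1 <= k < n.+1) k%:R^-1 <= ln n%:R - ln m%:R :> R.
Proof.
move=> m0; elim: n => [|n IHn]; first by rewrite leqn0 => /eqP m00; rewrite m00 in m0.
rewrite leq_eqVlt => /predU1P[->|]; first by rewrite big_geq // subrr.
rewrite ltnS => mn; rewrite big_nat_recr //=.
have := IHn mn; have := inv_le_lnB (leq_trans m0 mn).
move: (ln n.+1%:R) (ln n%:R) (n.+1%:R^-1) => x y z; lra.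
Qed.

(** The points [N j = 2 ^ (j ^ 2)] are sparse enough for variances of order [1 / ln (N j)] to be
    summable, and dense enough that [ln (N j.+1) / ln (N j)] tends to 1: the terms added after [N j]
    and before [N j.+1] contribute at most [M (2 j + 1) / j ^ 2]. *)
Lemma log_average_interp (b : nat -> R) (M : R) : (forall k, `|b k| <= M) ->
  log_average b (2 ^ (j.+1 ^ 2))%N @[j --> \oo] --> (0 : R) ->
  log_average b n @[n --> \oo] --> (0 : R).
Proof.
move=> bM cv; have M0 : 0 <= M by rewrite (le_trans _ (bM 0%N)).
pose N (j : nat) := (2 ^ (j ^ 2))%N.
have N0 j : (0 < N j)%N by rewrite expn_gt0.
have lnN j : ln (N j)%:R = (j ^ 2)%:R * ln 2 :> R.
  by rewrite /N natrX lnXn // mulr_natl.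
have ln2 : 0 < ln 2 :> R by rewrite ln_gt0 // ltr1n.
apply/cvgrPdist_le => e e0.
have e20 : 0 < e / 2 by rewrite divr_gt0.
move/cvgrPdist_le : cv => /(_ _ e20) [J _ hJ].
have [J' hJ'] : exists J' : nat, forall j, (J' < j)%N -> M * (2 * j + 1)%:R / (j ^ 2)%:R <= e / 2.
  exists (Num.bound (M * 3 / (e / 2))) => j hj; have j0 : (0 < j)%N by exact: leq_ltn_trans hj.
  have jR : 0 < j%:R :> R by rewrite ltr0n.
  rewrite natrX; apply: (@le_trans _ _ (M * 3 / j%:R)).
    rewrite ler_pdivrMr ?exprn_gt0 //.
    have -> : M * 3 / j%:R * j%:R ^+ 2 = M * (3 * j)%:R.
      by rewrite natrM; field; rewrite gt_eqF.
    rewrite ler_wpM2l // ler_nat; lia.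
  have hb : M * 3 / (e / 2) <= j%:R.
    apply: ltW; apply: lt_le_trans (archi_boundP _) _; last by rewrite ler_nat ltnW.
    by rewrite !mulr_ge0 // invr_ge0 ltW.
  by rewrite ler_pdivrMr // -ler_pdivrMl // mulrC.
pose j0 := (maxn J J').+1.
exists (N j0) => // n /= hn.
have [j [j0j Njn nNj]] : exists j, [/\ (j0 <= j)%N, (N j <= n)%N & (n < N j.+1)%N].
  have ex : exists j, (N j <= n)%N by exists j0.
  have bd j : (N j <= n)%N -> (j <= n)%N.
    apply: leq_trans; apply: (@leq_trans (j ^ 2)%N); last exact/ltnW/ltn_expl.
    by case: j => // j; rewrite expnS expn1 leq_pmulr.
  case: (ex_maxnP ex bd) => j Hj mj; exists j; split=> //; first exact: mj.
  by rewrite ltnNge; apply/negP => /mj; rewrite ltnn.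
have jp : (0 < j)%N by exact: leq_trans j0j.
have n0 : (0 < n)%N by exact: leq_trans Njn.
have lnj : 0 < ln (N j)%:R :> R by rewrite lnN mulr_gt0 // ltr0n expn_gt0 jp.
have lnn : ln (N j)%:R <= ln n%:R :> R by rewrite ler_ln ?posrE ?ltr0n // ler_nat.
have lnn0 : 0 < ln n%:R :> R by exact: lt_le_trans lnn.
rewrite sub0r normrN /log_average (big_cat_nat (n := (N j).+1)) //=.
rewrite mulrDr (le_trans (ler_normD _ _)) // (splitr e) lerD //.
- have := hJ j.-1; rewrite /= sub0r normrN prednK // -/(N j) => /(_ _).
  have -> : (J <= j.-1)%N by rewrite -ltnS prednK // (leq_trans _ j0j) // ltnS leq_maxl.
  move=> /(_ isT); apply: le_trans; rewrite /log_average !normrM ler_wpM2r //.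
  rewrite !ger0_norm ?invr_ge0 ?(ltW lnj) ?(ltW lnn0) //.
  by rewrite lef_pV2 ?posrE.
- rewrite normrM ger0_norm ?invr_ge0 ?(ltW lnn0) //.
  apply: (@le_trans _ _ ((ln (N j)%:R)^-1 * (M * (ln (N j.+1)%:R - ln (N j)%:R)))).
    apply: ler_pM; rewrite ?invr_ge0 ?(ltW lnn0) //; first by rewrite lef_pV2 ?posrE.
    apply: (@le_trans _ _ (M * \sum_((N j).+1 <= k < n.+1) k%:R^-1)).
      rewrite mulr_sumr (le_trans (ler_norm_sum _ _ _)) //; apply: ler_sum => k _.
      by rewrite normrM ger0_norm ?invr_ge0 // mulrC ler_wpM2r ?invr_ge0.
    rewrite ler_wpM2l // (le_trans (harmB_le (N0 j) Njn)) // lerB //.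
    by rewrite ler_ln ?posrE ?ltr0n // ler_nat ltnW.
  rewrite !lnN -mulrBl.
  have -> : (j.+1 ^ 2)%:R - (j ^ 2)%:R = (2 * j + 1)%:R :> R.
    by rewrite -natrB ?leq_exp2r //; congr (_%:R); lia.
  have jj : (j ^ 2)%:R != 0 :> R by rewrite pnatr_eq0 -lt0n expn_gt0 jp.
  rewrite [leLHS](_ : _ = M * (2 * j + 1)%:R / (j ^ 2)%:R); last first.
    have l20 : ln 2 != 0 :> R by rewrite gt_eqF.
    move: (ln 2) l20 ((j ^ 2)%:R : R) jj ((2 * j + 1)%:R : R) => x x0 y y0 z.
    by field; rewrite x0 y0.
  by apply: hJ'; apply: leq_trans j0j; rewrite ltnS leq_maxr.
Qed.

Lemma sum_inv_sqr n : \sum_(j < n) (j.+1 ^ 2)%:R^-1 <= 2 :> R.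
Proof.
case: n => [|n]; first by rewrite big_ord0.
suff : \sum_(j < n.+1) (j.+1 ^ 2)%:R^-1 <= 2 - n.+1%:R^-1 :> R.
  by move=> /le_trans; apply; rewrite lerBlDr lerDl invr_ge0.
elim: n => [|n IHn]; first by rewrite big_ord1 exp1n invr1; lra.
rewrite big_ord_recr /=; apply: (le_trans (lerD IHn (lexx _))).
have a0 : 0 < n.+1%:R :> R by rewrite ltr0n.
have a1 : n.+2%:R = n.+1%:R + 1 :> R by rewrite natr1.
rewrite natrX a1; move: (n.+1%:R : R) a0 => x x0.
have x1 : 0 < x + 1 by rewrite ltr_wpDl // ltW.
have h : (x + 1) ^- 2 <= x^-1 - (x + 1)^-1.
  have -> : x^-1 - (x + 1)^-1 = (x * (x + 1))^-1 by field; rewrite !gt_eqF.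
  by rewrite lef_pV2 ?posrE ?exprn_gt0 ?mulr_gt0 // expr2 ler_pM2r // lerDl.
lra.
Qed.

End HarmonicSums.

Section LogAverageSLLN.
Context d (T : measurableType d) (R : realType) (P : probability T R).

(** By monotone convergence the sum of the [Y j ^ 2] is integrable, hence finite almost everywhere,
    and its terms tend to 0. *)
Lemma ae_cvg0_of_summable (Y : nat -> T -> R) (B : R) : (forall j, mom P (Y j)) ->
  (forall n, \sum_(j < n) Ex P (fun w => Y j w ^+ 2) <= B) ->
  {ae P, forall w, Y j w @[j --> \oo] --> (0 : R)}.
Proof.
move=> mY hB.
have mY2 j : mom P (fun w => Y j w ^+ 2) by exact: mom_exp.
pose f j w : \bar R := (Y j w ^+ 2)%:E.
have mf j : measurable_fun [set: T] (f j).
  by apply/measurable_EFinP; exact: mom_meas (mY2 j).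
have f0 j w : [set: T] w -> (0 <= f j w)%E by rewrite lee_fin sqr_ge0.
have intE j : (\int[P]_w f j w)%E = (Ex P (fun w => Y j w ^+ 2))%:E.
  by rewrite /Ex /Rintegral fineK //; apply: integrable_fin_num => //; exact: mom_integrable.
have I : P.-integrable [set: T] (fun w => (\sum_(0 <= j <oo) f j w)%E).
  apply/integrableP; split.
    by apply: ge0_emeasurable_sum => // j w ? ?; exact: f0.
  rewrite (eq_integral (fun w => (\sum_(0 <= j <oo) f j w)%E)); last first.
    by move=> w _; rewrite gee0_abs // nneseries_ge0 // => j _ _; exact: f0.
  rewrite integral_nneseries //.
  apply: (@le_lt_trans _ _ B%:E); last exact: ltry.
  apply: lime_le; first by apply: is_cvg_ereal_nneg_natsum => j _; apply: integral_ge0 => w _; exact: f0.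
  apply: nearW => n; rewrite big_mkord (eq_bigr (fun j : 'I_n => (Ex P (fun w => Y j w ^+ 2))%:E)).
    by rewrite sumEFin lee_fin; exact: hB.
  by move=> j _; rewrite intE.
have := integrable_ae measurableT I; apply: filterS => w /(_ Logic.I) fin.
have cvs : cvgn (series (fun j => Y j w ^+ 2)).
  apply: nondecreasing_is_cvgn.
    by apply: nondecreasing_series => j _ _; exact: sqr_ge0.
  exists (fine (\sum_(0 <= j <oo) f j w)%E) => _ [n _ <-].
  rewrite -lee_fin fineK // /series /= -sumEFin.
  by apply: nneseries_lim_ge => j _ _; exact: f0.
have c2 := cvg_series_cvg_0 cvs.
have : Num.sqrt (Y j w ^+ 2) @[j --> \oo] --> Num.sqrt (0 : R).
  by apply: continuous_cvg; [exact: sqrt_continuous|exact: c2].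
rewrite sqrtr0 => c3; apply: (cvg0_le _ c3) => j.
by rewrite sqrtr_sqr normr_id.
Qed.

(** With [W n] the weighted partial sum, the next term raises [E (W n ^ 2)] by at most
    [2 D / (n + 1)], whence [E (W n ^ 2) <= 2 D harm n]. Divided by the square of [ln n] this is of
    order [1 / ln n], summable along the sparse subsequence. *)
Lemma log_average_slln (a : nat -> T -> R) (M D : R) : (forall k, mom P (a k)) ->
  (forall k w, `|a k w| <= M) ->
  (forall l, (0 < l)%N ->
     \sum_(1 <= k < l.+1) k%:R^-1 * `|Ex P (fun w => a k w * a l w)| <= D) ->
  {ae P, forall w, log_average (fun k => a k w) n @[n --> \oo] --> (0 : R)}.
Proof.
move=> ma bM hD.
pose W n w := \sum_(1 <= k < n.+1) k%:R^-1 * a k w.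
have mW n : mom P (W n) by apply: mom_sum => k; apply: mom_scal.
have D0 : 0 <= D.
  apply: le_trans (hD 1%N isT); apply: sumr_ge0 => k _.
  by rewrite mulr_ge0 // invr_ge0.
have EW n : Ex P (fun w => W n w ^+ 2) <= 2 * D * harm n.
  elim: n => [|n IHn].
    rewrite /harm big_geq // mulr0; under eq_fun do rewrite /W big_geq // expr0n /=.
    by rewrite Ex_cst.
  have -> : (fun w => W n.+1 w ^+ 2) = (fun w => W n w ^+ 2 +
     n.+1%:R^-1 * (2 * (W n w * a n.+1 w) + n.+1%:R^-1 * (a n.+1 w * a n.+1 w))).
    by apply/funext => w; rewrite /W big_nat_recr //=; ring.
  have m1 := mom_mul (mW n) (ma n.+1); have m2 := mom_mul (ma n.+1) (ma n.+1).
  rewrite ExD; [|exact: mom_exp|by apply: mom_scal; apply: mom_add; exact: mom_scal].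
  rewrite ExZ; last by apply: mom_add; exact: mom_scal.
  rewrite ExD; [|exact: mom_scal|exact: mom_scal].
  rewrite !ExZ // /harm big_nat_recr //= -/(harm n) [leRHS]mulrDr lerD //.
  rewrite [leRHS]mulrC ler_wpM2l ?invr_ge0 //.
  have EWa : Ex P (fun w => W n w * a n.+1 w) =
      \sum_(1 <= k < n.+1) k%:R^-1 * Ex P (fun w => a k w * a n.+1 w).
    have -> : (fun w => W n w * a n.+1 w) =
      (fun w => \sum_(1 <= k < n.+1) k%:R^-1 * (a k w * a n.+1 w)).
      by apply/funext => w; rewrite /W mulr_suml; apply: eq_bigr => k _; rewrite mulrA.
    rewrite Ex_sum => [|k]; last by apply: mom_scal; exact: mom_mul.
    by apply: eq_bigr => k _; rewrite ExZ //; exact: mom_mul.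
  (* The bound [D] includes the diagonal term [k = l], which pays for the square of the new term. *)
  have h := hD n.+1 isT; rewrite big_nat_recr //= in h.
  have h1 : Ex P (fun w => W n w * a n.+1 w) <=
     \sum_(1 <= k < n.+1) k%:R^-1 * `|Ex P (fun w => a k w * a n.+1 w)|.
    by rewrite EWa; apply: ler_sum => k _; rewrite ler_wpM2l ?invr_ge0 // ler_norm.
  have h2 : n.+1%:R^-1 * Ex P (fun w => a n.+1 w * a n.+1 w) <=
     n.+1%:R^-1 * `|Ex P (fun w => a n.+1 w * a n.+1 w)|.
    by rewrite ler_wpM2l ?invr_ge0 // ler_norm.
  have h3 : 0 <= n.+1%:R^-1 * `|Ex P (fun w => a n.+1 w * a n.+1 w)|.
    by rewrite mulr_ge0 // invr_ge0.
  by move: h h1 h2 h3; move: (bigop.body _ _ _) (Ex _ _) (n.+1%:R^-1 * Ex _ _) (n.+1%:R^-1 * `|_|) => x y z t; lra.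
pose Y j w := log_average (fun k => a k w) (2 ^ (j.+1 ^ 2))%N.
have mY j : mom P (Y j) by apply: mom_scal; exact: mW.
have ln2 : 0 < ln 2 :> R by rewrite ln_gt0 // ltr1n.
pose B : R := 2 * D * ((ln 2) ^- 2 + (ln 2)^-1).
have EY j : Ex P (fun w => Y j w ^+ 2) <= B * (j.+1 ^ 2)%:R^-1.
  have lnN : ln (2 ^ (j.+1 ^ 2))%:R = (j.+1 ^ 2)%:R * ln 2 :> R.
    by rewrite natrX lnXn // mulr_natl.
  have -> : (fun w => Y j w ^+ 2) = (fun w => ((j.+1 ^ 2)%:R * ln 2) ^- 2 * W (2 ^ (j.+1 ^ 2))%N w ^+ 2).
    by apply/funext => w; rewrite /Y /log_average lnN exprMn exprVn.
  rewrite ExZ; last exact: mom_exp.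
  have q1 : 1 <= (j.+1 ^ 2)%:R :> R by rewrite ler1n expn_gt0.
  have hh : harm (2 ^ (j.+1 ^ 2)) <= 1 + (j.+1 ^ 2)%:R * ln 2 :> R.
    by rewrite -lnN; apply: harm_le; rewrite expn_gt0.
  have {}EW := EW (2 ^ (j.+1 ^ 2))%N.
  set q : R := (j.+1 ^ 2)%:R in q1 hh *.
  have q0 : 0 < q by exact: lt_le_trans q1.
  apply: (@le_trans _ _ ((q * ln 2) ^- 2 * (2 * D * (1 + q * ln 2)))).
    rewrite ler_wpM2l ?invr_ge0 ?sqr_ge0 // (le_trans EW) // ler_wpM2l // mulr_ge0 //.
  have -> : (q * ln 2) ^- 2 * (2 * D * (1 + q * ln 2)) =
    2 * D * (q^-1 * ln 2 ^- 2 + (ln 2)^-1) * q^-1 by field; rewrite !gt_eqF.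
  rewrite /B ler_wpM2r ?invr_ge0 ?(ltW q0) // ler_wpM2l ?mulr_ge0 // lerD2r.
  by rewrite ler_piMl ?invr_ge0 ?sqr_ge0 // invf_le1.
have B0 : 0 <= B by rewrite !mulr_ge0 // addr_ge0 // invr_ge0 ?sqr_ge0 // ltW.
have aeY : {ae P, forall w, Y j w @[j --> \oo] --> (0 : R)}.
  apply: (ae_cvg0_of_summable mY (B := B * 2)) => n.
  apply: (@le_trans _ _ (\sum_(j < n) B * (j.+1 ^ 2)%:R^-1)); first exact: ler_sum.
  by rewrite -mulr_sumr ler_wpM2l // sum_inv_sqr.
apply: filterS aeY => w hw.
by apply: (log_average_interp (M := M)) => [k|]; [exact: bM|exact: hw].
Qed.

End LogAverageSLLN.

(** * Stein's equation and almost sure equidistribution *)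

Section SteinSolution.
Context {R : realType}.
Local Notation N := (normal_prob (0 : R) 1 : probability (measurableTypeR R) R).
Local Notation p := (normal_pdf (0 : R) 1).
Local Notation mu := (@lebesgue_measure R).
Variables (psi : R -> R) (M : R).
Hypothesis psic : continuous psi.
Hypothesis psiM : forall x, `|psi x| <= M.

(** The integral of [psi] times the density over []-oo, x]], written as an expectation so that
    dominated convergence gives its limits. *)
Let u (x : R) : R := Ex N (psi \* \1_(`]-oo, x]%classic)).

Let mpsi : measurable_fun [set: R] psi.
Proof. exact: continuous_measurable_fun. Qed.

Let mcut x : measurable_fun [set: R] (psi \* \1_(`]-oo, x]%classic) : R -> R).
Proof. by apply: measurable_funM => //; exact: measurable_indic. Qed.

Let cutM x y : `|(psi \* \1_(`]-oo, x]%classic)) y| <= M.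
Proof.
rewrite /= normrM; apply: le_trans (psiM y); rewrite ler_piMr // indicE.
by case: (_ \in _); rewrite ?normr1 ?normr0.
Qed.

(** The fundamental theorem of calculus on a half-line. With [psi = 1] it also yields the continuity
    of the normal distribution function. *)
Lemma is_derive_normal_cut (x : R) : is_derive x 1 u (psi x * p x).
Proof.
have hu z : u z = \int[mu]_(t in [set` Interval -oo%O (BRight z)]) (psi t * p t).
  rewrite /u (Ex_normalE (@mom_bnd _ _ R N _ M (mcut z) (cutM z))).
  rewrite /Rintegral [in RHS]integral_mkcond; congr fine; apply: eq_integral => y _.
  rewrite /= patchE /= indicE; case: (_ \in _); by rewrite ?mulr1 ?mulr0 ?mul0r.
have ip : mu.-integrable [set: R] (EFin \o (fun t => psi t * p t)).
  by apply: integrable_normal_prob_pdf; exact: (@mom_bnd _ _ R N _ M).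
have ip1 : mu.-integrable [set` Interval -oo%O (BRight (x + 1))] (EFin \o (fun t => psi t * p t)).
  by apply: integrableS ip.
have cp : {for x, continuous (fun t => psi t * p t)}.
  by apply: cvgM; [exact: psic | exact: continuous_normal_pdf].
have x1 : x < x + 1 by rewrite ltrDl.
have [du1 du2] := continuous_FTC1 x1 ip1 (ltNyr _) cp.
have -> : u = (fun x0 => \int[mu]_(t in [set` Interval -oo%O (BRight x0)]) (psi t * p t)).
  by apply/funext.
by apply: DeriveDef; [exact: du1|rewrite -derive1E du2].
Qed.

Lemma normal_cut_cvgNy : u (- n%:R) @[n --> \oo] --> 0.
Proof.
have := @Ex_dct _ _ _ N (fun n => psi \* \1_(`]-oo, - n%:R]%classic)) (fun=> 0) (fun=> M).
rewrite Ex_cst; apply=> //.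
- by move=> n; exact: mcut.
- exact: mom_cst.
move=> w; apply: cvg_near_cst.
near=> n; rewrite /= indicE memNset ?mulr0 //= in_itv /= => h.
have : - w < n%:R by near: n; exact: nbhs_infty_gtr.
by rewrite ltNge lerNr h.
Unshelve. all: by end_near. Qed.

Lemma normal_cut_cvgy : u n%:R @[n --> \oo] --> Ex N psi.
Proof.
have := @Ex_dct _ _ _ N (fun n => psi \* \1_(`]-oo, n%:R]%classic)) psi (fun=> M).
apply=> //.
- by move=> n; exact: mcut.
- exact: mom_cst.
move=> w; apply: cvg_near_cst.
near=> n; rewrite /= indicE mem_set ?mulr1 //= in_itv /=.
by near: n; exact: nbhs_infty_ger.
Unshelve. all: by end_near. Qed.

Hypothesis psi0 : Ex N psi = 0.
Let du := is_derive_normal_cut.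
Let uNy := normal_cut_cvgNy.
Let uy : u n%:R @[n --> \oo] --> 0.
Proof. by rewrite -psi0; exact: normal_cut_cvgy. Qed.

Let pgt0 x : 0 < p x.
Proof. by rewrite normal_pdfE //= mulr_gt0 ?normal_peak_gt0 ?expR_gt0. Qed.

Let M0 : 0 <= M.
Proof. exact: le_trans (normr_ge0 _) (psiM 0). Qed.

Let dp (x : R) : is_derive x 1 p (- x * p x).
Proof.
apply: is_derive_eq (is_derive_normal_pdf 0 ltr01 x) _.
by rewrite subr0 expr1n divr1.
Qed.

(* [M p / x] is a supersolution: it dominates [u] together with its derivative. *)
Let dbar (c x : R) : x != 0 ->
  is_derive x 1 (fun y => M * (p y / y) + c * u y)
    (- (M * (1 + (x ^+ 2)^-1) - c * psi x) * p x).
Proof.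
move=> x0; have x0' : id x != 0 by [].
have H := is_deriveD (is_deriveZ M (is_deriveM (dp x) (is_deriveV x0' (is_derive_id x 1))))
  (is_deriveZ c (du x)).
apply: (is_derive_eq H); rewrite -![_ *: _]/(_ * _).
by field.
Qed.

Let pdivy (x : nat -> R) : (forall n, (0 < n)%N -> 1 <= `|x n|) -> p (x n) @[n --> \oo] --> 0 ->
  M * (p (x n) / x n) @[n --> \oo] --> 0.
Proof.
move=> x1 px; rewrite -[X in _ --> X](mulr0 M); apply: cvgMr.
rewrite -(cvg_shiftS (fun n => p (x n) / x n)).
rewrite -(cvg_shiftS (fun n => p (x n))) in px.
apply: cvg0_le px => n /=.
by rewrite normrM ler_piMr // normfV invf_le1 ?x1 // (lt_le_trans ltr01) ?x1.
Qed.

Let pcvg : p n%:R @[n --> \oo] --> 0 /\ p (- n%:R) @[n --> \oo] --> 0.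
Proof. exact: (@normal_pdf_cvg0 _ 0 1). Qed.

(** On each half-line [M p / y + u] and [M p / y - u] are nonincreasing and tend to 0 at infinity,
    at [+oo] because [psi] has mean 0. Both thus have, weakly, the sign of [x], and multiplication
    by [x] gives the two bounds. *)
Let ubound (x : R) : x != 0 -> `|x * u x| <= M * p x.
Proof.
move=> x0.
have psic' c : `|c| = 1 -> forall y, c * psi y <= M.
  move=> c1 y; apply: le_trans (ler_norm _) _; rewrite normrM c1 mul1r; exact: psiM.
have dneg c y : `|c| = 1 -> - (M * (1 + (y ^+ 2)^-1) - c * psi y) * p y <= 0.
  move=> c1; rewrite mulNr oppr_le0; apply: mulr_ge0; last exact: ltW.
  have := psic' c c1 y; have : 0 <= M * (y ^+ 2)^-1 by rewrite mulr_ge0 ?invr_ge0 ?sqr_ge0.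
  by rewrite mulrDr mulr1; move: (M * _) => q; lra.
have decr c a b : `|c| = 1 -> a <= b -> 0 < a * b ->
    M * (p b / b) + c * u b <= M * (p a / a) + c * u a.
  move=> c1 ab ab0.
  have nz y : y \in `[a, b] -> y != 0.
    rewrite in_itv /= => /andP[h1 h2]; apply/eqP => y0; move: h1 h2; rewrite y0 => h1 h2.
    by have := mulr_le0_ge0 h1 h2; rewrite leNgt ab0.
  have sub y : y \in `]a, b[ -> y \in `[a, b] by apply: subset_itv_oo_cc.
  apply: (@ler0_derive1_le _ (fun y => M * (p y / y) + c * u y) a b _ _ true false) => //.
  - by move=> y /sub/nz y0; case: (dbar c y0).
  - move=> y /sub/nz y0; rewrite derive1E; have [_ ->] := dbar c y0; exact: dneg.
  - apply: continuous_in_subspaceT => y; rewrite inE /= => /nz y0.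
    apply: differentiable_continuous; apply/derivable1_diffP; by case: (dbar c y0).
  - by rewrite in_itv /= lexx ab.
  - by rewrite in_itv /= lexx ab.
have lim0 (c : R) (s : nat -> R) : (forall n, (0 < n)%N -> 1 <= `|s n|) ->
    p (s n) @[n --> \oo] --> 0 -> u (s n) @[n --> \oo] --> 0 ->
    M * (p (s n) / s n) + c * u (s n) @[n --> \oo] --> 0.
  move=> s1 ps us; rewrite -[X in _ --> X](addr0 0); apply: cvgD; first exact: pdivy.
  by rewrite -[X in _ --> X](mulr0 c); exact: cvgMr.
have n1 (n : nat) : (0 < n)%N -> 1 <= `|n%:R : R| by move=> n0; rewrite normr_nat ler1n.
have pos (c : R) : `|c| = 1 -> 0 <= x * (M * (p x / x) + c * u x).
  move=> c1; have [xn|xp|x00] := ltgtP x 0; last by rewrite x00 eqxx in x0.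
  - apply: mulr_le0; first exact: ltW.
    apply: (ler_cvg_to (cvg_cst _) (lim0 c (fun n => - n%:R) _ pcvg.2 uNy)).
      by move=> n n0; rewrite normrN n1.
    near=> n; apply: decr => //.
      by rewrite lerNl; near: n; exact: nbhs_infty_ger.
    rewrite nmulr_rgt0 // oppr_lt0; near: n; exact: nbhs_infty_gtr.
  - apply: mulr_ge0; first exact: ltW.
    apply: (ler_cvg_to (lim0 c (fun n => n%:R) n1 pcvg.1 uy) (cvg_cst _)).
    near=> n; apply: decr => //.
      by near: n; exact: nbhs_infty_ger.
    rewrite pmulr_rgt0 //; near: n; exact: nbhs_infty_gtr.
have e c : x * (M * (p x / x) + c * u x) = M * p x + c * (x * u x) by field.
rewrite ler_norml; apply/andP; split.
  by have := pos 1 (normr1 _); rewrite e; lra.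
by have := pos (-1) (normrN1 _); rewrite e; lra.
Unshelve. all: by end_near. Qed.

(** The solution is [u / p]. For [|x| > 1] its bound follows from the one on [x f]; on [[-1, 1]] it
    comes from continuity, so [K] is not explicit. *)
Lemma stein_solution : exists f : R -> R, exists K : R,
  [/\ forall x : R, is_derive x 1 f (psi x + x * f x),
      forall x, `|f x| <= K & forall x, `|x * f x| <= M].
Proof.
pose f x := u x / p x.
have pn x : p x != 0 by rewrite gt_eqF.
have df (x : R) : is_derive x 1 f (psi x + x * f x).
  have H := is_deriveM (du x) (is_deriveV (pn x) (dp x)).
  apply: (is_derive_eq H); rewrite -![_ *: _]/(_ * _) /f.
  by have := pn x; move: (u x) (p x) => a b b0; field.
have xf x : `|x * f x| <= M.
  have [->|x0] := eqVneq x 0; first by rewrite mul0r normr0.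
  by rewrite mulrA normrM normfV (gtr0_norm (pgt0 x)) ler_pdivrMr ?pgt0 // ubound.
have fc : {within `[-1, 1 : R], continuous (fun x => `|f x|)}.
  apply: continuous_subspaceT => x; apply: cvg_norm.
  by apply: differentiable_continuous; apply/derivable1_diffP; case: (df x).
have [c _ hc] := EVT_max (le_trans (lerN10 R) ler01) fc.
exists f, (M + `|f c|); split=> // x.
have [x1|x1] := lerP (`|x|) 1.
  apply: (le_trans (hc x _)); last by rewrite lerDr.
  by rewrite in_itv /= -ler_norml.
apply: (@le_trans _ _ M); last by rewrite lerDl.
by apply: le_trans (xf x); rewrite (normrM x) ler_peMl ?normr_ge0 ?(ltW x1).
Qed.

End SteinSolution.

(** * Sums of powers of integers *)

Section PowerSums.
Context {R : realType}.

Lemma powR_sub_exp (a : R) (k : nat) : (0 < k)%N ->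
  k%:R `^ a = k.+1%:R `^ a * expR (- (a * (ln k.+1%:R - ln k%:R))).
Proof.
move=> k0; rewrite /powR !pnatr_eq0 (gtn_eqF k0) /= -expRD.
by congr expR; ring.
Qed.

(** Induction on [n]. The factor 2 in [2 / a] absorbs the loss in
    [expR (- z) <= 1 / (1 + z) <= 1 - z / 2] for [0 < z <= 1], used at [z = a / (n + 1)]. *)
Lemma sum_powR_le (a : R) n : 0 < a <= 1 ->
  \sum_(1 <= k < n.+1) k%:R `^ (a - 1) <= 2 / a * n%:R `^ a.
Proof.
move=> /andP[a0 a1]; elim: n => [|n IHn].
  by rewrite big_geq // powR0 ?mulr0 // gt_eqF.
rewrite big_nat_recr //=; apply: le_trans (lerD IHn (lexx _)) _.
have [->|n0] := posnP n.
  rewrite powR0 ?gt_eqF // !powR1 mulr0 add0r mulr1 ler_pdivlMr ?mul1r //; lra.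
have nR : 0 < n%:R :> R by rewrite ltr0n.
have nR1 : 0 < n.+1%:R :> R by rewrite ltr0n.
rewrite powR_sub_exp // powRB // ?powRr1 ?ler0n //; last first.
  by rewrite pnatr_eq0 implybT.
have := @inv_le_lnB R _ n0; move: (ln _ - ln _) => y hy.
have P0 : 0 < n.+1%:R `^ a :> R by rewrite powR_gt0.
move: (_ `^ _) P0 => Q Q0.
have i0 : 0 < n.+1%:R^-1 :> R by rewrite invr_gt0.
have i1 : n.+1%:R^-1 <= 1 :> R by rewrite invf_le1 // ler1n.
move: (n.+1%:R^-1) i0 i1 hy => x x0 x1 hy.
have e1 : expR (- (a * y)) <= 1 - a * x / 2.
  rewrite expRN; apply: (@le_trans _ _ (1 + a * x)^-1).
    have ax : 0 < a * x by apply: mulr_gt0.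
    rewrite lef_pV2 ?posrE ?expR_gt0 //; last by lra.
    apply: le_trans (expR_ge1Dx _); rewrite lerD2l; apply: ler_wpM2l => //; exact: ltW.
  have ax : 0 < a * x by apply: mulr_gt0.
  have ax1 : a * x <= 1 by rewrite mulr_ile1 // ltW.
  rewrite -[leLHS]mul1r ler_pdivrMr; last by lra.
  move: (a * x) ax ax1 => z z0 z1; nra.
have := ler_wpM2l (mulr_ge0 (divr_ge0 (ler0n R 2) (ltW a0)) (ltW Q0)) e1.
rewrite mulrBr mulr1 => h.
rewrite mulrA; apply: le_trans (lerD h (lexx _)) _.
by rewrite [leLHS](_ : _ = 2 / a * Q) //; field; exact: lt0r_neq0.
Qed.

(** Telescoping: for [k >= 2], [k^(-1-a)] is at most [a^-1 ((k-1)^(-a) - k^(-a))]. *)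
Lemma sum_powR_tail (a : R) n : 0 < a ->
  \sum_(1 <= k < n.+1) k%:R `^ (- 1 - a) <= 1 + a^-1.
Proof.
move=> a0; case: n => [|n]; first by rewrite big_geq // addr_ge0 // invr_ge0 ltW.
suff : \sum_(1 <= k < n.+2) k%:R `^ (- 1 - a) <= 1 + a^-1 * (1 - n.+1%:R `^ (- a)).
  by move=> /le_trans; apply; rewrite lerD2l ler_piMr ?invr_ge0 ?(ltW a0) //.
elim: n => [|n IHn]; first by rewrite big_nat1 !powR1 subrr mulr0 addr0.
rewrite big_nat_recr //=; apply: le_trans (lerD IHn (lexx _)) _.
rewrite -addrA lerD2l.
rewrite powRD; last by rewrite pnatr_eq0 implybT.
have -> : n.+1%:R `^ (- a) = n.+2%:R `^ (- a) * expR (a * (ln n.+2%:R - ln n.+1%:R)) :> R.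
  by rewrite powR_sub_exp // mulNr opprK.
rewrite powR_inv1 ?ler0n //.
have := @inv_le_lnB R _ (ltn0Sn n); move: (ln _ - ln _) => y hy.
have Q0 : 0 < n.+2%:R `^ (- a) :> R by rewrite powR_gt0.
move: (_ `^ _) Q0 (n.+2%:R^-1) hy => Q Q0 x hy.
have e1 : 1 + a * x <= expR (a * y).
  by apply: le_trans (expR_ge1Dx _); rewrite lerD2l; apply: ler_wpM2l => //; exact: ltW.
have ai : 0 < a^-1 by rewrite invr_gt0.
have := ler_wpM2l (mulr_ge0 (ltW ai) (ltW Q0)) e1.
have -> : a^-1 * Q * (1 + a * x) = a^-1 * Q + Q * x by field; rewrite gt_eqF.
by move: (a^-1) (expR _) => b e; lra.
Qed.

End PowerSums.

(** * Equidistribution in logarithmic average *)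

Section LogAverage.
Context {R : realType}.
Implicit Types (u v x : nat -> R) (c : R).

Lemma log_average_le u v n : (forall k, u k <= v k) -> log_average u n <= log_average v n.
Proof.
move=> uv; apply: ler_wpM2l.
  (* At [n = 0] the logarithm has the default value 0. *)
  by rewrite invr_ge0; case: n => [|n]; [rewrite ln0|rewrite ln_ge0 ?ler1n].
by apply: ler_sum => k _; apply: ler_wpM2l => //; rewrite invr_ge0 ler0n.
Qed.

Lemma log_averageD u v n :
  log_average (fun k => u k + v k) n = log_average u n + log_average v n.
Proof.
rewrite /log_average -mulrDr -big_split /=; congr (_ * _).
by apply: eq_bigr => k _; rewrite mulrDr.
Qed.

Lemma log_averageZ c u n : log_average (fun k => c * u k) n = c * log_average u n.
Proof.
rewrite /log_average mulrCA; congr (_ * _); rewrite mulr_sumr.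
by apply: eq_bigr => k _; rewrite mulrCA.
Qed.

Lemma ln_le_harm n : ln n.+1%:R <= harm n :> R.
Proof.
elim: n => [|n IHn]; first by rewrite /harm big_geq // ln1.
rewrite /harm big_nat_recr //= -/(harm n).
have -> : n.+2%:R = (1 + n.+1%:R^-1) * n.+1%:R :> R.
  by rewrite mulrDl mul1r mulVf ?pnatr_eq0 // natr1.
rewrite lnM ?posrE ?ltr0n // ?addr_gt0 ?invr_gt0 ?ltr0n // addrC lerD //.
by apply: le_ln1Dx; apply: lt_trans (ltrN10 _) _; rewrite invr_gt0 ltr0n.
Qed.

Lemma cvg_inv_ln : (ln n%:R)^-1 @[n --> \oo] --> (0 : R).
Proof.
apply/cvgrPdist_le => e e0; near=> n; rewrite sub0r normrN normfV.
have hn : expR e^-1 <= n%:R by near: n; exact: nbhs_infty_ger.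
have ei : 0 < e^-1 by rewrite invr_gt0.
have h : e^-1 <= ln n%:R.
  by rewrite -[leLHS]expRK ler_ln ?posrE ?expR_gt0 // (lt_le_trans (expR_gt0 _) hn).
have l0 : 0 < ln n%:R :> R by exact: lt_le_trans h.
by rewrite gtr0_norm // -(invrK e) lef_pV2 ?posrE.
Unshelve. all: by end_near. Qed.

(** The harmonic sum lies between [ln n] and [1 + ln n]. *)
Lemma log_average_cst c : log_average (fun=> c) n @[n --> \oo] --> c.
Proof.
have -> : log_average (fun=> c) = (fun n => c * ((ln n%:R)^-1 * harm n)).
  apply/funext => n; rewrite /log_average /harm mulrCA; congr (_ * _).
  by rewrite mulr_sumr; apply: eq_bigr => k _; rewrite mulrC.
rewrite -[X in _ --> X](mulr1 c); apply: cvgMr.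
have h1 : 1 + (ln n%:R)^-1 @[n --> \oo] --> (1 : R).
  by rewrite -[X in _ --> X](addr0 1); apply: cvgD; [exact: cvg_cst|exact: cvg_inv_ln].
apply: (squeeze_cvgr _ (cvg_cst (1 : R)) h1).
near=> n.
have n1 : 1 < n%:R :> R by near: n; exact: nbhs_infty_gtr.
have l0 : 0 < ln n%:R :> R by rewrite ln_gt0.
have n0 : (0 < n)%N by rewrite -(ltr0n R) (lt_trans ltr01).
rewrite ler_pdivlMl // mulr1; apply/andP; split.
  apply: le_trans (ln_le_harm n); rewrite ler_ln ?posrE ?ltr0n // ler_nat //.
rewrite [leRHS](_ : _ = (ln n%:R)^-1 * (1 + ln n%:R)); last by rewrite mulrDr mulr1 mulVf ?gt_eqF // addrC.
by apply: ler_wpM2l; [rewrite invr_ge0 ltW|exact: harm_le].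
Unshelve. all: by end_near. Qed.

Lemma log_average_fin (u : nat -> R) (K : nat) : (forall k, (K <= k)%N -> u k = 0) ->
  log_average u n @[n --> \oo] --> (0 : R).
Proof.
move=> u0.
rewrite -[X in _ --> X](mul0r (\sum_(1 <= k < K.+1) k%:R^-1 * u k)).
have : (ln n%:R)^-1 * (\sum_(1 <= k < K.+1) k%:R^-1 * u k) @[n --> \oo] -->
  (0 : R) * (\sum_(1 <= k < K.+1) k%:R^-1 * u k) by apply: cvgMl; exact: cvg_inv_ln.
apply: cvg_trans; apply: near_eq_cvg; near=> n.
have Kn : (K <= n)%N by near: n; exists K.
rewrite /log_average; congr (_ * _).
rewrite [RHS](@big_cat_nat _ _ _ K.+1) //= [X in _ + X]big_nat_cond [X in _ + X]big1 ?addr0 //.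
by move=> k /andP[/andP[h _] _]; rewrite u0 ?mulr0 // ltnW.
Unshelve. all: by end_near. Qed.

Lemma cvg_sandwich (u : nat -> R) (l : R) :
  (forall e, 0 < e -> exists (v w : nat -> R) (a b : R),
    [/\ forall n, v n <= u n <= w n, v @ \oo --> a, w @ \oo --> b, l - e <= a & b <= l + e]) ->
  u @ \oo --> l.
Proof.
move=> H; apply/cvgrPdist_le => e e0.
have e2 : 0 < e / 2 by rewrite divr_gt0.
have [v [w [a [b [uvw /cvgrPdist_le va /cvgrPdist_le wb la lb]]]]] := H _ e2.
near=> n.
have : `|a - v n| <= e / 2 by near: n; exact: va.
have : `|b - w n| <= e / 2 by near: n; exact: wb.
have /andP[h1 h2] := uvw n.
rewrite !ler_norml => /andP[h3 h4] /andP[h5 h6].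
by apply/andP; split; lra.
Unshelve. all: by end_near. Qed.

End LogAverage.

Section Equidistribution.
Context {R : realType}.
Local Notation N := (normal_prob (0 : R) 1 : probability (measurableTypeR R) R).
Local Notation ind z := (\1_(`]-oo, z]%classic) : R -> R).
Implicit Types (x y : nat -> R) (g : R -> R).

Lemma indNyE (z t : R) : ind z t = (t <= z)%R%:R.
Proof.
rewrite indicE; case: (lerP t z) => h; first by rewrite mem_set.
by rewrite memNset //= in_itv /= leNgt h.
Qed.

(** [s] stands for [x k], [t] for [y k], and [b] flags the finitely many early indices. The
    bracketed terms signal [s] outside []-A, A]], where nothing is known of [t]. *)
Let transfer_ineq (z A del s t : R) (b : bool) :
  (~~ b -> `|s| <= A -> `|t - s| <= del) ->
  ind (z - del) s - ((1 - ind A s) + ind (- A) s) - b%:R <= ind z t <=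
  ind (z + del) s + ((1 - ind A s) + ind (- A) s) + b%:R.
Proof.
rewrite !indNyE; case: b => [_|/(_ isT) H].
  move: (t <= z) (s <= z - del) (s <= z + del) (s <= A) (s <= - A).
  by do 5!case; apply/andP; split => /=; lra.
have [sA|sA] := lerP s A; last first.
  move: (t <= z) (s <= z - del) (s <= z + del) (s <= - A) => {H}.
  by do 4!case; apply/andP; split => /=; lra.
have [sA'|sA'] := lerP s (- A).
  move: (t <= z) (s <= z - del) (s <= z + del) => {H}.
  by do 3!case; apply/andP; split => /=; lra.
move: H; rewrite ler_norml sA (ltW sA') => /(_ isT); rewrite ler_norml => /andP[h1 h2].
by case: (lerP t z) => g1; case: (lerP s (z - del)) => g2; case: (lerP s (z + del)) => g3;
  apply/andP; split => /=; lra.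
Qed.

(** Integrability is carried along so that the limits can be added and compared. *)
Definition log_equi x g := mom N g /\ log_average (fun k => g (x k)) n @[n --> \oo] --> Ex N g.

Lemma mom_ind z : mom N (ind z).
Proof.
apply: (@mom_bnd _ _ R N _ 1); first exact: measurable_indic.
by move=> t; rewrite indNyE; case: (t <= z); rewrite ?normr1 ?normr0.
Qed.

Lemma log_equiD x f g : log_equi x f -> log_equi x g -> log_equi x (fun t => f t + g t).
Proof.
move=> [mf cf] [mg cg]; split; first exact: mom_add.
apply: cvg_seq_ext (cvgD cf cg) _ _; first by rewrite ExD.
by move=> n; rewrite log_averageD.
Qed.

Lemma log_equiZ x c g : log_equi x g -> log_equi x (fun t => c * g t).
Proof.
move=> [mg cg]; split; first exact: mom_scal.
apply: (@cvg_seq_ext _ _ _ (c * Ex N g) _ (cvgMr cg)); first by rewrite ExZ.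
by move=> n; rewrite log_averageZ.
Qed.

Lemma log_equi_cst x c : log_equi x (fun=> c).
Proof. by split; [exact: mom_cst|rewrite Ex_cst; exact: log_average_cst]. Qed.

Lemma log_equiB x f g : log_equi x f -> log_equi x g -> log_equi x (fun t => f t - g t).
Proof.
move=> hf hg; have := log_equiD hf (log_equiZ (-1) hg).
by congr log_equi; apply/funext => t; rewrite mulN1r.
Qed.

Lemma log_equi_sandwich x g : mom N g ->
  (forall e, 0 < e -> exists s1 s2, [/\ log_equi x s1, log_equi x s2,
     forall t, s1 t <= g t <= s2 t & Ex N s2 - Ex N s1 <= e]) -> log_equi x g.
Proof.
move=> mg H; split=> //; apply: cvg_sandwich => e e0.
have [s1 [s2 [[m1 c1] [m2 c2] s12 E]]] := H e e0.
have h1 : Ex N s1 <= Ex N g by apply: Ex_le => // t; case/andP: (s12 t).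
have h2 : Ex N g <= Ex N s2 by apply: Ex_le => // t; case/andP: (s12 t).
exists (log_average (fun k => s1 (x k))), (log_average (fun k => s2 (x k))), (Ex N s1), (Ex N s2).
split=> //; try lra.
by move=> n; apply/andP; split; apply: log_average_le => k; case/andP: (s12 (x k)).
Qed.

Let cutE (z : R) : Ex N (ind z) = Ex N ((fun=> 1) \* ind z).
Proof. by congr Ex; apply/funext => t /=; rewrite mul1r. Qed.

Let one1 (t : R) : `|1| <= 1 :> R. Proof. by rewrite normr1. Qed.
Let onec : continuous ((fun=> 1) : R -> R). Proof. by move=> t; exact: cvg_cst. Qed.

Lemma Ex_ind_continuous (z e : R) : 0 < e -> exists2 del, 0 < del &
  Ex N (ind (z + del)) <= Ex N (ind z) + e /\ Ex N (ind z) - e <= Ex N (ind (z - del)).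
Proof.
move=> e0.
have : {for z, continuous (fun z => Ex N (ind z))}.
  have -> : (fun z => Ex N (ind z)) = (fun z => Ex N ((fun=> 1) \* ind z)).
    by apply/funext => y; rewrite cutE.
  apply: differentiable_continuous; apply/derivable1_diffP.
  by case: (is_derive_normal_cut onec one1 z).
move=> /cvgrPdist_le/(_ e e0) [del /= d0 hd].
have d2 : 0 < del / 2 by rewrite divr_gt0.
have dd : `|del / 2| < del by rewrite gtr0_norm // ltr_pdivrMr // ltr_pMr // ltr1n.
exists (del / 2) => //; split.
  have := hd (z + del / 2); rewrite /= opprD addrA subrr sub0r normrN => /(_ dd).
  by rewrite ler_norml => /andP[h _]; rewrite -lerBlDl -[leLHS]opprB lerNl.
have := hd (z - del / 2); rewrite /= opprB addrCA subrr addr0 => /(_ dd).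
by rewrite ler_norml => /andP[_ h]; rewrite lerBlDr -lerBlDl.
Qed.

Lemma Ex_ind_tails (e : R) : 0 < e -> exists2 A, 0 < A &
  Ex N (ind (- A)) <= e /\ 1 - e <= Ex N (ind A).
Proof.
move=> e0.
have /cvgrPdist_le/(_ e e0) h1 := normal_cut_cvgNy onec one1.
have /cvgrPdist_le/(_ e e0) h2 := normal_cut_cvgy onec one1.
near \oo => n.
have n0 : 0 < n%:R :> R by near: n; exact: nbhs_infty_gtr.
exists n%:R => //; rewrite !cutE; split.
  have : `|0 - Ex N ((fun=> 1) \* ind (- n%:R))| <= e by near: n; exact: h1.
  by rewrite sub0r normrN; apply: le_trans; exact: ler_norm.
have : `|Ex N (fun=> 1) - Ex N ((fun=> 1) \* ind (n%:R))| <= e by near: n; exact: h2.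
rewrite Ex_cst; move/(le_trans (ler_norm _)); lra.
Unshelve. all: by end_near. Qed.

(** Closeness is available on compact sets only. The logarithmic frequency of [x] outside [[-A, A]]
    is controlled by the equidistribution of [x] itself, and the continuity of the normal
    distribution function absorbs the shift of [z] by [del]. *)
Lemma log_equi_transfer x y :
  (forall z, log_equi x (ind z)) ->
  (forall A e, 0 < e -> exists K, forall k, (K <= k)%N -> `|x k| <= A -> `|y k - x k| <= e) ->
  forall z, log_equi y (ind z).
Proof.
move=> xe xy z; split; first exact: mom_ind.
apply: cvg_sandwich => e e0.
have e3 : 0 < e / 3 by rewrite divr_gt0.
have [del d0 [dp dm]] := Ex_ind_continuous z e3.
have [A A0 [AN Ap]] := Ex_ind_tails e3.
have [K hK] := xy A del d0.
pose err := (fun t => (1 - ind A t) + ind (- A) t).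
have herr : log_equi x err.
  by apply: log_equiD => //; apply: log_equiB => //; exact: log_equi_cst.
have Eerr : Ex N err <= e / 3 + e / 3.
  rewrite ExD; [|by apply: mom_sub; [exact: mom_cst|exact: mom_ind]|exact: mom_ind].
  by rewrite ExB ?Ex_cst; [lra|exact: mom_cst|exact: mom_ind].
pose fin k : R := (k < K)%:R.
have hfin : log_average fin n @[n --> \oo] --> (0 : R).
  by apply: (@log_average_fin _ _ K) => k Kk; rewrite /fin ltnNge Kk.
have [mp cp] := log_equiD (xe (z + del)) herr.
have [mm cm] := log_equiB (xe (z - del)) herr.
exists (log_average (fun k => ind (z - del) (x k) - err (x k) + - 1 * fin k)).
exists (log_average (fun k => ind (z + del) (x k) + err (x k) + fin k)).
exists (Ex N (fun t => ind (z - del) t - err t) + -1 * 0).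
exists (Ex N (fun t => ind (z + del) t + err t) + 0); split.
- have hk k : ~~ (k < K)%N -> `|x k| <= A -> `|y k - x k| <= del by rewrite -leqNgt => /hK.
  by move=> n; apply/andP; split; apply: log_average_le => k; rewrite ?mulN1r;
    have /andP[] := @transfer_ineq z A del (x k) (y k) _ (hk k).
- apply: (@cvg_seq_ext _ _ _ _ _ (cvgD cm (cvg_scalel (-1) hfin)) erefl) => n.
  by rewrite log_averageD log_averageZ.
- by apply: (@cvg_seq_ext _ _ _ _ _ (cvgD cp hfin) erefl) => n; rewrite log_averageD.
- rewrite ExB; [|exact: mom_ind|exact: herr.1]; lra.
- rewrite ExD; [|exact: mom_ind|exact: herr.1]; lra.
Qed.

End Equidistribution.

Section EquidistributionBounded.
Context {R : realType}.
Local Notation N := (normal_prob (0 : R) 1 : probability (measurableTypeR R) R).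
Local Notation ind z := (\1_(`]-oo, z]%classic) : R -> R).
Implicit Types (x : nat -> R).

(** [phi] is squeezed between step functions, which are combinations of indicators of half-lines;
    the error is [e1] inside []-A, A]] and grows by [2 M] outside. *)
Lemma log_equi_bounded x (phi : R -> R) (M : R) : continuous phi ->
  (forall t, `|phi t| <= M) -> (forall z, log_equi x (ind z)) -> log_equi x phi.
Proof.
move=> cphi phiM xe.
have mphi : mom N phi by apply: (@mom_bnd _ _ R N _ M) => //; exact: continuous_measurable_fun.
apply: log_equi_sandwich => // e e0.
have M0 : 0 <= M by rewrite (le_trans _ (phiM 0)).
(* The two sides of the sandwich differ in mean by at most twice [e1 + 4 M e2], and
   [4 M e2 <= e / 4]. *)
pose e1 := e / 4; have e10 : 0 < e1 by rewrite divr_gt0.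
pose e2 := e / (16 * (M + 1)); have e20 : 0 < e2 by rewrite divr_gt0 // mulr_gt0 // ltr_wpDl.
have [A A0 [AN Ap]] := Ex_ind_tails e20.
have [del d0 hdel] := @unif_continuous_segment _ phi (- A) A e1 cphi e10.
(* One cell of length [del / 2] is added at a time; the bound [|s t| <= M] keeps the error outside
   the cells below [2 M]. *)
have step n : exists s, log_equi x s /\ forall t,
    (- A < t <= - A + n%:R * (del / 2) -> t <= A -> `|phi t - s t| <= e1) /\
    (~~ (- A < t <= - A + n%:R * (del / 2)) -> s t = 0) /\ `|s t| <= M.
  elim: n => [|n [s [es hs]]].
    exists (fun=> 0); split; first exact: log_equi_cst.
    by move=> t; rewrite normr0 mul0r addr0; split=> // /andP[h1 h2]; lra.
  pose a := - A + n%:R * (del / 2); pose b := - A + n.+1%:R * (del / 2).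
  have ab : b = a + del / 2 by rewrite /a /b -natr1; ring.
  have aA : - A <= a by rewrite lerDl mulr_ge0 // ltW // divr_gt0.
  exists (fun t => s t + phi a * (ind b t - ind a t)); split.
    by apply: log_equiD => //; apply: log_equiZ; apply: log_equiB.
  move=> t; have [h1 [h2 h3]] := hs t; rewrite -/a in h1 h2; rewrite -/b !indNyE; split; last split.
    move=> /andP[t1 t2] tA; have [ta|ta] := lerP t a.
      by rewrite (_ : (t <= b) = true) // subrr mulr0 addr0; apply: h1 => //; rewrite t1.
    rewrite t2 h2 ?t1 -?ltNge //= subr0 mulr1 add0r distrC; apply: hdel.
      by rewrite tA (ltW t1).
    rewrite ler0_norm; last by rewrite subr_le0 ltW.
    rewrite opprB ltrBlDr addrC; apply: le_lt_trans t2 _.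
    by rewrite ab ltrD2l ltr_pdivrMr // ltr_pMr // ltr1n.
  rewrite negb_and -!leNgt -ltNge => hb; rewrite h2; last first.
    rewrite negb_and -!leNgt -ltNge; case/orP: hb => [->//|bt].
    by apply/orP; right; apply: lt_trans bt; rewrite ab ltrDl divr_gt0.
  case/orP: hb => [tA|bt].
    have ta : t <= a by exact: le_trans aA.
    have tb : t <= b by rewrite ab (le_trans ta) // lerDl ltW // divr_gt0.
    by rewrite ta tb subrr mulr0 addr0.
  have ta : a < t by apply: lt_trans bt; rewrite ab ltrDl divr_gt0.
  by rewrite !leNgt bt ta /= subrr mulr0 addr0.
  have [ta|ta] := lerP t a.
    by rewrite (_ : (t <= b) = true) ?subrr ?mulr0 ?addr0 // ab (le_trans ta) // lerDl ltW // divr_gt0.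
  rewrite subr0 h2; last by rewrite negb_and -!ltNge -leNgt ta orbT.
  by case: (t <= b); rewrite ?mulr1 ?mulr0 ?addr0 ?add0r ?normr0.
near \oo => n.
have nA : A <= - A + n%:R * (del / 2).
  rewrite -lerBlDl opprK -ler_pdivrMr ?divr_gt0 // (_ : A + A = 2 * A); last by ring.
  by near: n; exact: nbhs_infty_ger.
have [s [es hs]] := step n.
pose err := (fun t => e1 + (2 * M) * ((1 - ind A t) + ind (- A) t)).
have herr : log_equi x err.
  apply: log_equiD; first exact: log_equi_cst.
  by apply: log_equiZ; apply: log_equiD => //; apply: log_equiB => //; exact: log_equi_cst.
have Eerr : Ex N err <= e / 2.
  have m1 : mom N (fun t => 1 - ind A t) by apply: mom_sub; [exact: mom_cst|exact: mom_ind].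
  have m2 : mom N (fun t => (1 - ind A t) + ind (- A) t) by apply: mom_add => //; exact: mom_ind.
  rewrite ExD; [|exact: mom_cst|exact: mom_scal].
  rewrite Ex_cst ExZ // ExD //; last exact: mom_ind.
  rewrite ExB; [|exact: mom_cst|exact: mom_ind].
  rewrite Ex_cst; have h : 1 - Ex N (ind A) + Ex N (ind (- A)) <= 2 * e2 by lra.
  have {}h : 2 * M * (1 - Ex N (ind A) + Ex N (ind (- A))) <= 2 * M * (2 * e2).
    by apply: ler_wpM2l => //; rewrite mulr_ge0.
  have M1 : 0 < M + 1 by lra.
  have h2 : 2 * M * (2 * e2) <= e / 4 * (M / (M + 1)).
    by rewrite le_eqVlt; apply/orP; left; apply/eqP; rewrite /e2; field; rewrite gt_eqF.
  have h3 : M / (M + 1) <= 1 by rewrite ler_pdivrMr //; lra.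
  have h4 : e / 4 * (M / (M + 1)) <= e / 4 by rewrite ler_piMr // ltW.
  by rewrite /e1; lra.
exists (fun t => s t - err t), (fun t => s t + err t); split.
- exact: log_equiB.
- exact: log_equiD.
- move=> t; have [h1 [h2 h3]] := hs t; have h4 := phiM t.
  suff : `|phi t - s t| <= err t.
    by rewrite ler_norml => /andP[g1 g2]; apply/andP; split; lra.
  have h5 : `|phi t - s t| <= M + M by apply: le_trans (ler_normB _ _) (lerD h4 h3).
  rewrite /err !indNyE; have [tA|tA] := lerP t A; last first.
    by case: (t <= - A) => /=; lra.
  have [tA'|tA'] := lerP t (- A); first by lra.
  rewrite subrr addr0 mulr0 addr0; apply: h1 => //; rewrite tA' /=.
  exact: le_trans nA.
- rewrite ExB; [|exact: es.1|exact: herr.1]; rewrite ExD; [|exact: es.1|exact: herr.1]; lra.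
Unshelve. all: by end_near. Qed.

End EquidistributionBounded.

Section Logistic.
Context {R : realType}.

(** A smooth approximation of the indicator of [t <= q], of steepness [m]: bounded, with bounded
    derivative, and with parameters that can be taken in countable sets. *)
Definition logistic (m q t : R) : R := (1 + expR (m * (t - q)))^-1.

Definition dlogistic (m q t : R) := - (m * expR (m * (t - q)) * logistic m q t ^+ 2).

Lemma is_derive_logistic (m q t : R) : is_derive t 1 (logistic m q) (dlogistic m q t).
Proof.
have de : is_derive t 1 (fun s : R => 1 + expR (m * (s - q))) (m * expR (m * (t - q))).
  have dl : is_derive t 1 (fun s : R => m * (s - q)) m.
    by apply: is_derive_eq; rewrite -?[_ *: _]/(_ * _); ring.
  have H := @is_derive1_comp _ expR (fun s : R => m * (s - q)) t _ _ (is_derive_expR (m * (t - q))) dl.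
  have H2 := is_deriveD (is_derive_cst (1 : R) t 1) H; apply: (is_derive_eq H2).
  by rewrite add0r mulrC.
have p0 : 1 + expR (m * (t - q)) != 0 by rewrite gt_eqF // addr_gt0 ?expR_gt0.
have H := @is_deriveV _ (fun s : R => 1 + expR (m * (s - q))) _ _ _ p0 de; apply: (is_derive_eq H).
by rewrite -[_ *: _]/(_ * _) /dlogistic /logistic exprVn; ring.
Qed.

Lemma logistic_ge0 m q t : 0 <= logistic m q t.
Proof. by rewrite invr_ge0 addr_ge0 // expR_ge0. Qed.

Lemma logistic_le1 m q t : logistic m q t <= 1.
Proof. by rewrite invf_le1 ?lerDl ?expR_ge0 // addr_gt0 ?expR_gt0. Qed.

Lemma logistic_bound m q t : `|logistic m q t| <= 1.
Proof. by rewrite ger0_norm ?logistic_ge0 // logistic_le1. Qed.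

Lemma continuous_logistic m q : continuous (logistic m q).
Proof.
move=> t; apply: differentiable_continuous; apply/derivable1_diffP.
by case: (is_derive_logistic m q t).
Qed.

Lemma continuous_dlogistic m q : continuous (dlogistic m q).
Proof.
move=> t; apply: cvgN; apply: cvgM.
  apply: cvgMr; apply: (@continuous_comp _ _ _ (fun t => m * (t - q)) expR).
    by apply: cvgMr; apply: cvgB; [exact: cvg_id|exact: cvg_cst].
  exact: continuous_expR.
rewrite (_ : (fun x => _) = (fun x => logistic m q x * logistic m q x)); last first.
  by apply/funext => x; rewrite expr2.
by rewrite expr2; apply: cvgM; exact: continuous_logistic.
Qed.

Lemma dlogistic_bound m q t : `|dlogistic m q t| <= `|m|.
Proof.
rewrite /dlogistic normrN -mulrA normrM ler_piMr //.
rewrite expr2 mulrA normrM mulr_ile1 ?logistic_bound // ger0_norm ?mulr_ge0 ?expR_ge0 ?logistic_ge0 //.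
by rewrite ler_pdivrMr ?addr_gt0 ?expR_gt0 // mul1r lerDr.
Qed.

Lemma logistic_high (m q d t : R) : 0 <= m -> q + d <= t ->
  logistic m q t <= (1 + expR (m * d))^-1.
Proof.
move=> m0 h; rewrite lef_pV2 ?posrE ?addr_gt0 ?expR_gt0 // lerD2l ler_expR.
by apply: ler_wpM2l => //; rewrite lerBrDl.
Qed.

Lemma logistic_low (m q d t : R) : 0 <= m -> t <= q - d ->
  1 - (1 + expR (m * d))^-1 <= logistic m q t.
Proof.
move=> m0 h; have E0 := expR_gt0 (m * d).
have -> : 1 - (1 + expR (m * d))^-1 = (1 + expR (- (m * d)))^-1.
  have := E0; rewrite expRN; move: (expR _) => E E1; field.
  by rewrite !gt_eqF ?addr_gt0 //.
rewrite lef_pV2 ?posrE ?addr_gt0 ?expR_gt0 // lerD2l ler_expR -mulrN.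
by apply: ler_wpM2l => //; rewrite lerBlDr addrC.
Qed.

End Logistic.

Section AlmostSureEquidistribution.
Context d (T : measurableType d) (R : realType) (P : probability T R).
Local Notation N := (normal_prob (0 : R) 1 : probability (measurableTypeR R) R).
Local Notation ind z := (\1_(`]-oo, z]%classic) : R -> R).
Variable G : (T -> R) -> Prop.
Hypothesis GS : gaussian_space P G.
Variable X : nat -> T -> R.
Hypothesis GX : forall t, G (X t).
Hypothesis gram0 : forall s t, 0 <= gram P X s t.
Hypothesis gram1 : forall t, 1 <= gram P X t t.
Variables (a C : R).
Hypothesis a0 : 0 < a.
Hypothesis C1 : 1 <= C.
Hypothesis rowP : forall k s, (s < k)%N ->
  \sum_(t < k) gram P X s t <= C * k%:R `^ (2^-1 - a).
Hypothesis gram2 : forall s l, \sum_(t < l) gram P X s t ^+ 2 <= C.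

Let F w k := std_sumsq P X k w.

Let measF k : measurable_fun [set: T] (F ^~ k).
Proof.
apply: measurable_funM; last exact: measurable_cst.
apply: measurable_funB; last exact: measurable_cst.
exact: mom_meas (mom_sumsq GS GX k).
Qed.

Let C0 : 0 <= C. Proof. exact: le_trans ler01 C1. Qed.

(** With the weight [1 / k] the first error becomes [k^(-1-a)] and the second [l^(-1/4) k^(1/4-1)],
    whose sums over [k <= l] are bounded uniformly in [l]. *)
Let bound_sum (B : R) l : (0 < l)%N ->
  \sum_(1 <= k < l.+1) k%:R^-1 * (B * (2 * (C * k%:R `^ (2^-1 - a)) / Num.sqrt k%:R +
    2 * C * Num.sqrt (Num.sqrt (k%:R / l%:R)))) =
  B * (2 * C) * ((\sum_(1 <= k < l.+1) k%:R `^ (- 1 - a)) +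
    (l%:R `^ 4^-1)^-1 * \sum_(1 <= k < l.+1) k%:R `^ (4^-1 - 1)).
Proof.
move=> l0; rewrite !(mulr_sumr, mulrDr) -big_split /=.
rewrite big_nat [RHS]big_nat; apply: eq_bigr => k /andP[k1 kl].
have kR : 0 < k%:R :> R by rewrite ltr0n.
have lR : 0 < l%:R :> R by rewrite ltr0n.
have e2 : k%:R `^ (- 1 - a) = k%:R^-1 * (k%:R `^ (2^-1 - a) / Num.sqrt k%:R).
  rewrite -powR12_sqrt ?ler0n // -powRN -powRD; last by rewrite (gt_eqF kR) implybT.
  rewrite -[k%:R^-1]powR_inv1 ?ler0n // -powRD; last by rewrite (gt_eqF kR) implybT.
  by congr (_ `^ _); ring.
have e4 : (l%:R `^ 4^-1)^-1 * k%:R `^ (4^-1 - 1) = k%:R^-1 * Num.sqrt (Num.sqrt (k%:R / l%:R)) :> R.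
  rewrite powRB; last by rewrite (gt_eqF kR) implybT.
  rewrite powRr1 ?ler0n // -!powR12_sqrt ?powR_ge0 ?divr_ge0 ?ler0n // -powRrM.
  rewrite (_ : 2^-1 * 2^-1 = 4^-1) -?invfM -?natrM // powRM ?ler0n ?invr_ge0 ?ler0n //.
  by rewrite -[X in _ * (_ * X `^ _)]powR_inv1 ?ler0n // -powRrM mulN1r powRN; ring.
by rewrite mulrCA e2 e4; ring.
Qed.

(** Stein's equation for the centered function gives [psi0 x = f' x - x f x], so the two-point
    estimate bounds [E (psi0 (F_k) psi0 (F_l))]. *)
Lemma ae_log_equi_smooth (psi psi' : R -> R) (M : R) :
  (forall x : R, is_derive x 1 psi (psi' x)) -> continuous psi' ->
  (forall x, `|psi x| <= M) -> (forall x, `|psi' x| <= M) ->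
  {ae P, forall w, log_equi (F w) psi}.
Proof.
move=> dp cp' bp bp'.
have M0 : 0 <= M by exact: le_trans (bp 0).
have cpsi : continuous psi.
  by move=> x; apply: differentiable_continuous; apply/derivable1_diffP; case: (dp x).
have mpsi : mom N psi by apply: (@mom_bnd _ _ R N _ M) => //; exact: continuous_measurable_fun.
pose c := Ex N psi; pose psi0 x := psi x - c.
have cM : `|c| <= M.
  apply: le_trans (Ex_abs mpsi) _; rewrite -(Ex_cst N M); apply: Ex_le => //; first exact: mom_abs.
  exact: mom_cst.
have dp0 (x : R) : is_derive x 1 psi0 (psi' x).
  by have H := is_deriveB (dp x) (is_derive_cst c x 1); apply: (is_derive_eq H); rewrite subr0.
have c0 : continuous psi0 by move=> x; apply: cvgB; [exact: cpsi|exact: cvg_cst].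
have b0 x : `|psi0 x| <= M + M by apply: le_trans (ler_normB _ _) (lerD (bp x) cM).
have E0 : Ex N psi0 = 0 by rewrite ExB ?Ex_cst ?subrr //; exact: mom_cst.
have [f [K [df bf bxf]]] := stein_solution c0 b0 E0.
(* One constant for [f], [f'], [psi0] and [psi']: both [psi0] and [x f] are at most [2 M], and [f']
   is their sum. *)
pose B := `|K| + 4 * M.
have B1 x : `|f x| <= B.
  by apply: le_trans (bf x) _; apply: le_trans (ler_norm _) _; rewrite lerDl mulr_ge0.
have B2 x : `|psi0 x + x * f x| <= B.
  apply: le_trans (ler_normD _ _) _; have := b0 x; have := bxf x; have := normr_ge0 K.
  by rewrite /B; lra.
have B3 x : `|psi0 x| <= B by have := b0 x; have := normr_ge0 K; rewrite /B; lra.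
have B4 x : `|psi' x| <= B by have := bp' x; have := normr_ge0 K; rewrite /B; lra.
have cf : continuous f.
  by move=> x; apply: differentiable_continuous; apply/derivable1_diffP; case: (df x).
have cf' : continuous (fun x => psi0 x + x * f x).
  by move=> x; apply: cvgD; [exact: c0|apply: cvgM; [exact: cvg_id|exact: cf]].
have ma k : mom P (fun w => psi0 (F w k)).
  apply: (@mom_bnd _ _ R P _ B) => //.
  by apply: measurableT_comp (measF k); exact: continuous_measurable_fun.
have aM k w : `|psi0 (F w k)| <= B by [].
(* [1 + a^-1] bounds the tail sum, and [8 = 2 / (1/4)] comes from the power sum of exponent
   [1/4 - 1]. *)
pose D := B ^+ 2 * (2 * C) * (1 + a^-1 + 8).
have := log_average_slln (D := D) ma aM; case.
  move=> l l0; rewrite /D.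
  apply: (@le_trans _ _ (\sum_(1 <= k < l.+1) k%:R^-1 * (B ^+ 2 *
     (2 * (C * k%:R `^ (2^-1 - a)) / Num.sqrt k%:R + 2 * C * Num.sqrt (Num.sqrt (k%:R / l%:R)))))).
    rewrite big_nat [leRHS]big_nat; apply: ler_sum => k /andP[k1 kl].
    apply: ler_wpM2l; first by rewrite invr_ge0 ler0n.
    have := stein_bound GS GX gram0 gram1 rowP C1 gram2 df cf' B1 B2 dp0 cp' B3 B4 k1 kl.
    apply: le_trans; rewrite le_eqVlt; apply/orP; left; apply/eqP; congr `|Ex _ _|.
    by apply/funext => w; rewrite /F; congr (_ * _); ring.
  rewrite bound_sum //; apply: ler_wpM2l.
    by rewrite mulr_ge0 ?sqr_ge0 // mulr_ge0.
  apply: lerD; first exact: sum_powR_tail.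
  rewrite ler_pdivrMl ?powR_gt0 ?ltr0n // mulrC.
  have h4 : 0 < (4^-1 : R) <= 1 by apply/andP; split; lra.
  by apply: le_trans (sum_powR_le l h4) _; rewrite invrK -natrM.
move=> A [mA A0 hA]; exists A; split=> // w /= nw; apply: hA => /= hw; apply: nw.
have : log_equi (F w) psi0.
  by split; [apply: mom_sub => //; exact: mom_cst|rewrite E0].
move=> /log_equiD/(_ (log_equi_cst (F w) c)).
by congr log_equi; apply/funext => x; rewrite /psi0 subrK.
Qed.

Lemma ae_log_equi_ind : {ae P, forall w, forall z, log_equi (F w) (ind z)}.
Proof.
(* Enumerating the logistic functions with rational threshold and integer steepness leaves one null
   set for all [z]. *)
pose fam (i : nat) : R -> R :=
  if unpickle i is Some (q, m) then logistic m%:R (ratr q) else fun=> 0 : R.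
have : {ae P, forall w, forall i : nat, log_equi (F w) (fam i)}.
  apply: ae_foralln => i; rewrite /fam.
  case: (unpickle i : option (rat * nat)) => [[q m]|]; last first.
    by apply: aeW => w; exact: log_equi_cst.
  have m1 : 1 <= `|m%:R| + 1 :> R by rewrite lerDr.
  apply: (@ae_log_equi_smooth _ (dlogistic m%:R (ratr q)) (`|m%:R| + 1)) => [x||x|x].
  - exact: is_derive_logistic.
  - exact: continuous_dlogistic.
  - exact: le_trans (logistic_bound _ _ _) m1.
  by apply: le_trans (dlogistic_bound _ _ _) _; rewrite lerDl.
apply: filterS => w famw z.
have {famw} eqv (q : rat) (m : nat) : log_equi (F w) (logistic m%:R (ratr q)).
  by have := famw (pickle (q, m)); rewrite /fam pickleK.
apply: log_equi_sandwich; first exact: mom_ind.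
move=> e e0; have e4 : 0 < e / 4 by rewrite divr_gt0.
have [D D0 [Dp Dm]] := Ex_ind_continuous z e4.
(* The thresholds [q1] and [q2] will keep a distance [del] from [z] and from [z - D], respectively
   [z + D]. Four errors [eta <= e / 8] and two of [e / 4] then add up to [e]. *)
pose del := D / 3; have d0 : 0 < del by rewrite divr_gt0.
have [q1] : exists q : rat, ratr q \in `]z - 2 * del, z - del[.
  by apply: rat_in_itvoo; lra.
rewrite in_itv /= => /andP[q11 q12].
have [q2] : exists q : rat, ratr q \in `]z + del, z + 2 * del[.
  by apply: rat_in_itvoo; lra.
rewrite in_itv /= => /andP[q21 q22].
have D3 : D = 3 * del by rewrite /del; field.
near \oo => m.
pose eta : R := (1 + expR (m%:R * del))^-1.
have m0 : 0 <= m%:R :> R by [].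
have eta0 : 0 <= eta by rewrite invr_ge0 addr_ge0 // expR_ge0.
have etae : eta <= e / 8.
  have mm : 8 / e / del <= m%:R by near: m; exact: nbhs_infty_ger.
  have -> : e / 8 = (8 / e)^-1 by rewrite invf_div.
  rewrite lef_pV2 ?posrE ?addr_gt0 ?expR_gt0 ?divr_gt0 //.
  have := expR_ge1Dx (m%:R * del); rewrite ler_pdivrMr // in mm.
  by move: (expR _) => E hE; lra.
exists (fun t => logistic m%:R (ratr q1) t - eta), (fun t => logistic m%:R (ratr q2) t + eta).
have [eq1 eq2] := (eqv q1 m, eqv q2 m).
split.
- exact: log_equiB (log_equi_cst _ _).
- exact: log_equiD (log_equi_cst _ _).
- move=> t; rewrite indNyE; have [tz|tz] := lerP t z; apply/andP; split => /=.
  + by have := logistic_le1 m%:R (ratr q1) t; lra.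
  + have : t <= ratr q2 - del by lra.
    by move=> /(logistic_low m0); rewrite -/eta; lra.
  + have : ratr q1 + del <= t by lra.
    by move=> /(logistic_high m0); rewrite -/eta; lra.
  + by have := logistic_ge0 m%:R (ratr q2) t; lra.
have E1 : Ex N (ind (z - D)) <= Ex N (fun t => logistic m%:R (ratr q1) t + eta).
  apply: Ex_le; [exact: mom_ind|exact: mom_add eq1.1 (mom_cst _ _)|] => t.
  rewrite indNyE; have [tz|tz] := lerP t (z - D) => /=; last first.
    by have := logistic_ge0 m%:R (ratr q1) t; lra.
  have : t <= ratr q1 - del by lra.
  by move=> /(logistic_low m0); rewrite -/eta; lra.
have E2 : Ex N (fun t => logistic m%:R (ratr q2) t - eta) <= Ex N (ind (z + D)).
  apply: Ex_le; [exact: mom_sub eq2.1 (mom_cst _ _)|exact: mom_ind|] => t.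
  rewrite indNyE; have [tz|tz] := lerP t (z + D) => /=.
    by have := logistic_le1 m%:R (ratr q2) t; lra.
  have : ratr q2 + del <= t by lra.
  by move=> /(logistic_high m0); rewrite -/eta; lra.
move: E1 E2; have mc := mom_cst N eta.
rewrite (ExD eq1.1 mc) (ExD eq2.1 mc) (ExB eq1.1 mc) (ExB eq2.1 mc) Ex_cst.
by clear D3 q11 q12 q21 q22; lra.
Unshelve. all: by end_near. Qed.

End AlmostSureEquidistribution.

(** * Covariances of the autoregression *)

Section LinearSpan.
Context d (T : measurableType d) (R : realType) (P : probability T R).
Variable xi : int -> {RV P >-> R}.
Hypothesis xi_gauss : gaussian_process xi.
Hypothesis xi_centered : centered xi.

Definition linear_span (V : T -> R) :=
  exists (s : seq int) (a : int -> R), V = (fun w => \sum_(t <- s) a t * xi t w).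

(** A combination may list an index several times. Counting multiplicities over a duplicate-free
    list gives the sum of two combinations a single coefficient function. *)
Let sum_multiplicity (F : int -> R) (s u : seq int) : uniq u -> {subset s <= u} ->
  \sum_(t <- s) F t = \sum_(t <- u) (count_mem t s)%:R * F t.
Proof.
move=> uu; elim: s => [|x s IHs] sub.
  by rewrite big_nil big1_seq // => t _; rewrite mul0r.
rewrite big_cons IHs => [|t ts]; last by apply: sub; rewrite inE ts orbT.
have xu : x \in u by apply: sub; rewrite inE eqxx.
rewrite (bigD1_seq x) //= [in RHS](bigD1_seq x) //= eqxx addrA; congr (_ + _).
  by rewrite natrD mulrDl mul1r.
by apply: eq_bigr => t tx; rewrite eq_sym (negbTE tx).
Qed.

Lemma mean_xi t : Ex P (xi t) = 0.
Proof. by have := xi_centered t; rewrite /Ex /Rintegral unlock => ->. Qed.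

Lemma linear_span_xi t : linear_span (xi t).
Proof.
exists [:: t], (fun=> 1); apply/funext => w.
by rewrite big_seq1 mul1r.
Qed.

Lemma mom_xi t : mom P (xi t).
Proof.
have [] // := @gaussian_ibp_trig _ _ _ P (xi t); last exact: mean_xi.
have := xi_gauss [:: t] (fun=> 1); congr gaussian; apply/funext => w.
by rewrite big_seq1 mul1r.
Qed.

Lemma linear_span_gaussian : gaussian_space P linear_span.
Proof.
have mom_span s (a : int -> R) : mom P (fun w => \sum_(t <- s) a t * xi t w).
  by apply: mom_sum => t; apply: mom_scal; exact: mom_xi.
split.
- move=> U V c [s [a ->]] [s' [a' ->]].
  exists (undup (s ++ s')), (fun t => (count_mem t s)%:R * a t + c * ((count_mem t s')%:R * a' t)).
  apply/funext => w.
  rewrite (@sum_multiplicity _ s (undup (s ++ s'))) ?undup_uniq //; last first.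
    by move=> t ts; rewrite mem_undup mem_cat ts.
  rewrite (@sum_multiplicity _ s' (undup (s ++ s'))) ?undup_uniq //; last first.
    by move=> t ts; rewrite mem_undup mem_cat ts orbT.
  by rewrite mulr_sumr -big_split /=; apply: eq_bigr => t _; ring.
- by move=> V [s [a ->]]; exact: mom_meas (mom_span s a).
- by move=> V [s [a ->]]; exact: xi_gauss.
- move=> V [s [a ->]]; rewrite Ex_sum; last by move=> t; apply: mom_scal; exact: mom_xi.
  by rewrite big1 // => t _; rewrite ExZ ?mean_xi ?mulr0 //; exact: mom_xi.
Qed.

Hypothesis xi_stat : stationary xi.

(** Stationarity is an equality of laws of tuples; for pairs it transfers the integral of the
    product of the two coordinates. *)
Lemma Ex_xi_xi s t : Ex P (fun w => xi s w * xi t w) = autocov P xi (t - s).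
Proof.
pose f (y : 2.-tuple R) := tnth y ord0 * tnth y ord_max.
have mf : measurable_fun [set: 2.-tuple R] (EFin \o f).
  by apply/measurable_EFinP; apply: measurable_funM; exact: measurable_tnth.
pose ix (a b : int) (i : 'I_2) : int := if i == ord0 then a else b.
pose Y a b w : 2.-tuple R := [tuple xi (ix a b i) w | i < 2].
have mY a b : measurable_fun [set: T] (Y a b).
  by apply/measurable_fun_tnthP => i; rewrite (_ : _ \o _ = xi (ix a b i)) //;
    apply/funext => w; rewrite /= tnth_mktuple.
have fY a b w : f (Y a b w) = xi a w * xi b w by rewrite /f !tnth_mktuple.
have E a b : Ex P (fun w => xi a w * xi b w) =
    fine (\int[pushforward P (Y a b)]_y (f y)%:E).
  rewrite (integral_pushforward (mY a b) mf) ?preimage_setT //.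
    by rewrite /Ex /Rintegral; congr fine; apply: eq_integral => w _; rewrite /= fY.
  rewrite (_ : _ \o _ = EFin \o (fun w => xi a w * xi b w)); last first.
    by apply/funext => w; rewrite /= fY.
  by apply: mom_integrable; apply: mom_mul; exact: mom_xi.
rewrite /autocov unlock -[RHS]/(Ex P (fun w => xi 0 w * xi (t - s) w)) !E.
congr fine; apply: eq_measure_integral => A mA _.
have := @xi_stat 2 (ix 0 (t - s)) s A mA.
congr (_ = _); congr (pushforward P _ A); apply/funext => w; apply: eq_mktuple => i.
by rewrite /ix; case: (i == ord0); rewrite ?add0r ?subrK.
Qed.

End LinearSpan.

Lemma eventually_power_bound {R : realType} (u : nat -> R) (c b : R) (J : nat) : 0 <= c ->
  (forall j, (J <= j)%N -> u j <= c * j.+1%:R `^ (- b)) ->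
  exists2 C, 1 <= C & forall j, u j <= C * j.+1%:R `^ (- b).
Proof.
move=> c0 hu; pose S := \sum_(j < J) `|u j| * j.+1%:R `^ b.
have S0 : 0 <= S by apply: sumr_ge0 => j _; rewrite mulr_ge0 ?powR_ge0.
exists (1 + c + S) => [|j]; first by lra.
have p0 : 0 < j.+1%:R `^ (- b) by rewrite powR_gt0.
have [Jj|jJ] := leqP J j.
  by apply: le_trans (hu j Jj) _; rewrite ler_pM2r //; lra.
apply: (@le_trans _ _ (S * j.+1%:R `^ (- b))); last by rewrite ler_pM2r //; lra.
have : `|u j| * j.+1%:R `^ b <= S.
  rewrite /S (bigD1 (Ordinal jJ)) //= lerDl.
  by apply: sumr_ge0 => i _; rewrite mulr_ge0 ?powR_ge0.
rewrite -(ler_pM2r p0) -mulrA -powRD; last by rewrite pnatr_eq0 implybT.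
by rewrite subrr powRr0 mulr1; apply: le_trans; exact: ler_norm.
Qed.

(* The slowly varying factor is absorbed by giving up [3/4 - H] of the exponent. *)
Lemma lrd_decay {R : realType} (H : R) (rho : int -> R) : H < 3 / 4 ->
  lrd_covariance H rho -> exists (u : nat -> R) (C : R),
  [/\ forall k, rho k = u `|k|%N, u 0%N = 1, forall j, 0 < u j, 1 <= C &
      forall j, u j <= C * j.+1%:R `^ (- (5 / 4 - H))].
Proof.
move=> H34 [H12 [H1 [L [Lpos Lsv _ [r0 rk]]]]].
have rE k : rho k = rho `|k|%N.
  have [->|k0] := eqVneq k 0; first by [].
  have k1 : (`|k|%N : int) != 0 by rewrite eqz_nat absz_eq0.
  by rewrite !rk.
have upos j : 0 < rho j%:Z.
  have [->|j0] := eqVneq j 0%N; first by rewrite r0.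
  rewrite rk //= mulr_gt0 ?powR_gt0 ?Lpos ?ltr0n ?lt0n //.
(* This choice makes [2 H - 2 + del] equal to [- (5 / 4 - H)]. *)
pose del := 3 / 4 - H; have del0 : 0 < del by rewrite subr_gt0.
have [M [_ hM]] := Lsv del del0.
pose x0 := Num.max M 0 + 1.
have x00 : 0 < x0 by rewrite ltr_wpDl // le_max lexx orbT.
have Mx0 : M < x0 by rewrite (le_lt_trans (_ : M <= Num.max M 0)) ?ltrDl // le_max lexx.
pose c := x0 `^ (- del) * L x0.
have c0 : 0 <= c by rewrite mulr_ge0 ?powR_ge0 // ltW // Lpos.
have [J hJ] : exists J : nat, (0 < J)%N /\ x0 <= J%:R.
  near \oo => J; exists J; split; first by near: J; exists 1%N.
  by near: J; exact: nbhs_infty_ger.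
have key (j : nat) : (J <= j)%N -> rho j <= 2 * c * j.+1%:R `^ (- (5 / 4 - H)).
  move=> Jj; have j0 : (0 < j)%N by exact: leq_trans hJ.1 Jj.
  have jR : 0 < j%:R :> R by rewrite ltr0n.
  have xj : x0 <= j%:R by apply: le_trans hJ.2 _; rewrite ler_nat.
  rewrite rk /=; last by case: (j) j0.
  have h1 : j%:R `^ (- del) * L j%:R <= c.
    by apply: hM => //; rewrite in_itv /= ?Mx0 ?(lt_le_trans Mx0).
  have {}h1 : L j%:R <= c * j%:R `^ del.
    have p0 : 0 < j%:R `^ del :> R by rewrite powR_gt0.
    rewrite -(ler_pM2l p0) mulrA -powRD in h1; last by rewrite (gt_eqF jR) implybT.
    by rewrite subrr powRr0 mul1r mulrC in h1.
  apply: (@le_trans _ _ (c * j%:R `^ del * j%:R `^ (2 * H - 2))).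
    by rewrite ler_pM2r // powR_gt0.
  rewrite -mulrA -powRD; last by rewrite (gt_eqF jR) implybT.
  rewrite (_ : del + _ = - (5 / 4 - H)); last by rewrite /del; lra.
  (* The factor 2 pays for the passage from [j] to [j + 1], as [j + 1 <= 2 j] and the exponent is at
     most 1. *)
  rewrite [leRHS](_ : _ = c * (j.+1%:R `^ (- (5 / 4 - H)) * 2)); last by ring.
  apply: ler_wpM2l => //.
  have b0 : 0 < 5 / 4 - H by lra.
  have b1 : 5 / 4 - H <= 1 by lra.
  have p1 : 0 < j%:R `^ (5 / 4 - H) :> R by rewrite powR_gt0.
  have p2 : 0 < j.+1%:R `^ (5 / 4 - H) :> R by rewrite powR_gt0.
  rewrite !powRN [leRHS]mulrC ler_pdivlMr // mulrC ler_pdivrMr //.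
  apply: (@le_trans _ _ ((2 * j%:R) `^ (5 / 4 - H))).
    apply: ge0_ler_powR; rewrite ?nnegrE ?ler0n ?(ltW b0) // ?mulr_ge0 //.
    by rewrite -natrM ler_nat mul2n -addnn -add1n leq_add2r.
  rewrite powRM ?ler0n // ler_pM2r //.
  by rewrite -[leRHS]powRr1 // ler_powR // ler1n.
have [C C1 hC] := eventually_power_bound (mulr_ge0 (ler0n R 2) c0) key.
exists (fun j => rho j%:Z), C; split=> //.
Unshelve. all: by end_near. Qed.

(** * Covariances of truncated moving averages *)

Section ArCovariance.
Context {R : realType}.

Lemma geometric_sum_le (x : R) n : 0 <= x < 1 -> \sum_(j < n) x ^+ j <= (1 - x)^-1.
Proof.
move=> /andP[x0 x1]; have y0 : 0 < 1 - x by lra.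
rewrite -[leRHS]mul1r ler_pdivlMr // -opprB mulrN mulrC -subrX1 opprB.
by rewrite lerBlDr lerDl exprn_ge0.
Qed.

Lemma arith_geometric_sum_le (x : R) n : 0 <= x < 1 ->
  \sum_(j < n) x ^+ j * j.+1%:R <= (1 - x) ^- 2.
Proof.
move=> /andP[x0 x1]; have y0 : 0 < 1 - x by lra.
rewrite -[leRHS]mul1r ler_pdivlMr ?exprn_gt0 //.
have -> : (\sum_(j < n) x ^+ j * j.+1%:R) * (1 - x) ^+ 2 = 1 - x ^+ n * (1 + n%:R * (1 - x)).
  elim: n => [|n IHn]; first by rewrite big_ord0; ring.
  by rewrite big_ord_recr /= mulrDl IHn (exprS x n) -natr1; ring.
by rewrite lerBlDr lerDl mulr_ge0 ?exprn_ge0 // addr_ge0 ?mulr_ge0 // ltW.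
Qed.

Variables (rho : int -> R) (u : nat -> R) (C b : R).
Hypothesis rhoE : forall k, rho k = u `|k|%N.
Hypothesis u0 : u 0%N = 1.
Hypothesis u_gt0 : forall j, 0 < u j.
Hypothesis C1 : 1 <= C.
Hypothesis b01 : 0 <= b <= 1.
Hypothesis u_le : forall j, u j <= C * j.+1%:R `^ (- b).

Variable x : R.
Hypothesis x01 : 0 < x < 1.

Let x0 : 0 <= x. Proof. by case/andP: x01 => /ltW. Qed.
Let x1 : x < 1. Proof. by case/andP: x01. Qed.
Let x01' : 0 <= x < 1. Proof. by rewrite x0 x1. Qed.
Let y0 : 0 < 1 - x. Proof. by rewrite subr_gt0. Qed.

(* Covariance at lag [k] of the series [\sum_j x ^+ j * xi (t - j)] cut after [n] and
   after [m] terms. *)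
Definition arcov (n m : nat) (k : int) : R :=
  \sum_(i < n) \sum_(j < m) x ^+ (i + j) * rho (k + i%:Z - j%:Z).

Let term_ge0 (i j : nat) (k : int) : 0 <= x ^+ (i + j) * rho (k + i%:Z - j%:Z).
Proof. by rewrite mulr_ge0 ?exprn_ge0 // rhoE ltW. Qed.

Lemma arcov_ge0 n m k : 0 <= arcov n m k.
Proof. by apply: sumr_ge0 => i _; apply: sumr_ge0 => j _; exact: term_ge0. Qed.

Lemma arcovC n m k : arcov n m (- k) = arcov m n k.
Proof.
rewrite /arcov exchange_big /=; apply: eq_bigr => j _; apply: eq_bigr => i _.
by rewrite addnC !rhoE -abszN; congr (_ * u `|_|%N); ring.
Qed.

Let sum_ord_le (F : nat -> R) n n' : (forall i, 0 <= F i) -> (n <= n')%N ->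
  \sum_(i < n) F i <= \sum_(i < n') F i.
Proof.
move=> F0 nn; rewrite -!(big_mkord xpredT F) (@big_cat_nat _ _ _ n _ n') //=.
by rewrite lerDl sumr_ge0.
Qed.

Lemma arcov_le n m n' m' k : (n <= n')%N -> (m <= m')%N -> arcov n m k <= arcov n' m' k.
Proof.
move=> nn mm; apply: (@le_trans _ _ (arcov n m' k)).
  apply: ler_sum => i _.
  exact: (@sum_ord_le (fun j => x ^+ (i + j) * rho (k + i%:Z - j%:Z))).
apply: (@sum_ord_le (fun i => \sum_(j < m') x ^+ (i + j) * rho (k + i%:Z - j%:Z))) => // i.
by apply: sumr_ge0 => j _; exact: term_ge0.
Qed.

Lemma arcov_diag_ge1 n : 1 <= arcov n.+1 n.+1 0.
Proof.
apply: le_trans (arcov_le 0 (ltn0Sn n) (ltn0Sn n)).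
by rewrite /arcov !big_ord1 addr0 expr0 mul1r rhoE u0.
Qed.

(** For the shifted lag [l = k + i - j] one has [|k| + 1 <= (|l| + 1) (i + 1) (j + 1)], so with
    [b <= 1] the shift costs at most a factor [(i + 1) (j + 1)], summable against [x^(i+j)]. *)
Lemma arcov_decay n m k :
  arcov n m k <= C * (1 - x) ^- 4 * (`|k|%N).+1%:R `^ (- b).
Proof.
have [b0 b1] := andP b01.
set B := (`|k|%N).+1%:R `^ (- b).
have B0 : 0 <= B by exact: powR_ge0.
have key (i j : nat) : rho (k + i%:Z - j%:Z) <= C * B * (i.+1%:R * j.+1%:R).
  set l := k + _ - _; rewrite rhoE.
  apply: le_trans (u_le _) _; rewrite -mulrA; apply: ler_wpM2l; first exact: le_trans ler01 C1.
  have h : ((`|k|%N).+1 <= (`|l|%N).+1 * (i.+1 * j.+1))%N.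
    apply: (@leq_trans (`|l| + i + j).+1%N); first by rewrite /l; lia.
    nia.
  have p1 : 0 < (`|l|%N).+1%:R `^ b :> R by rewrite powR_gt0.
  have p2 : 0 < (`|k|%N).+1%:R `^ b :> R by rewrite powR_gt0.
  rewrite /B !powRN [leRHS]mulrC ler_pdivlMr // mulrC ler_pdivrMr //.
  apply: (@le_trans _ _ (((`|l|%N).+1%:R * (i.+1 * j.+1)%:R) `^ b)).
    by apply: ge0_ler_powR; rewrite ?nnegrE ?ler0n -?natrM ?ler_nat.
  rewrite powRM ?ler0n // mulrC -natrM ler_pM2r //.
  by rewrite -[leRHS]powRr1 // ler_powR // ler1n.
apply: (@le_trans _ _ (\sum_(i < n) \sum_(j < m) C * B * ((x ^+ i * i.+1%:R) * (x ^+ j * j.+1%:R)))).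
  apply: ler_sum => i _; apply: ler_sum => j _; rewrite exprD.
  rewrite [leRHS](_ : _ = x ^+ i * x ^+ j * (C * B * (i.+1%:R * j.+1%:R))); last by ring.
  by apply: ler_wpM2l => //; rewrite mulr_ge0 ?exprn_ge0.
under eq_bigr do rewrite -mulr_sumr -mulr_sumr mulrA.
rewrite -mulr_suml -mulr_sumr [leRHS]mulrAC -(mulrA (C * B)); apply: ler_wpM2l.
  by rewrite mulr_ge0 // (le_trans ler01).
rewrite (_ : (1 - x) ^- 4 = (1 - x) ^- 2 * (1 - x) ^- 2); last first.
  by rewrite -invfM -exprD.
by apply: ler_pM; rewrite ?arith_geometric_sum_le // ?sumr_ge0 // => i _; rewrite mulr_ge0 ?exprn_ge0.
Qed.

Definition arlim k : R := limn (fun n => arcov n n k).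

(** Positivity of the covariances makes the truncations increase. *)
Lemma cvg_arcov k : arcov n n k @[n --> \oo] --> arlim k.
Proof.
apply: nondecreasing_is_cvgn; first by move=> n m nm; exact: arcov_le.
by exists (C * (1 - x) ^- 4 * (`|k|%N).+1%:R `^ (- b)) => _ [n _ <-]; exact: arcov_decay.
Qed.

Lemma arcov_le_arlim n m k : arcov n m k <= arlim k.
Proof.
apply: (limr_ge (cvgP _ (@cvg_arcov k))).
near=> p; apply: arcov_le; near: p; exact: nbhs_infty_ge.
Unshelve. all: by end_near. Qed.

(** [X_s] and [X_t] contain different numbers of noise terms, so truncations of unequal length
    occur; they are squeezed between the equal ones and the limit. *)
Lemma cvg_arcov_shift q k : arcov n (n + q) k @[n --> \oo] --> arlim k.
Proof.
apply: (squeeze_cvgr _ (@cvg_arcov k) (cvg_cst (arlim k))); near=> n.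
by rewrite arcov_le ?leq_addr // arcov_le_arlim.
Unshelve. all: by end_near. Qed.

Lemma arlimN k : arlim (- k) = arlim k.
Proof. by congr (limn _); apply/funext => n; rewrite arcovC. Qed.

End ArCovariance.

(** Cauchy's criterion with integer quantifiers only, so that the convergence set of a sequence of
    measurable functions is measurable by countable operations. *)
Lemma cvgn_cauchyP {R : realType} (s : nat -> R) :
  cvgn s <-> forall k, exists N, forall n, `|s (N + n)%N - s N| <= k.+1%:R^-1.
Proof.
split=> [cs k|H].
  have h0 : 0 < (2 * k.+1%:R)^-1 :> R by rewrite invr_gt0 mulr_gt0.
  have /cvgrPdist_le/(_ _ h0) [N _ hN] := cs.
  exists N => n; have h1 := hN N (leqnn N); have h2 := hN (N + n)%N (leq_addr n N).
  rewrite (_ : s _ - s N = (limn s - s N) - (limn s - s (N + n)%N)); last by ring.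
  apply: le_trans (ler_normB _ _) _; apply: le_trans (lerD h1 h2) _.
  by rewrite invfM; move: (k.+1%:R^-1) => z; lra.
apply/cauchy_cvgP; apply/cauchyP => e e0.
have [k hk] : exists k : nat, k.+1%:R^-1 < e.
  near \oo => k; exists k; near: k; exact: near_infty_natSinv_lt (PosNum e0).
have [N hN] := H k; exists (s N), N => // n /= Nn.
rewrite /ball /= distrC; apply: le_lt_trans hk.
by rewrite -(subnKC Nn) hN.
Unshelve. all: by end_near. Qed.

(** No convergence is assumed: off the measurable set of convergence [limn] takes the constant
    default value [point]. *)
Lemma measurable_fun_limn_real d (T : measurableType d) {R : realType} (S : nat -> T -> R) :
  (forall n, measurable_fun [set: T] (S n)) ->
  measurable_fun [set: T] (fun w => limn (S ^~ w)).
Proof.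
move=> mS.
pose C := [set w | cvgn (S ^~ w)].
have mC : measurable C.
  have -> : C = \bigcap_k \bigcup_N \bigcap_n
      [set w | `|S (N + n)%N w - S N w| <= k.+1%:R^-1].
    apply/seteqP; split=> w /=.
      move=> /cvgn_cauchyP H k _; have [N hN] := H k; exists N => // n _ /=; exact: hN.
    move=> H; apply/cvgn_cauchyP => k; have [N _ hN] := H k I; exists N => n; exact: hN.
  apply: bigcapT_measurable => k; apply: bigcupT_measurable => N; apply: bigcapT_measurable => n.
  rewrite -[X in measurable X]setTI; apply: measurable_fun_le => //.
  by apply: measurableT_comp => //; apply: measurable_funB.
rewrite -(setUv C); apply/measurable_funU => //; first exact: measurableC.
split.
  apply: (measurable_fun_cvg (h := S)) => [n|w]; last by [].
  exact: measurable_funS (mS n).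
apply: (eq_measurable_fun (fun=> point)) => [w|]; last exact: measurable_cst.
by rewrite inE /C /= => /dvgP ->.
Qed.

(** * The stationary solution *)

Section StationarySolution.
Context d (T : measurableType d) (R : realType) (P : probability T R).
Variable xi : int -> {RV P >-> R}.
Hypothesis xi_gauss : gaussian_process xi.
Hypothesis xi_centered : centered xi.
Hypothesis xi_stat : stationary xi.
Variables (u : nat -> R) (C b : R).
Hypothesis rhoE : forall k, autocov P xi k = u `|k|%N.
Hypothesis u0 : u 0%N = 1.
Hypothesis u_gt0 : forall j, 0 < u j.
Hypothesis C1 : 1 <= C.
Hypothesis b01 : 0 <= b <= 1.
Hypothesis u_le : forall j, u j <= C * j.+1%:R `^ (- b).
Variable x : R.
Hypothesis x01 : 0 < x < 1.

Let rho := autocov P xi.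
Let x0 : 0 <= x. Proof. by case/andP: x01 => /ltW. Qed.
Let x01' : 0 <= x < 1. Proof. by case/andP: x01 => /ltW -> ->. Qed.
Let mxi t : mom P (xi t) := mom_xi xi_gauss xi_centered t.

Let ma (t : int) (n : nat) (w : T) := series (fun j : nat => x ^+ j * xi (t - j%:Z) w) n.
Let mabs (t : int) (n : nat) (w : T) := series (fun j : nat => `|x ^+ j * xi (t - j%:Z) w|) n.

Let mom_ma t n : mom P (ma t n).
Proof. by apply: mom_sum => j; apply: mom_scal. Qed.

Let mom_mabs t n : mom P (mabs t n).
Proof. by apply: mom_sum => j; apply: mom_abs; apply: mom_scal. Qed.

Lemma Ex_partial_ar1 s t n m :
  Ex P (fun w => series (fun j : nat => x ^+ j * xi (s - j%:Z) w) n *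
                 series (fun j : nat => x ^+ j * xi (t - j%:Z) w) m) =
  arcov rho x n m (t - s).
Proof.
have -> : (fun w => ma s n w * ma t m w) = (fun w => \sum_(i < n) \sum_(j < m)
    x ^+ (i + j) * (xi (s - i%:Z) w * xi (t - j%:Z) w)).
  apply/funext => w; rewrite /ma /series /= !big_mkord mulr_suml.
  apply: eq_bigr => i _; rewrite mulr_sumr; apply: eq_bigr => j _.
  by rewrite exprD; ring.
have mm (i j : nat) : mom P (fun w => x ^+ (i + j) * (xi (s - i%:Z) w * xi (t - j%:Z) w)).
  by apply: mom_scal; apply: mom_mul.
rewrite Ex_sum => [|i]; last by apply: mom_sum.
apply: eq_bigr => i _; rewrite Ex_sum //; apply: eq_bigr => j _.
rewrite ExZ; last exact: mom_mul.
by rewrite (Ex_xi_xi xi_gauss xi_centered xi_stat); congr (_ * autocov _ _ _); ring.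
Qed.

Let Ex_mabs2 t n : Ex P (fun w => mabs t n w ^+ 2) <= (1 - x) ^- 2.
Proof.
have mm (i j : nat) : mom P (fun w => x ^+ i * (x ^+ j * (`|xi (t - i%:Z) w| * `|xi (t - j%:Z) w|))).
  by do 2!apply: mom_scal; apply: mom_mul; apply: mom_abs.
have -> : (fun w => mabs t n w ^+ 2) = (fun w => \sum_(i < n) \sum_(j < n)
    x ^+ i * (x ^+ j * (`|xi (t - i%:Z) w| * `|xi (t - j%:Z) w|))).
  apply/funext => w; rewrite expr2 /mabs /series /= !big_mkord mulr_suml.
  apply: eq_bigr => i _; rewrite mulr_sumr; apply: eq_bigr => j _.
  by rewrite !normrM !(ger0_norm (exprn_ge0 _ x0)); ring.
rewrite Ex_sum => [|i]; last by apply: mom_sum.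
apply: (@le_trans _ _ ((\sum_(i < n) x ^+ i) * (\sum_(j < n) x ^+ j))).
  rewrite mulr_suml; apply: ler_sum => i _; rewrite mulr_sumr Ex_sum //.
  apply: ler_sum => j _; rewrite !ExZ; [|by apply: mom_mul; apply: mom_abs|
    by apply: mom_scal; apply: mom_mul; apply: mom_abs].
  rewrite mulrA ler_piMr ?mulr_ge0 ?exprn_ge0 //.
  have E s : Ex P (fun w => xi s w ^+ 2) = 1.
    by under eq_fun do rewrite expr2; rewrite (Ex_xi_xi xi_gauss xi_centered xi_stat) subrr rhoE u0.
  have ms s : mom P (fun w => 2^-1 * xi s w ^+ 2) by apply: mom_scal; exact: mom_exp.
  apply: (@le_trans _ _ (Ex P (fun w => 2^-1 * xi (t - i%:Z) w ^+ 2 + 2^-1 * xi (t - j%:Z) w ^+ 2))).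
    apply: Ex_le; [by apply: mom_mul; apply: mom_abs|exact: mom_add|] => w.
    rewrite -(normr_idP (sqr_ge0 (xi (t - i%:Z) w))) -(normr_idP (sqr_ge0 (xi (t - j%:Z) w))) !normrX.
    move: `|_| `|_| => p q; have := sqr_ge0 (p - q); rewrite sqrrB; lra.
  rewrite ExD ?ms // !ExZ; [|exact: mom_exp|exact: mom_exp].
  by rewrite !E; lra.
rewrite -exprVn expr2; apply: ler_pM; rewrite ?sumr_ge0 ?geometric_sum_le // => i _; exact: exprn_ge0.
Qed.

(** The squared sum of absolute values, possibly infinite. It is integrable by monotone convergence;
    hence it dominates the squared partial sums and, being finite almost everywhere, yields absolute
    convergence. *)
Let dom t w : \bar R := limn (fun n => (mabs t n w ^+ 2)%:E).

Let mabs_nd t w : {homo mabs t ^~ w : n m / (n <= m)%N >-> n <= m}.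
Proof.
by apply: nondecreasing_series => n _ _; exact: normr_ge0.
Qed.

Let mabs_ge0 t n w : 0 <= mabs t n w.
Proof. by apply: sumr_ge0. Qed.

Let sq_nd t w : {homo (fun n => (mabs t n w ^+ 2)%:E) : n m / (n <= m)%N >-> (n <= m)%E}.
Proof.
by move=> n m nm; rewrite lee_fin; apply: lerXn2r; rewrite ?nnegrE ?mabs_ge0 // mabs_nd.
Qed.

Let le_dom t n w : ((mabs t n w ^+ 2)%:E <= dom t w)%E.
Proof.
apply: lime_ge; first exact: ereal_nondecreasing_is_cvgn (@sq_nd t w).
by near=> m; apply: sq_nd; near: m; exact: nbhs_infty_ge.
Unshelve. all: by end_near. Qed.

Let measS t n : measurable_fun [set: T] (fun w => (mabs t n w ^+ 2)%:E).
Proof.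
by apply/measurable_EFinP; exact: mom_meas (mom_exp 2 (mom_mabs t n)).
Qed.

Let dom_integrable t : P.-integrable [set: T] (dom t).
Proof.
have meas : measurable_fun [set: T] (dom t).
  rewrite (_ : dom t = (fun w => limn_esup (fun n => (mabs t n w ^+ 2)%:E))).
    by apply: measurable_fun_limn_esup => n; exact: measS.
  apply/funext => w; rewrite is_cvg_limn_esupE //.
  exact: ereal_nondecreasing_is_cvgn (@sq_nd t w).
apply/integrableP; split=> //.
have -> : (\int[P]_w `|dom t w| = \int[P]_w dom t w)%E.
  apply: eq_integral => w _; rewrite gee0_abs //.
  by apply: le_trans (le_dom t 0 w); rewrite lee_fin sqr_ge0.
rewrite monotone_convergence //; last first.
  by move=> n w _; rewrite lee_fin sqr_ge0.
apply: (@le_lt_trans _ _ ((1 - x) ^- 2)%:E); last exact: ltry.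
apply: lime_le.
  apply: ereal_nondecreasing_is_cvgn => n m nm.
  apply: ge0_le_integral => //; try by move=> w _; rewrite lee_fin sqr_ge0.
  by move=> w _; exact: sq_nd.
near=> n; have := Ex_mabs2 t n; rewrite -lee_fin; apply: le_trans.
rewrite /Ex /Rintegral fineK //.
apply: integrable_fin_num => //.
exact: (mom_integrable (mom_exp 2 (mom_mabs t n))).
Unshelve. all: by end_near. Qed.

Let ma_le t n w : `|ma t n w| <= mabs t n w.
Proof. by apply: le_trans (ler_norm_sum _ _ _) _; exact: lexx. Qed.

Let cvg_ma t w : dom t w \is a fin_num -> ma t n w @[n --> \oo] --> stationary_ar1 xi x t w.
Proof.
move=> fd; apply: normed_cvg.
apply: nondecreasing_is_cvgn; first exact: mabs_nd.
exists (fine (dom t w) + 1) => _ [n _ <-].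
have := le_dom t n w; rewrite -(fineK fd) lee_fin => h.
suff : mabs t n w <= fine (dom t w) + 1 by [].
have := sqr_ge0 (mabs t n w - 1); have := sqr_ge0 (mabs t n w).
by rewrite sqrrB mulr1 expr1n -mulr_natl; lra.
Qed.

(** Dominated convergence for products of partial sums, whose expectations are the truncated
    covariances. *)
Lemma autocov_stationary_ar1 k : autocov P (stationary_ar1 xi x) k = arlim rho x k.
Proof.
have mY t : measurable_fun [set: T] (stationary_ar1 xi x t).
  by apply: (@measurable_fun_limn_real _ _ _ (ma t)) => n; exact: mom_meas.
have [] := @dominated_convergence _ _ _ P setT measurableT
  (fun n w => (ma 0 n w * ma k n w)%:E)
  (fun w => (stationary_ar1 xi x 0 w * stationary_ar1 xi x k w)%:E)
  (fun w => dom 0 w + dom k w)%E.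
- by move=> n; apply/measurable_EFinP; exact: mom_meas (mom_mul (mom_ma 0 n) (mom_ma k n)).
- by apply/measurable_EFinP; apply: measurable_funM.
- have := integrable_ae measurableT (dom_integrable 0).
  apply: filterS2 (integrable_ae measurableT (dom_integrable k)) => w /(_ I) fk /(_ I) f0 _.
  by apply: cvg_EFin; [exact: nearW|apply: cvgM; exact: cvg_ma].
- exact: integrableD.
- apply: aeW => w n _; rewrite abse_EFin.
  apply: (@le_trans _ _ (mabs 0 n w ^+ 2 + mabs k n w ^+ 2)%:E); last first.
    by rewrite EFinD leeD.
  rewrite lee_fin normrM; have h1 := ma_le 0 n w; have h2 := ma_le k n w.
  apply: (@le_trans _ _ (mabs 0 n w * mabs k n w)); first exact: ler_pM.
  move: (mabs _ _ _) (mabs _ _ _) => p q.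
  by have := sqr_ge0 (p - q); have := sqr_ge0 p; have := sqr_ge0 q; rewrite sqrrB; lra.
move=> iY _ cv.
have c1 : Ex P (fun w => ma 0 n w * ma k n w) @[n --> \oo] --> autocov P (stationary_ar1 xi x) k.
  rewrite /autocov unlock; apply: fine_cvg; rewrite fineK; last exact: integrable_fin_num.
  exact: cv.
have c2 := @cvg_arcov _ _ _ _ _ rhoE u_gt0 C1 b01 u_le _ x01 k.
apply: (seq_cvg_unique c1 c2) => n.
by rewrite Ex_partial_ar1 subr0.
Qed.

End StationarySolution.

Section GramAr1.
Context d (T : measurableType d) (R : realType) (P : probability T R).
Variable xi : int -> {RV P >-> R}.
Hypothesis xi_gauss : gaussian_process xi.
Hypothesis xi_centered : centered xi.
Hypothesis xi_stat : stationary xi.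
Variable x : R.

Lemma ar1E n w : ar1 xi x n w = series (fun j : nat => x ^+ j * xi (n%:Z - j%:Z) w) n.
Proof.
elim: n => [|n IHn]; first by rewrite /series /= big_geq.
rewrite /series /= big_mkord big_ord_recl /= expr0 mul1r subr0 addrC; congr (_ + _).
rewrite IHn /series /= big_mkord mulr_sumr; apply: eq_bigr => j _.
by rewrite mulrA -exprS; congr (_ * xi _ w); rewrite /bump /=; lia.
Qed.

Lemma linear_span_ar1 n : linear_span xi (ar1 xi x n).
Proof.
have GS := linear_span_gaussian xi_gauss xi_centered.
elim: n => [|n IHn]; first exact: (GS_zero GS (linear_span_xi xi 0)).
have := GS_lin GS x (linear_span_xi xi n.+1%:Z) IHn.
by congr linear_span; apply/funext => w /=; rewrite addrC.
Qed.

(** The time index is shifted by one because [X_0 = 0] has variance 0, while every later variance is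
    at least 1. *)
Lemma gram_ar1 s t : gram P (fun n => ar1 xi x n.+1) s t =
  arcov (autocov P xi) x s.+1 t.+1 (t%:Z - s%:Z).
Proof.
rewrite /gram; under eq_fun do rewrite !ar1E.
rewrite (Ex_partial_ar1 xi_gauss xi_centered xi_stat).
by congr arcov; lia.
Qed.

End GramAr1.

(** * Sums of squared covariances *)

Section DistanceSums.
Context {R : realType}.

(** Lags to the left of [s] and lags to the right are counted separately. *)
Lemma sum_dist_le (F : nat -> R) s k : (forall j, 0 <= F j) ->
  \sum_(t < k) F `|t%:Z - s%:Z|%N <= \sum_(j < s.+1) F j + \sum_(j < k) F j.
Proof.
move=> F0; elim: s k => [|s IHs] k.
  by rewrite big_ord1; under eq_bigr do rewrite subr0 absz_nat; rewrite lerDr.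
case: k => [|k]; first by rewrite !big_ord0 addr0 sumr_ge0.
rewrite big_ord_recl [X in _ <= X + _]big_ord_recr [X in _ <= _ + X]big_ord_recr /=.
rewrite subn0.
rewrite (eq_bigr (fun i : 'I_k => F `|(i : nat)%:Z - s%:Z|%N)); last first.
  by move=> i _; congr F; rewrite /bump /=; lia.
by have := IHs k; have := F0 k; lra.
Qed.

Lemma sum_power_shift (c : R) n :
  \sum_(j < n) j.+1%:R `^ c = \sum_(1 <= k < n.+1) k%:R `^ c.
Proof. by rewrite big_add1 big_mkord. Qed.

Variables (b : R).
Hypothesis b1 : 2^-1 < b < 1.

Lemma sum_dist_power_row s k : (s < k)%N ->
  \sum_(t < k) (`|t%:Z - s%:Z|%N).+1%:R `^ (- b) <= 4 / (1 - b) * k%:R `^ (1 - b).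
Proof.
have [b2 b3] := andP b1; have c0 : 0 < 1 - b <= 1 by apply/andP; split; lra.
move=> sk; apply: (le_trans (@sum_dist_le (fun j => j.+1%:R `^ (- b)) s k _)).
  by move=> j; exact: powR_ge0.
have h : \sum_(j < k) j.+1%:R `^ (- b) <= 2 / (1 - b) * k%:R `^ (1 - b).
  rewrite sum_power_shift; have := sum_powR_le k c0.
  by rewrite (_ : 1 - b - 1 = - b) //; ring.
apply: (@le_trans _ _ (\sum_(j < k) j.+1%:R `^ (- b) + \sum_(j < k) j.+1%:R `^ (- b))).
  rewrite lerD2r -!(big_mkord xpredT (fun j => j.+1%:R `^ (- b))) [leRHS](@big_cat_nat _ _ _ s.+1) //=.
  by rewrite lerDl sumr_ge0 // => j _; exact: powR_ge0.
apply: le_trans (lerD h h) _; rewrite le_eqVlt; apply/orP; left; apply/eqP; field.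
by rewrite gt_eqF; case/andP: c0.
Qed.

Lemma sum_power_sqr n : \sum_(j < n) (j.+1%:R `^ (- b)) ^+ 2 <= 1 + (2 * b - 1)^-1.
Proof.
have [b2 b3] := andP b1; have c0 : 0 < 2 * b - 1 by lra.
have := sum_powR_tail n c0; rewrite -sum_power_shift; apply: le_trans.
rewrite le_eqVlt; apply/orP; left; apply/eqP; apply: eq_bigr => j _.
by rewrite -powR_mulrn ?powR_ge0 // -powRrM; congr (_ `^ _); ring.
Qed.

Lemma sum_dist_power_sqr s k :
  \sum_(t < k) ((`|t%:Z - s%:Z|%N).+1%:R `^ (- b)) ^+ 2 <= 2 * (1 + (2 * b - 1)^-1).
Proof.
apply: (le_trans (@sum_dist_le (fun j => (j.+1%:R `^ (- b)) ^+ 2) s k _)).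
  by move=> j; exact: sqr_ge0.
by have := sum_power_sqr s.+1; have := sum_power_sqr k; lra.
Qed.

End DistanceSums.

Section Tannery.
Context {R : realType}.

Lemma cvg_series_recl (h : nat -> R) (l : R) :
  series (fun m => h m.+1) n @[n --> \oo] --> l -> series h n @[n --> \oo] --> h 0%N + l.
Proof.
move=> hl; rewrite -cvg_shiftS.
apply: (@cvg_seq_ext _ (fun n => h 0%N + series (fun m => h m.+1) n) _ (h 0%N + l)) => // [|n].
  by apply: cvgD => //; exact: cvg_cst.
by rewrite /series /= !big_mkord big_ord_recl.
Qed.

Lemma nneseriesE (h : nat -> R) (l : R) :
  series h n @[n --> \oo] --> l -> (\sum_(i <oo) (h i)%:E = l%:E)%E.
Proof.
move=> hl; apply/cvg_lim => //.
have -> : (fun n => \sum_(0 <= i < n) (h i)%:E)%E = EFin \o series h.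
  by apply/funext => n /=; rewrite sumEFin.
by apply: cvg_EFin => //; exact: nearW.
Qed.

Lemma esum_int_even (h : int -> R) (l : R) : (forall k, 0 <= h k) ->
  (forall k, h (- k) = h k) ->
  series (fun m : nat => h m.+1%:Z) n @[n --> \oo] --> l ->
  fine (\esum_(k in [set: int]) (h k)%:E) = h 0 + 2 * l.
Proof.
move=> h0 hN hl; rewrite (esumID [set k : int | 0 <= k]); last by move=> k _; rewrite lee_fin.
rewrite (@reindex_esum _ _ _ [set: nat] _ Posz); last first.
  split; [by move=> n _|by move=> m n _ _ []|].
  by move=> [n|n] [_ /= n0] //; exists n.
rewrite (@reindex_esum _ _ _ [set: nat] _ Negz); last first.
  split; [by move=> n _; split|by move=> m n _ _ []|].
  by move=> [n|n] [_ /= n0]; [case: n0|exists n].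
rewrite -!nneseries_esumT; [|by move=> n; rewrite lee_fin..].
have e1 := cvg_series_recl (h := fun n => h n%:Z) hl.
rewrite (nneseriesE e1) (@nneseriesE (fun n => h (Negz n)) l) /=; first by ring.
by apply: cvg_seq_ext hl erefl _ => n; apply: eq_bigr => i _; rewrite NegzE hN.
Qed.

(** Dominated convergence for sums whose range grows with [n]: the head converges term by term and
    the tail is below that of [B]. *)
Lemma cvg_tannery (f : nat -> nat -> R) (g B : nat -> R) :
  (forall n m, (m < n)%N -> 0 <= f n m <= B m) -> cvgn (series B) ->
  (forall m, f n m @[n --> \oo] --> g m) ->
  cvgn (series g) /\ \sum_(m < n) f n m @[n --> \oo] --> limn (series g).
Proof.
move=> fB cB fg.
have gB m : 0 <= g m <= B m.
  apply/andP; split.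
    apply: (ler_cvg_to (cvg_cst 0) (fg m)); near=> n.
    have /andP[] // : 0 <= f n m <= B m by apply: fB; near: n; exact: nbhs_infty_gt.
  apply: (ler_cvg_to (fg m) (cvg_cst (B m))); near=> n.
  have /andP[] // : 0 <= f n m <= B m by apply: fB; near: n; exact: nbhs_infty_gt.
have B0 m : 0 <= B m by case/andP: (gB m) => /le_trans; apply.
have cg : cvgn (series g).
  apply: series_le_cvg cB => // m; [by case/andP: (gB m)|by case/andP: (gB m)].
split=> //; apply/cvgrPdist_le => e e0.
have e3 : 0 < e / 3 by rewrite divr_gt0.
have /cvgrPdist_le/(_ _ e3) [M1 _ hM1] := cg.
have /cvgrPdist_le/(_ _ e3) [M2 _ hM2] := cB.
pose M := maxn M1 M2.
have h1 : `|limn (series g) - series g M| <= e / 3 by apply: hM1; exact: leq_maxl.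
have h2 : `|limn (series B) - series B M| <= e / 3 by apply: hM2; exact: leq_maxr.
have fin : \sum_(m < M) f n m @[n --> \oo] --> series g M.
  rewrite /series /= big_mkord; elim: (M) => [|k IHk].
    by rewrite big_ord0; under eq_cvg do rewrite big_ord0; exact: cvg_cst.
  by rewrite big_ord_recr /=; under eq_cvg do rewrite big_ord_recr /=; exact: cvgD.
have /cvgrPdist_le/(_ _ e3) hf := fin.
near=> n.
have Mn : (M <= n)%N by near: n; exact: nbhs_infty_ge.
have h3 : `|series g M - \sum_(m < M) f n m| <= e / 3 by near: n.
have E : \sum_(m < n) f n m = \sum_(m < M) f n m + \sum_(M <= m < n) f n m.
  by rewrite -!(big_mkord xpredT (f n)) -big_cat_nat.
have h4 : 0 <= \sum_(M <= m < n) f n m <= e / 3.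
  apply/andP; split.
    by rewrite big_nat; apply: sumr_ge0 => m /andP[_ mn]; case/andP: (fB n m mn).
  apply: (@le_trans _ _ (\sum_(M <= m < n) B m)).
    by rewrite big_nat [leRHS]big_nat; apply: ler_sum => m /andP[_ mn]; case/andP: (fB n m mn).
  have -> : \sum_(M <= m < n) B m = series B n - series B M.
    by rewrite /series /= [X in _ = X - _](@big_cat_nat _ _ _ M 0 n) //= addrAC subrr add0r.
  have : series B n <= limn (series B).
    apply: nondecreasing_cvgn_le => //; apply: nondecreasing_series => // i _ _; exact: B0.
  by move: h2; rewrite ler_norml => /andP[_ h2]; lra.
move: h1 h3; rewrite E !ler_norml => /andP[a1 a2] /andP[a3 a4]; move/andP: h4 => [a5 a6].
apply/andP; split; lra.
Unshelve. all: by end_near. Qed.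

End Tannery.

Section SquareMeans.
Context {R : realType}.

(** Off-diagonal pairs are grouped by their larger index [u] and their distance [m + 1]. *)
Lemma sum_symmetric_square (F : nat -> nat -> R) n : (forall s t, F s t = F t s) ->
  \sum_(u < n) \sum_(t < n) F u t = \sum_(u < n) (F u u + 2 * \sum_(m < u) F (u - m.+1)%N u).
Proof.
move=> FC; elim: n => [|n IHn]; first by rewrite !big_ord0.
rewrite [RHS]big_ord_recr /= -IHn big_ord_recr /= big_ord_recr /=.
under eq_bigr do rewrite big_ord_recr /=.
rewrite big_split /=.
have -> : \sum_(m < n) F (n - m.+1)%N n = \sum_(i < n) F i n.
  by rewrite [RHS](reindex_inj rev_ord_inj).
have -> : \sum_(i < n) F n i = \sum_(i < n) F i n by apply: eq_bigr => i _; exact: FC.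
ring.
Qed.

Variables (rho : int -> R) (u : nat -> R) (C b : R).
Hypothesis rhoE : forall k, rho k = u `|k|%N.
Hypothesis u_gt0 : forall j, 0 < u j.
Hypothesis C1 : 1 <= C.
Hypothesis b1 : 2^-1 < b < 1.
Hypothesis u_le : forall j, u j <= C * j.+1%:R `^ (- b).
Variable x : R.
Hypothesis x01 : 0 < x < 1.

Let b01 : 0 <= b <= 1. Proof. by apply/andP; case/andP: b1 => ? ?; split; lra. Qed.
Let K := C * (1 - x) ^- 4.
Let K0 : 0 <= K.
Proof.
apply: mulr_ge0; first exact: le_trans ler01 C1.
by rewrite invr_ge0 exprn_ge0 // subr_ge0 ltW //; case/andP: x01.
Qed.
Let g (s t : nat) := arcov rho x s.+1 t.+1 (t%:Z - s%:Z).

Let gC s t : g s t = g t s.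
Proof. by rewrite /g -[RHS](arcovC rhoE); congr arcov; ring. Qed.

Let g0 s t : 0 <= g s t.
Proof. exact: (@arcov_ge0 _ _ _ rhoE u_gt0 _ x01). Qed.

(** Grouped by the larger index, the inner sums over the lags converge by dominated convergence, the
    domination being summable because [2 b > 1], and Cesaro's theorem gives the limit of their
    means. *)
Lemma cvg_mean_sq_arcov :
  n%:R^-1 * (\sum_(s < n) \sum_(t < n) arcov rho x s.+1 t.+1 (t%:Z - s%:Z) ^+ 2) @[n --> \oo]
  --> fine (\esum_(k in [set: int]) (arlim rho x k ^+ 2)%:E).
Proof.
pose f n m := g (n - m.+1)%N n ^+ 2.
pose B m := (K * m.+2%:R `^ (- b)) ^+ 2.
have fB n m : (m < n)%N -> 0 <= f n m <= B m.
  move=> mn; rewrite sqr_ge0 /=; apply: lerXn2r; rewrite ?nnegrE ?g0 //.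
    by rewrite mulr_ge0 ?powR_ge0.
  have := @arcov_decay _ _ _ _ _ rhoE C1 b01 u_le _ x01 (n - m.+1).+1 n.+1 (n%:Z - (n - m.+1)%N%:Z).
  by rewrite (_ : `|n%:Z - (n - m.+1)%N%:Z|%N = m.+1) //; lia.
have cB : cvgn (series B).
  apply: nondecreasing_is_cvgn; first by apply: nondecreasing_series => m _ _; exact: sqr_ge0.
  exists (K ^+ 2 * (1 + (2 * b - 1)^-1)) => _ [n _ <-].
  rewrite /series /= big_mkord (eq_bigr (fun m : 'I_n => K ^+ 2 * (m.+2%:R `^ (- b)) ^+ 2)); last first.
    by move=> m _; rewrite /B exprMn.
  rewrite -mulr_sumr; apply: ler_wpM2l; first exact: sqr_ge0.
  apply: le_trans (sum_power_sqr b1 n.+1); rewrite big_ord_recl lerDr; exact: sqr_ge0.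
have fg m : f n m @[n --> \oo] --> arlim rho x m.+1%:Z ^+ 2.
  (* Shifting [n] by [m + 1] makes the truncated subtraction [n - m.+1] exact. *)
  rewrite -(cvg_shiftn m.+1).
  have h : arcov rho x n.+1 (n.+1 + m.+1) m.+1%:Z @[n --> \oo] --> arlim rho x m.+1%:Z.
    rewrite (cvg_shiftS (fun n => arcov rho x n (n + m.+1) m.+1%:Z)).
    exact: (@cvg_arcov_shift _ _ _ _ _ rhoE u_gt0 C1 b01 u_le _ x01).
  apply: (cvg_seq_ext (cvgM h h)) => [|n]; first by rewrite expr2.
  rewrite -[LHS]expr2 -[RHS]/(f (n + m.+1)%N m) /f /g addnK.
  by rewrite addSn PoszD addrAC subrr add0r.
have [cg tn] := cvg_tannery fB cB fg.
have g00 : g n n ^+ 2 @[n --> \oo] --> arlim rho x 0 ^+ 2.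
  have h : arcov rho x n.+1 n.+1 0 @[n --> \oo] --> arlim rho x 0.
    rewrite (cvg_shiftS (fun n => arcov rho x n n 0)).
    exact: (@cvg_arcov _ _ _ _ _ rhoE u_gt0 C1 b01 u_le _ x01).
  apply: (cvg_seq_ext (cvgM h h)) => [|n]; first by rewrite expr2.
  by rewrite /g subrr -[LHS]expr2.
rewrite (@esum_int_even _ (fun k => arlim rho x k ^+ 2) _ _ _ cg); last 2 first.
- by move=> k; exact: sqr_ge0.
- by move=> k; rewrite (arlimN rhoE).
rewrite -cvg_shiftS.
apply: (cvg_seq_ext (cesaro (cvgD g00 (cvg_scalel 2 tn))) erefl) => n.
rewrite /arithmetic_mean /series /=; congr (_ * _).
rewrite big_mkord -(@sum_symmetric_square (fun s t => g s t ^+ 2) n.+1) // => s t.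
by rewrite gC.
Qed.

End SquareMeans.

(** * The second moment function and its inverse *)

Section SecondMoment.
Context {R : realType}.
Variables (rho : int -> R) (u : nat -> R) (C b : R).
Hypothesis rhoE : forall k, rho k = u `|k|%N.
Hypothesis u0 : u 0%N = 1.
Hypothesis u_gt0 : forall j, 0 < u j.
Hypothesis C1 : 1 <= C.
Hypothesis b01 : 0 <= b <= 1.
Hypothesis u_le : forall j, u j <= C * j.+1%:R `^ (- b).

Let uC j : u j <= C.
Proof.
apply: le_trans (u_le j) _; rewrite ler_piMr ?(le_trans ler01) //.
rewrite powRN invf_le1 ?powR_gt0 ?ltr0n //.
by rewrite -[leLHS](powRr0 j.+1%:R) ler_powR ?ler1n //; case/andP: b01.
Qed.

Let C0 : 0 <= C. Proof. exact: le_trans C1. Qed.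

(** Serves the twice differentiated power series, whose convergence the differentiation theorem asks
    for; a closed form of the partial sums is verified by induction. *)
Lemma quadratic_geometric_sum_le (x : R) n : 0 <= x < 1 ->
  \sum_(j < n) x ^+ j * (j.+1 * j.+2)%:R <= 2 * (1 - x) ^- 3.
Proof.
move=> /andP[x0 x1]; have y0 : 0 < 1 - x by lra.
rewrite ler_pdivlMr ?exprn_gt0 //.
have -> : (\sum_(j < n) x ^+ j * (j.+1 * j.+2)%:R) * (1 - x) ^+ 3 =
    2 - x ^+ n * (n%:R ^+ 2 * (1 - x) ^+ 2 + n%:R * ((1 - x) * (3 - x)) + 2).
  elim: n => [|n IHn]; first by rewrite big_ord0; ring.
  by rewrite big_ord_recr /= mulrDl IHn (exprS x n) natrM -!natr1; ring.
rewrite lerBlDr lerDl mulr_ge0 ?exprn_ge0 // addr_ge0 // addr_ge0 ?mulr_ge0 ?sqr_ge0 ?(ltW y0) //.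
lra.
Qed.

Let pseries_bounded (c : nat -> R) (x K : R) : 0 <= x -> (forall j, 0 <= c j) ->
  (forall n, \sum_(j < n) c j * x ^+ j <= K) -> cvgn (pseries c x).
Proof.
move=> x0 c0 cK; apply: nondecreasing_is_cvgn.
  by apply: nondecreasing_series => j _ _; rewrite mulr_ge0 ?exprn_ge0.
by exists K => _ [n _ <-]; rewrite /pseries /series /= big_mkord.
Qed.

Section Point.
Variable x : R.
Hypothesis x01 : 0 < x < 1.
Let x0 : 0 <= x. Proof. by case/andP: x01 => /ltW. Qed.
Let x01' : 0 <= x < 1. Proof. by case/andP: x01 => /ltW -> ->. Qed.
Let y0 : 0 < 1 - x. Proof. by case/andP: x01; rewrite subr_gt0. Qed.

Let yx : 0 < 1 - x ^+ 2.
Proof. by rewrite subr_gt0 expr_lt1 //; case/andP: x01. Qed.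

Lemma cvg_pseries_cov : cvgn (pseries u x).
Proof.
apply: (@pseries_bounded _ _ (C * (1 - x)^-1)) => // [j|n]; first exact: ltW.
apply: (@le_trans _ _ (C * \sum_(j < n) x ^+ j)); last first.
  by apply: ler_wpM2l => //; exact: geometric_sum_le.
by rewrite mulr_sumr; apply: ler_sum => j _; apply: ler_wpM2r => //; exact: exprn_ge0.
Qed.

Lemma cvg_pseries_diffs_cov : cvgn (pseries (pseries_diffs u) x).
Proof.
apply: (@pseries_bounded _ _ (C * (1 - x) ^- 2)) => // [j|n].
  by rewrite /pseries_diffs mulr_ge0 // ltW.
apply: (@le_trans _ _ (C * \sum_(j < n) x ^+ j * j.+1%:R)); last first.
  by apply: ler_wpM2l => //; exact: arith_geometric_sum_le.
rewrite mulr_sumr; apply: ler_sum => j _; rewrite /pseries_diffs.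
rewrite [leLHS](_ : _ = u j.+1 * (x ^+ j * j.+1%:R)); last by ring.
by apply: ler_wpM2r => //; rewrite mulr_ge0 ?exprn_ge0.
Qed.

Lemma cvg_pseries_diffs2_cov : cvgn (pseries (pseries_diffs (pseries_diffs u)) x).
Proof.
apply: (@pseries_bounded _ _ (C * (2 * (1 - x) ^- 3))) => // [j|n].
  by rewrite /pseries_diffs !mulr_ge0 // ltW.
apply: (@le_trans _ _ (C * \sum_(j < n) x ^+ j * (j.+1 * j.+2)%:R)); last first.
  by apply: ler_wpM2l => //; exact: quadratic_geometric_sum_le.
rewrite mulr_sumr; apply: ler_sum => j _; rewrite /pseries_diffs.
rewrite [leLHS](_ : _ = u j.+2 * (x ^+ j * (j.+1 * j.+2)%:R)); last by rewrite natrM; ring.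
by apply: ler_wpM2r => //; rewrite mulr_ge0 ?exprn_ge0.
Qed.

Let B := limn (pseries u x).

Let partial_le n : pseries u x n <= B.
Proof.
apply: nondecreasing_cvgn_le; last exact: cvg_pseries_cov.
by apply: nondecreasing_series => j _ _; rewrite mulr_ge0 ?exprn_ge0 // ltW.
Qed.

Lemma pseries_cov_ge1 : 1 <= B.
Proof.
apply: le_trans (partial_le 1).
by rewrite /pseries /series /= big_nat1 u0 expr0 mulr1.
Qed.

(** The first row and the first column of the square of indices contribute [u_j x^j] each, the
    corner being counted once; the remaining square is the previous one times [x^2]. *)
Lemma arcov_diag_rec n :
  arcov rho x n.+1 n.+1 0 = x ^+ 2 * arcov rho x n n 0 + 2 * pseries u x n.+1 - 1.
Proof.
rewrite /pseries /series /= big_mkord [in RHS]big_ord_recl.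
rewrite {1}/arcov big_ord_recl big_ord_recl /=.
under [X in _ + X]eq_bigr do rewrite big_ord_recl /=.
rewrite big_split /=.
have e1 (m : nat) : x ^+ (0 + bump 0 m) * rho (0 + 0%:Z - (bump 0 m)%:Z) = u m.+1 * x ^+ m.+1.
  by rewrite mulrC rhoE /bump; congr (u _ * _); lia.
have e2 (m : nat) : x ^+ (bump 0 m + 0) * rho (0 + (bump 0 m)%:Z - 0%:Z) = u m.+1 * x ^+ m.+1.
  by rewrite mulrC rhoE /bump addn0; congr (u _ * _); lia.
rewrite (eq_bigr (fun i : 'I_n => u i.+1 * x ^+ i.+1)); last by move=> m _; rewrite e1.
rewrite [X in _ + (X + _)](eq_bigr (fun i : 'I_n => u i.+1 * x ^+ i.+1)); last by move=> m _; rewrite e2.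
rewrite [X in _ + (_ + X)](_ : _ = x ^+ 2 * arcov rho x n n 0); last first.
  rewrite /arcov mulr_sumr; apply: eq_bigr => i _; rewrite mulr_sumr; apply: eq_bigr => j _.
  rewrite mulrA -exprD /bump /= !add1n; congr (x ^+ _ * rho _); first by rewrite addSn addnS.
  by lia.
have -> : rho (0 + 0%:Z - 0%:Z) = 1 by rewrite rhoE u0.
rewrite [X in 2 * (_ + X)](eq_bigr (fun i : 'I_n => u i.+1 * x ^+ i.+1)) //.
rewrite addn0 expr0 u0 !mul1r; ring.
Qed.

(** The fixed point of the recursion. It gives the closed form [(2 B - 1) / (1 - x^2)], from which
    monotonicity and differentiability are read off. *)
Lemma arlim_pseries : (1 - x ^+ 2) * arlim rho x 0 = 2 * B - 1.
Proof.
have h := @cvg_arcov _ _ _ _ _ rhoE u_gt0 C1 b01 u_le _ x01 0.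
have h2 : arcov rho x n.+1 n.+1 0 @[n --> \oo] --> arlim rho x 0.
  by rewrite (cvg_shiftS (fun n => arcov rho x n n 0)).
have h3 : pseries u x n.+1 @[n --> \oo] --> B.
  by rewrite (cvg_shiftS (pseries u x)); exact: cvg_pseries_cov.
have h4 : x ^+ 2 * arcov rho x n n 0 + 2 * pseries u x n.+1 - 1 @[n --> \oo] -->
    x ^+ 2 * arlim rho x 0 + 2 * B - 1.
  by apply: cvgB; [apply: cvgD; apply: cvgMr|exact: cvg_cst].
have := seq_cvg_unique h2 h4 arcov_diag_rec.
lra.
Qed.

(** The definition nests two limits, while [arlim] is a limit along squares; as all terms are
    nonnegative, each bounds the other. *)
Lemma second_moment_arlim : second_moment rho x = arlim rho x 0.
Proof.
pose F (i j : nat) := x ^+ (i + j) * rho (i%:Z - j%:Z).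
have FE n m : arcov rho x n m 0 = \sum_(i < n) \sum_(j < m) F i j.
  by rewrite /arcov; apply: eq_bigr => i _; apply: eq_bigr => j _; rewrite add0r.
have F0 i j : 0 <= F i j by rewrite mulr_ge0 ?exprn_ge0 // rhoE ltW.
have le_al := arcov_le_arlim rhoE u_gt0 C1 b01 u_le x01.
have cin i : cvgn (series (F i)).
  apply: nondecreasing_is_cvgn; first by apply: nondecreasing_series => j _ _; exact: F0.
  exists (arlim rho x 0) => _ [n _ <-]; apply: le_trans (le_al i.+1 n 0).
  rewrite FE big_ord_recr /= /series /= big_mkord lerDr; apply: sumr_ge0 => k _.
  by apply: sumr_ge0.
apply/cvg_lim => //.
apply: (squeeze_cvgr _ (@cvg_arcov _ _ _ _ _ rhoE u_gt0 C1 b01 u_le _ x01 0) (cvg_cst _)).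
apply: nearW => n; apply/andP; split.
  rewrite FE /series /= big_mkord; apply: ler_sum => i _.
  rewrite -(big_mkord xpredT (F i)); apply: (@nondecreasing_cvgn_le _ (series (F i))).
    by apply: nondecreasing_series => j _ _; exact: F0.
  exact: cin.
have cs : \sum_(i < n) series (F i) m @[m --> \oo] --> series (fun i => limn (series (F i))) n.
  rewrite /series /= big_mkord; elim: (n) => [|k IHk].
    by rewrite big_ord0; under eq_cvg do rewrite big_ord0; exact: cvg_cst.
  by rewrite big_ord_recr /=; under eq_cvg do rewrite big_ord_recr /=; apply: cvgD => //; exact: cin.
apply: (ler_cvg_to cs (cvg_cst (arlim rho x 0))); apply: nearW => m.
apply: le_trans (le_al n m 0); rewrite FE.
by apply: ler_sum => i _; rewrite /series /= big_mkord.
Qed.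

Lemma second_moment_pseries : second_moment rho x = (2 * B - 1) / (1 - x ^+ 2).
Proof.
rewrite second_moment_arlim -arlim_pseries mulrAC divff ?mul1r // gt_eqF // yx.
Qed.

(** The errors satisfy [e (n+1) = x^2 e n] plus a tail of order [x^n], and summing this recursion
    bounds their total. It is the accumulated bias of the second moments of the process started at
    0. *)
Lemma sum_arlim_sub_arcov_le : exists K : R, forall N,
  \sum_(n < N) `|arlim rho x 0 - arcov rho x n.+1 n.+1 0| <= K.
Proof.
pose e n := arlim rho x 0 - arcov rho x n n 0.
have e0 n : 0 <= e n by rewrite subr_ge0; exact: (arcov_le_arlim rhoE u_gt0 C1 b01 u_le x01).
have tail n : B - pseries u x n <= C * x ^+ n * (1 - x)^-1.
  rewrite lerBlDr; apply: (limr_le cvg_pseries_cov); near=> m.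
  have nm : (n <= m)%N by near: m; exact: nbhs_infty_ge.
  rewrite {1}/pseries /series /= (@big_cat_nat _ _ _ n) //= addrC lerD2r.
  rewrite -{1}(add0n n) big_addn big_mkord.
  apply: (@le_trans _ _ (C * x ^+ n * \sum_(j < m - n) x ^+ j)); last first.
    by apply: ler_wpM2l; [rewrite mulr_ge0 ?exprn_ge0|exact: geometric_sum_le].
  rewrite mulr_sumr; apply: ler_sum => j _; rewrite -mulrA -exprD addnC.
  by apply: ler_wpM2r => //; exact: exprn_ge0.
have rec n : e n.+1 = x ^+ 2 * e n + 2 * (B - pseries u x n.+1).
  by rewrite /e arcov_diag_rec; have := arlim_pseries; lra.
pose K0 := e 0%N + 2 * (C * (1 - x)^-1 * (1 - x)^-1).
exists (K0 / (1 - x ^+ 2)) => N.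
rewrite (eq_bigr (fun n : 'I_N => e n.+1)); last by move=> n _; rewrite ger0_norm // e0.
suff h : \sum_(n < N.+1) e n <= K0 / (1 - x ^+ 2).
  by apply: le_trans h; rewrite big_ord_recl lerDr.
set S := \sum_(n < N.+1) e n.
have SE : S = e 0%N + \sum_(i < N) e i.+1 by rewrite /S big_ord_recl.
have h1 : \sum_(i < N) e i.+1 <= x ^+ 2 * S + 2 * (C * (1 - x)^-1 * (1 - x)^-1).
  rewrite (eq_bigr (fun i : 'I_N => x ^+ 2 * e i + 2 * (B - pseries u x i.+1))) //.
  rewrite big_split /= -!mulr_sumr; apply: lerD.
    by apply: ler_wpM2l; [exact: sqr_ge0|rewrite /S big_ord_recr /= lerDl].
  apply: ler_wpM2l => //.
  apply: (@le_trans _ _ (\sum_(i < N) C * (1 - x)^-1 * x ^+ i)).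
    apply: ler_sum => i _; apply: le_trans (tail i.+1) _; rewrite mulrAC; apply: ler_wpM2l.
      by rewrite mulr_ge0 // invr_ge0 ltW.
    by rewrite exprS ler_piMl ?exprn_ge0 // ltW //; case/andP: x01.
  rewrite -mulr_sumr; apply: ler_wpM2l; last exact: geometric_sum_le.
  by rewrite mulr_ge0 // invr_ge0 ltW.
rewrite ler_pdivlMr //; move: h1; rewrite /K0.
by move: SE => /(congr1 (fun z => z - e 0%N)); rewrite addrAC subrr add0r => <-; lra.
Unshelve. all: by end_near. Qed.

End Point.
End SecondMoment.

Section SecondMomentInverse.
Context {R : realType}.
Variables (rho : int -> R) (u : nat -> R) (C b : R).
Hypothesis rhoE : forall k, rho k = u `|k|%N.
Hypothesis u0 : u 0%N = 1.
Hypothesis u_gt0 : forall j, 0 < u j.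
Hypothesis C1 : 1 <= C.
Hypothesis b01 : 0 <= b <= 1.
Hypothesis u_le : forall j, u j <= C * j.+1%:R `^ (- b).

Let cvgu x (x01 : 0 < x < 1) : cvgn (pseries u x) :=
  cvg_pseries_cov u_gt0 C1 b01 u_le x01.

(** In the closed form the numerator is positive and nondecreasing, and the denominator decreases
    strictly. *)
Lemma second_moment_lt (x y : R) : 0 < x -> x < y -> y < 1 ->
  second_moment rho x < second_moment rho y.
Proof.
move=> x0 xy y1; have x01 : 0 < x < 1 by rewrite x0 (lt_trans xy).
have y01 : 0 < y < 1 by rewrite y1 (lt_trans x0).
rewrite !(second_moment_pseries rhoE u0 u_gt0 C1 b01 u_le) //.
have Bxy : limn (pseries u x) <= limn (pseries u y).
  apply: (ler_cvg_to (cvgu x01) (cvgu y01)); apply: nearW => n.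
  apply: ler_sum => j _; apply: ler_wpM2l; first exact: ltW.
  by apply: lerXn2r; rewrite ?nnegrE ltW // (lt_trans x0).
have Bx := pseries_cov_ge1 u0 u_gt0 C1 b01 u_le x01.
have xx : x ^+ 2 < y ^+ 2 by rewrite ltr_pXn2r // ?nnegrE ltW // (lt_trans x0).
have yy : y ^+ 2 < 1 by rewrite expr_lt1 // ltW // (lt_trans x0).
apply: (@lt_le_trans _ _ ((2 * limn (pseries u x) - 1) / (1 - y ^+ 2))).
  rewrite ltr_pM2l; last by lra.
  by rewrite ltf_pV2 ?posrE; lra.
by rewrite ler_pM2r ?invr_gt0; lra.
Qed.

Lemma is_derive_second_moment (x : R) : 0 < x < 1 ->
  exists2 l, 0 < l & is_derive x 1 (second_moment rho) l.
Proof.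
move=> x01; have [x0 x1] := andP x01.
(* A point beyond [x], since a power series is differentiated strictly inside an interval of
   convergence. *)
have [K [xK K1]] : exists K, x < K /\ K < 1.
  by exists ((x + 1) / 2); split; lra.
have K01 : 0 < K < 1 by rewrite K1 (lt_trans x0).
have xKn : `|x| < `|K| by rewrite !gtr0_norm // (lt_trans x0).
have dB := pseries_snd_diffs (cvgu K01) (cvg_pseries_diffs_cov u_gt0 C1 b01 u_le K01)
  (cvg_pseries_diffs2_cov u_gt0 C1 b01 u_le K01) xKn.
set B' := limn (pseries (pseries_diffs u) x) in dB.
have B'0 : 0 <= B'.
  apply: (limr_ge (cvg_pseries_diffs_cov u_gt0 C1 b01 u_le x01)).
  apply: nearW => n; apply: sumr_ge0 => j _.
  by rewrite mulr_ge0 ?exprn_ge0 ?(ltW x0) // mulr_ge0 // ltW.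
have B1 := pseries_cov_ge1 u0 u_gt0 C1 b01 u_le x01.
have yx : 0 < 1 - x ^+ 2 by rewrite subr_gt0 expr_lt1 // ltW.
pose B z := limn (pseries u z).
pose l := (2 * B' * (1 - x ^+ 2) + 2 * x * (2 * B x - 1)) / (1 - x ^+ 2) ^+ 2.
exists l.
  apply: divr_gt0; last by rewrite exprn_gt0.
  apply: ltr_wpDl; first by rewrite !mulr_ge0 // ltW.
  by rewrite !mulr_gt0 // /B; lra.
apply: (@near_eq_is_derive _ _ _ (fun z => (2 * B z - 1) / (1 - z ^+ 2))).
  near=> z; rewrite (second_moment_pseries rhoE u0 u_gt0 C1 b01 u_le) //.
  have zx : z \in `]0, 1[ by near: z; apply: near_in_itvoo; rewrite in_itv.
  by rewrite in_itv in zx.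
have d1 : is_derive x 1 (fun z : R => 2 * B z - 1) (2 * B').
  have H := is_deriveB (is_deriveZ 2 dB) (is_derive_cst (1 : R) x 1).
  by apply: (is_derive_eq H); rewrite subr0.
have d2 : is_derive x 1 (fun z : R => 1 - z ^+ 2) (- (2 * x)).
  by apply: is_derive_eq; rewrite -?[_ *: _]/(_ * _) /=; ring.
have nz : 1 - x ^+ 2 != 0 by rewrite gt_eqF.
have H := is_deriveM d1 (@is_deriveV _ (fun z : R => 1 - z ^+ 2) _ _ _ nz d2).
apply: (is_derive_eq H); rewrite -![_ *: _]/(_ * _) /l.
by move: (B x) => q; field.
Unshelve. all: by end_near. Qed.

Lemma second_moment_invK (x : R) : 0 < x < 1 -> second_moment_inv rho (second_moment rho x) = x.
Proof.
move=> x01; rewrite /second_moment_inv pinvKV //; last by rewrite inE /= in_itv.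
move=> y z; rewrite !inE /= !in_itv /= => /andP[y0 y1] /andP[z0 z1] E.
have [yz|zy|//] := ltgtP y z.
  by have := second_moment_lt y0 yz z1; rewrite E ltxx.
by have := second_moment_lt z0 zy y1; rewrite E ltxx.
Qed.

Lemma is_derive_second_moment_inv (x : R) : 0 < x < 1 ->
  0 < derive1 (second_moment rho) x /\
  is_derive (second_moment rho x) 1 (second_moment_inv rho) (derive1 (second_moment rho) x)^-1.
Proof.
move=> x01; have [l l0 dl] := is_derive_second_moment x01.
have -> : derive1 (second_moment rho) x = l by rewrite derive1E; case: dl.
split=> //; apply: is_derive_inverse => //; last by rewrite gt_eqF.
  near=> z; apply: second_moment_invK.
  have zx : z \in `]0, 1[ by near: z; apply: near_in_itvoo; rewrite in_itv.
  by rewrite in_itv in zx.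
near=> z.
have zx : z \in `]0, 1[ by near: z; apply: near_in_itvoo; rewrite in_itv.
rewrite in_itv /= in zx; have [m _ dm] := is_derive_second_moment zx.
by apply: differentiable_continuous; apply/derivable1_diffP; case: dm.
Unshelve. all: by end_near. Qed.

End SecondMomentInverse.

(** * Linearization of the estimator *)

Section DeltaMethod.
Context {R : realType}.

Lemma is_derive_linear_approx (h : R -> R) (y l eta : R) : is_derive y 1 h l -> 0 < eta ->
  exists2 del, 0 < del & forall z, `|z| <= del -> `|h (y + z) - h y - l * z| <= eta * `|z|.
Proof.
move=> [dh <-] eta0.
have /cvgrPdist_le/(_ _ eta0) [del /= d0 hd] := dh.
have d2 : 0 < del / 2 by rewrite divr_gt0.
exists (del / 2) => // z zd.
have [->|z0] := eqVneq z 0; first by rewrite addr0 subrr mulr0 subr0 normr0 mulr0.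
have zl : `|0 - z| < del.
  by rewrite sub0r normrN (le_lt_trans zd) // ltr_pdivrMr // ltr_pMr // ltr1n.
have := hd z zl z0; rewrite -![_ *: _]/(_ * _) /= mulr1.
have -> : 'D_1 h y = lim (h0^-1 *: ((h \o shift y) (h0 *: 1) - h y) @[h0 --> 0^']) by [].
set L := lim _ => hL.
have -> : h (y + z) - h y - L * z = - (L - z^-1 * (h (z + y) - h y)) * z.
  by rewrite (addrC z); field.
by rewrite normrM normrN ler_pM2r // normr_gt0.
Qed.

(** In the application [D] is the derivative of the second moment function, [v k = 1 / sqrt k],
    [s k] the rescaled standard deviation and [q k] the rescaled bias. The threshold is uniform in
    [|F| <= A], hence independent of the sample point. *)
Lemma delta_method (h : R -> R) (y D sigma : R) (s q v : nat -> R) :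
  0 < D -> 0 < sigma -> is_derive y 1 h D^-1 ->
  s k @[k --> \oo] --> sigma -> q k @[k --> \oo] --> 0 -> v k @[k --> \oo] --> 0 ->
  (forall k, (0 < k)%N -> 0 < v k) ->
  forall A e, 0 < e -> exists K, forall k, (K <= k)%N -> forall F, `|F| <= A ->
    `|D / v k * (h (y + v k * (s k * F + q k)) - h y) / sigma - F| <= e.
Proof.
move=> D0 s0 dh ss qq vv v0 A e e0.
have [A0|A0] := ltP A 0.
  by exists 0%N => k _ F FA; have := le_trans (normr_ge0 F) FA; rewrite leNgt A0.
pose W := (sigma + 1) * A + 1.
have W0 : 0 < W by rewrite ltr_wpDl // mulr_ge0 // addr_ge0 // ltW.
have es : 0 < e * sigma / 4 by rewrite divr_gt0 // mulr_gt0.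
(* The allowance [e sigma] is split into a half for the nonlinearity of [h], controlled by [eta] on
   increments at most [v k W], and a quarter each for [s k - sigma] and [q k]. *)
pose eta := e * sigma / 2 / (D * W).
have eta0 : 0 < eta by rewrite !divr_gt0 ?mulr_gt0.
have [del d0 hdel] := is_derive_linear_approx dh eta0.
have c1 : 0 < e * sigma / 4 / (A + 1) by rewrite divr_gt0 // ltr_wpDl.
have c2 : 0 < del / W by rewrite divr_gt0.
have /cvgrPdist_le/(_ _ c1) hs := ss.
have /cvgrPdist_le/(_ _ ltr01) hs1 := ss.
have /cvgrPdist_le/(_ _ es) hq := qq.
have /cvgrPdist_le/(_ _ ltr01) hq1 := qq.
have /cvgrPdist_le/(_ _ c2) hv := vv.
have [K [_ hK]] : exists K, True /\ forall k, (K <= k)%N ->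
   [/\ `|sigma - s k| <= e * sigma / 4 / (A + 1), `|sigma - s k| <= 1,
      `|q k| <= e * sigma / 4, `|q k| <= 1 & 0 < v k <= del / W].
  have : \forall k \near \oo, [/\ `|sigma - s k| <= e * sigma / 4 / (A + 1), `|sigma - s k| <= 1,
      `|q k| <= e * sigma / 4, `|q k| <= 1 & 0 < v k <= del / W].
    near=> k; split.
    - by near: k; exact: hs.
    - by near: k; exact: hs1.
    - have : `|0 - q k| <= e * sigma / 4 by near: k; exact: hq.
      by rewrite sub0r normrN.
    - have : `|0 - q k| <= 1 by near: k; exact: hq1.
      by rewrite sub0r normrN.
    - have k0 : 0 < v k by apply: v0; near: k; exact: nbhs_infty_gt.
      rewrite k0 /=; have : `|0 - v k| <= del / W by near: k; exact: hv.
      by rewrite sub0r normrN gtr0_norm.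
  by move=> [K _ hK]; exists K.
exists K => k /hK [a1 a2 a3 a4 /andP[vk0 vk1]] F FA.
set Y := s k * F + q k.
have YW : `|Y| <= W.
  apply: le_trans (ler_normD _ _) _; apply: lerD => //; rewrite normrM.
  apply: ler_pM => //; move: a2; rewrite !ler_norml => /andP[g1 g2].
  by apply/andP; split; lra.
have zd : `|v k * Y| <= del.
  rewrite normrM (gtr0_norm vk0); apply: (@le_trans _ _ (del / W * W)).
    by apply: ler_pM => //; exact: ltW.
  by rewrite divfK // gt_eqF.
have := hdel _ zd; set q1 := h _ - h y; rewrite normrM (gtr0_norm vk0) => h1.
have E : D / v k * q1 / sigma - F =
   (D / v k * (q1 - D^-1 * (v k * Y)) + ((s k - sigma) * F + q k)) / sigma.
  by rewrite /Y; field; rewrite !gt_eqF.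
rewrite E normrM normfV (gtr0_norm s0) ler_pdivrMr //.
apply: le_trans (ler_normD _ _) _.
have -> : e * sigma = e * sigma / 2 + (e * sigma / 4 + e * sigma / 4) by field.
apply: lerD.
  rewrite normrM (gtr0_norm (divr_gt0 D0 vk0)).
  apply: (@le_trans _ _ (D / v k * (eta * (v k * W)))).
    apply: ler_wpM2l; first by rewrite divr_ge0 // ltW.
    apply: le_trans h1 _; apply: ler_wpM2l; first exact: ltW.
    by apply: ler_wpM2l => //; exact: ltW.
  rewrite le_eqVlt; apply/orP; left; apply/eqP; rewrite /eta; field.
  by rewrite !gt_eqF.
apply: le_trans (ler_normD _ _) _; apply: lerD => //.
rewrite normrM distrC; apply: (@le_trans _ _ (e * sigma / 4 / (A + 1) * (A + 1))).
  by apply: ler_pM => //; apply: le_trans FA _; rewrite lerDl.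
by rewrite divfK // gt_eqF // ltr_wpDl.
Unshelve. all: by end_near. Qed.

End DeltaMethod.

Section Estimator.
Context d (T : measurableType d) (R : realType) (P : probability T R).
Variable xi : int -> {RV P >-> R}.
Hypothesis xi_gauss : gaussian_process xi.
Hypothesis xi_centered : centered xi.
Hypothesis xi_stat : stationary xi.
Variables (u : nat -> R) (C b : R).
Hypothesis rhoE : forall k, autocov P xi k = u `|k|%N.
Hypothesis u0 : u 0%N = 1.
Hypothesis u_gt0 : forall j, 0 < u j.
Hypothesis C1 : 1 <= C.
Hypothesis b1 : 2^-1 < b < 1.
Hypothesis u_le : forall j, u j <= C * j.+1%:R `^ (- b).
Variable theta : R.
Hypothesis theta01 : 0 < theta < 1.

Local Notation ind z := (\1_(`]-oo, z]%classic) : R -> R).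
Let rho := autocov P xi.
Let b01 : 0 <= b <= 1. Proof. by apply/andP; case/andP: b1 => ? ?; split; lra. Qed.
Let X (n : nat) := ar1 xi theta n.+1.
Let GS := linear_span_gaussian xi_gauss xi_centered.
Let GX n : linear_span xi (X n). Proof. exact: linear_span_ar1. Qed.
Let gramE s t : gram P X s t = arcov rho theta s.+1 t.+1 (t%:Z - s%:Z).
Proof. exact: gram_ar1. Qed.
Let gram0 s t : 0 <= gram P X s t.
Proof. by rewrite gramE; exact: (@arcov_ge0 _ _ _ rhoE u_gt0 _ theta01). Qed.
Let gram1 t : 1 <= gram P X t t.
Proof. by rewrite gramE subrr; exact: (@arcov_diag_ge1 _ _ _ rhoE u0 u_gt0 _ theta01). Qed.
Let K := C * (1 - theta) ^- 4.
Let K0 : 0 <= K.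
Proof.
apply: mulr_ge0; first exact: le_trans ler01 C1.
by rewrite invr_ge0 exprn_ge0 // subr_ge0 ltW //; case/andP: theta01.
Qed.
Let gram_le s t : gram P X s t <= K * (`|t%:Z - s%:Z|%N).+1%:R `^ (- b).
Proof. by rewrite gramE; exact: (@arcov_decay _ _ _ _ _ rhoE C1 b01 u_le _ theta01). Qed.

(** Row sums of the covariance matrix are [O(k^(1-b))], which is [k^(1/2 - a)] for [a = b - 1/2];
    sums of squares along a row are bounded because [2 b > 1]. *)
Lemma ae_log_equi_std_sumsq :
  {ae P, forall w, forall z, log_equi (fun k => std_sumsq P X k w) (ind z)}.
Proof.
have [b2 b3] := andP b1.
pose C' := 1 + K * (4 / (1 - b)) + K ^+ 2 * (2 * (1 + (2 * b - 1)^-1)).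
have p1 : 0 <= K * (4 / (1 - b)) by rewrite mulr_ge0 // divr_ge0 // subr_ge0 ltW.
have p2 : 0 <= K ^+ 2 * (2 * (1 + (2 * b - 1)^-1)).
  by rewrite mulr_ge0 ?sqr_ge0 // mulr_ge0 // addr_ge0 // invr_ge0; lra.
apply: (@ae_log_equi_ind _ _ _ _ _ GS X GX gram0 gram1 (b - 2^-1) C').
- by rewrite subr_gt0.
- by rewrite /C'; lra.
- move=> k s sk; apply: (@le_trans _ _ (K * \sum_(t < k) (`|t%:Z - s%:Z|%N).+1%:R `^ (- b))).
    by rewrite mulr_sumr; apply: ler_sum => t _; exact: gram_le.
  apply: (@le_trans _ _ (K * (4 / (1 - b) * k%:R `^ (1 - b)))).
    by apply: ler_wpM2l => //; exact: sum_dist_power_row.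
  rewrite (_ : 2^-1 - (b - 2^-1) = 1 - b); last by field.
  by rewrite mulrA; apply: ler_wpM2r; [exact: powR_ge0|rewrite /C'; lra].
- move=> s l; apply: (@le_trans _ _ (K ^+ 2 * \sum_(t < l) ((`|t%:Z - s%:Z|%N).+1%:R `^ (- b)) ^+ 2)).
    rewrite mulr_sumr; apply: ler_sum => t _; rewrite -exprMn.
    by apply: lerXn2r; rewrite ?nnegrE ?gram0 // mulr_ge0 ?powR_ge0.
  apply: (@le_trans _ _ (K ^+ 2 * (2 * (1 + (2 * b - 1)^-1)))).
    by apply: ler_wpM2l; [exact: sqr_ge0|exact: sum_dist_power_sqr].
  by rewrite /C'; lra.
Qed.

Lemma cvg_sumsq_sd :
  sumsq_sd P X k / Num.sqrt k%:R @[k --> \oo] --> sigma_ar1 xi theta.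
Proof.
have h := @cvg_mean_sq_arcov _ _ _ _ _ rhoE u_gt0 C1 b1 u_le _ theta01.
have E : sigma_ar1 xi theta = Num.sqrt (2 * fine (\esum_(k in [set: int]) (arlim rho theta k ^+ 2)%:E)).
  rewrite /sigma_ar1; congr (Num.sqrt (2 * fine _)); apply: eq_esum => k _.
  by rewrite (autocov_stationary_ar1 xi_gauss xi_centered xi_stat rhoE u0 u_gt0 C1 b01 u_le theta01).
rewrite E; apply: (cvg_seq_ext (cvg_comp _ _ (cvg_scalel 2 h) (@sqrt_continuous R _)) erefl) => k /=.
rewrite /sumsq_sd -sqrtrV ?ler0n // -sqrtrM; last first.
  rewrite mulr_ge0 //; apply: sumr_ge0 => s _; apply: sumr_ge0 => t _; exact: sqr_ge0.
congr Num.sqrt; rewrite mulrCA mulrC; congr (_ * _ * _).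
by apply: eq_bigr => s _; apply: eq_bigr => t _; rewrite gramE.
Qed.

(** A limit of ratios that are at least 1, because the diagonal of the covariance matrix is. *)
Lemma sigma_ar1_gt0 : 0 < sigma_ar1 xi theta.
Proof.
apply: (@lt_le_trans _ _ 1) => //.
apply: (ler_cvg_to (cvg_cst (1 : R)) (@cvg_sumsq_sd)); near=> k.
have k0 : (0 < k)%N by near: k; exact: nbhs_infty_gt.
have kR : 0 < k%:R :> R by rewrite ltr0n.
rewrite ler_pdivlMr ?sqrtr_gt0 // mul1r /sumsq_sd ler_wsqrtr //.
have := gram_norm2_lb gram0 gram1 k; have := ler0n R k.
by move: (gram_norm2 _ _ _ _) => q; lra.
Unshelve. all: by end_near. Qed.

(** The empirical second moment is [f0 + v k (s k F + q k)], where [F] is the standardized sum of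
    squares and [q k = v k r k] the rescaled bias, so the delta method applies. *)
Lemma normalized_error_approx w A e : 0 < e -> exists K, forall k, (K <= k)%N ->
  `|std_sumsq P X k w| <= A -> `|normalized_error xi theta k w - std_sumsq P X k w| <= e.
Proof.
move=> e0.
have [D0 dinv] := is_derive_second_moment_inv rhoE u0 u_gt0 C1 b01 u_le theta01.
set D := derive1 _ _ in D0 dinv.
pose f0 := second_moment rho theta.
(* The bias of the sum of squares stays bounded in [k], hence vanishes after division by
   [sqrt k]. *)
pose r k := \sum_(t < k) (gram P X t t - f0).
pose v (k : nat) : R := (Num.sqrt k%:R)^-1.
have v0 k : (0 < k)%N -> 0 < v k by move=> k0; rewrite invr_gt0 sqrtr_gt0 ltr0n.
have vv : v k @[k --> \oo] --> 0.
  have h : (k%:R)^-1 @[k --> \oo] --> (0 : R).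
    by rewrite -(cvg_shiftS (fun k => k%:R^-1 : R)); exact: cvg_harmonic.
  apply: (cvg_seq_ext (cvg_comp _ _ h (@sqrt_continuous R _)) (sqrtr0 _)) => k /=.
  by rewrite /v sqrtrV ?ler0n.
have [B hB] := sum_arlim_sub_arcov_le rhoE u0 u_gt0 C1 b01 u_le theta01.
have rB k : `|r k| <= B.
  apply: le_trans (ler_norm_sum _ _ _) _; apply: le_trans (hB k).
  rewrite le_eqVlt; apply/orP; left; apply/eqP; apply: eq_bigr => t _.
  by rewrite gramE subrr distrC /f0 (second_moment_arlim rhoE u_gt0 C1 b01 u_le theta01).
have qq : v k * r k @[k --> \oo] --> 0.
  have h := cvg_scalel B vv; rewrite mulr0 in h; apply: cvg0_le h => k.
  rewrite !normrM mulrC; apply: ler_wpM2r => //.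
  by apply: le_trans (rB k) _; exact: ler_norm.
have [M hM] := delta_method D0 sigma_ar1_gt0 dinv cvg_sumsq_sd qq vv v0 A e0.
(* The threshold is raised by one to have [k > 0], so that [k] cancels its inverse. *)
exists M.+1 => k Mk FA; have k0 : (0 < k)%N by exact: leq_trans Mk.
have := hM k (ltnW Mk) _ FA.
rewrite (second_moment_invK rhoE u0 u_gt0 C1 b01 u_le theta01).
congr (`|_ - _| <= _); rewrite /normalized_error -/D.
have kR : 0 < k%:R :> R by rewrite ltr0n.
have sk : 0 < Num.sqrt k%:R :> R by rewrite sqrtr_gt0.
have Ek : k%:R = Num.sqrt k%:R ^+ 2 :> R by rewrite sqr_sqrtr // ltW.
rewrite {1}/v invrK; congr (_ * (_ - _) / _).
rewrite /moment_estimator -/rho; congr (second_moment_inv rho _).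
have -> : \sum_(1 <= t < k.+1) ar1 xi theta t w ^+ 2 = sumsq X k w.
  by rewrite big_add1 big_mkord.
have S0 := sumsq_sd_gt0 gram0 gram1 k0.
have -> : sumsq X k w = sumsq_sd P X k * std_sumsq P X k w + \sum_(t < k) gram P X t t.
  by rewrite /std_sumsq mulrCA divff ?mulr1 ?subrK // gt_eqF.
rewrite /r sumrB sumr_const card_ord -[f0 *+ k]mulr_natl /v.
move: (std_sumsq _ _ _ _) (sumsq_sd _ _ _) (\sum_(t < k) _) => F S Q.
have key (y f : R) : 0 < y ->
    f + y^-1 * (S / y * F + y^-1 * (Q - y ^+ 2 * f)) = y ^- 2 * (S * F + Q).
  by move=> y0; field; rewrite gt_eqF.
by have := key _ f0 sk; rewrite -Ek.
Qed.

End Estimator.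

Theorem theorem1p5 (R : realType)
    (d : measure_display) (T : measurableType d) (P : probability T R)
    (H theta : R) (xi : int -> {RV P >-> R})
    (d' : measure_display) (T' : measurableType d') (Q : probability T' R)
    (Z : {RV Q >-> R})
    (hH : 1 / 2 < H < 3 / 4) (htheta : 0 < theta < 1)
    (xi_gauss : gaussian_process xi) (xi_stat : stationary xi)
    (xi_centered : centered xi)
    (xi_cov : lrd_covariance H (autocov P xi))
    (Z_gauss : forall A, measurable A ->
       distribution Q Z A = normal_prob 0 1 A) :
  let G := normalized_error xi theta in
  {ae P, forall w, forall z : R,
     log_average (fun k => \1_[set x | x <= z] (G k w)) n @[n --> \oo]
       --> fine (Q [set v | Z v <= z])} /\
  {ae P, forall w, forall phi : R -> R, continuous phi -> bounded_fun phi ->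
     log_average (fun k => phi (G k w)) n @[n --> \oo]
       --> fine ('E_Q[phi \o Z])%E}.
Proof.
move=> G.
have [hH1 hH2] := andP hH.
have [u [C [rhoE u0 u_gt0 C1 u_le]]] := lrd_decay hH2 xi_cov.
have b1 : 2^-1 < 5 / 4 - H < 1 by apply/andP; split; lra.
pose N : probability (measurableTypeR R) R := normal_prob (0 : R) 1.
pose ind z : R -> R := \1_(`]-oo, z]%classic).
have lawZ (g : R -> R) : measurable_fun [set: R] g -> mom N g -> Ex Q (g \o Z) = Ex N g.
  by move=> mg hg; have [] := @law_transfer _ _ _ Q Z N _ Z_gauss g mg hg.
have setE (z : R) : [set t : R | t <= z] = `]-oo, z]%classic.
  by apply/seteqP; split=> t /=; rewrite in_itv.
have QE z : fine (Q [set v | Z v <= z]) = Ex N (ind z).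
  have -> : Q [set v | Z v <= z] = distribution Q Z [set t | t <= z] by [].
  rewrite setE Z_gauss; last exact: measurable_itv.
  by rewrite /Ex /Rintegral integral_indic ?setIT //; exact: measurable_itv.
have EE (phi : R -> R) (M : R) : continuous phi -> (forall t, `|phi t| <= M) ->
    fine ('E_Q[phi \o Z])%E = Ex N phi.
  move=> cphi phiM; rewrite unlock -lawZ //; first exact: continuous_measurable_fun.
  by apply: (@mom_bnd _ _ R N _ M) => //; exact: continuous_measurable_fun.
(* A single null set serves all thresholds and, through step functions, all bounded continuous
   [phi]. *)
have main : {ae P, forall w, forall z, log_equi (fun k => G k w) (ind z)}.
  apply: filterS (ae_log_equi_std_sumsq xi_gauss xi_centered xi_stat rhoE u0 u_gt0 C1 b1 u_le htheta).
  move=> w hw; apply: (log_equi_transfer hw) => A e e0.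
  exact: (normalized_error_approx xi_gauss xi_centered xi_stat rhoE u0 u_gt0 C1 b1 u_le htheta).
split; apply: filterS main => w hw.
  move=> z; have [_] := hw z; by rewrite QE setE.
move=> phi cphi [M [_ hM]].
(* Boundedness provides the bound by every number above [M], here [M + 1]. *)
have phiM t : `|phi t| <= M + 1 by apply: hM; rewrite ?ltrDl.
by have [_] := log_equi_bounded cphi phiM hw; rewrite (EE _ (M + 1)).
Qed.
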